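(* Let $f\in C^2(\mathbb{R})$ have uniformly bounded second derivative and satisfy $f(0)=0$, $f'(0)=0$. Let $\varphi\in L^1(\mathbb{R}^n)$ satisfy $\varphi\ge 0$ in $\mathbb{R}^n$, $\int_{\mathbb{R}^n}\varphi=1$, $\int_{\mathbb{R}^n}y\,\varphi(y)\,dy=0$ and $\int_{\mathbb{R}^n}|y|^2\varphi(y)\,dy<\infty$, and for $\varepsilon>0$ let $\varphi_\varepsilon(x)=\varepsilon^{-n}\varphi(x/\varepsilon)$. Then for any $u\in W^{1,2}(\mathbb{R}^n)$, with $u_\varepsilon=u*\varphi_\varepsilon$, $$\lim_{\varepsilon\to0}\frac1{\varepsilon^2}\int_{\mathbb{R}^n}\bigl[f(u)-f(u_\varepsilon)\bigr]\,dx=\frac12\int_{\mathbb{R}^n}f''(u(x))\,\nabla u(x)\cdot A(\varphi)\nabla u(x)\,dx,$$ where $$A(\varphi)=\int_{\mathbb{R}^n}(y\otimes y)\,\varphi(y)\,dy.$$ If in addition $\varphi$ is rotationally symmetric, i.e. $\varphi(x)=\tilde\varphi(|x|)$ for some $\tilde\varphi:[0,\infty)\to[0,\infty)$, then $$\lim_{\varepsilon\to0}\frac1{\varepsilon^2}\int_{\mathbb{R}^n}\bigl[f(u)-f(u_\varepsilon)\bigr]\,dx=\frac12\,a(\varphi)\int_{\mathbb{R}^n}f''(u(x))\,|\nabla u(x)|^2\,dx,\qquad a(\varphi)=\omega_n\int_0^\infty r^{n+1}\tilde\varphi(r)\,dr.$$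
   Context: Functions $u$ are real-valued. The convolution is $u_\varepsilon(x)=(u*\varphi_\varepsilon)(x)=\int_{\mathbb{R}^n}u(x-y)\varphi_\varepsilon(y)\,dy$. For $a,b\in\mathbb{R}^n$, $a\otimes b$ denotes the tensor product, i.e. the $n\times n$ matrix with entries $a_ib_j$. $\omega_n=|B_1(0)|$ is the volume of the unit ball in $\mathbb{R}^n$. *)

(* Defs.v *)
From HB Require Import structures.
From mathcomp Require Import all_boot all_order all_algebra.
From mathcomp Require Import all_classical all_reals all_analysis.

Set Implicit Arguments.
Unset Strict Implicit.
Unset Printing Implicit Defensive.
Import Order.TTheory GRing.Theory Num.Theory.
Import numFieldNormedType.Exports.

Local Open Scope ring_scope.
Local Open Scope classical_set_scope.

(* The sigma-algebra on 'rV[R]_n is the one generated by the coordinates, as in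
   the library's instance on n.-tuple T; it is the Borel sigma-algebra. *)
Fact rV_display : measure_display. Proof. exact: default_measure_display. Qed.

Section measurable_rV.
Variables (R : realType) (n : nat).

Let coord (i : 'I_n) (x : 'rV[R]_n) : R := x 0 i.

Let rV_set0 : g_sigma_preimage coord set0.
Proof. exact: sigma_algebra0. Qed.

Let rV_setC A : g_sigma_preimage coord A -> g_sigma_preimage coord (~` A).
Proof. exact: sigma_algebraC. Qed.

Let rV_bigcup (F : (set 'rV[R]_n)^nat) :
  (forall i, g_sigma_preimage coord (F i)) ->
  g_sigma_preimage coord (\bigcup_i (F i)).
Proof. exact: sigma_algebra_bigcup. Qed.

HB.instance Definition _ := @isMeasurable.Build rV_display
  'rV[R]_n (g_sigma_preimage coord) rV_set0 rV_setC rV_bigcup.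

Lemma measurable_rV_coord (i : 'I_n) :
  measurable_fun [set: 'rV[R]_n] (fun x : 'rV[R]_n => x 0 i).
Proof.
move=> _ Y mY; rewrite setTI; apply: sub_sigma_algebra => /=.
rewrite -bigcup_seq/=; exists i => /=; first by rewrite mem_index_enum.
by exists Y => //; rewrite setTI.
Qed.

Lemma measurable_fun_rV d (T : measurableType d) (f : T -> 'rV[R]_n) :
  (forall i, measurable_fun [set: T] (fun t => f t 0 i)) ->
  measurable_fun [set: T] f.
Proof.
move=> mf; have H : g_sigma_preimage (fun i => coord i \o f) `<=` measurable.
  apply: smallest_sub; first exact: sigma_algebra_measurable.
  rewrite -bigcup_seq; apply: bigcup_sub => i _.
  by move=> A [B mB <-]; exact: mf.
rewrite g_sigma_preimage_comp in H.
by move=> _ A mA; apply: H; exists A.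
Qed.

End measurable_rV.

Section lebesgue_rV.
Variable R : realType.

Definition rV_cons n (p : measurableTypeR R * 'rV[R]_n) : 'rV[R]_n.+1 :=
  row_mx (const_mx p.1 : 'rV[R]_1) p.2.

Definition rV_uncons n (x : 'rV[R]_n.+1) : measurableTypeR R * 'rV[R]_n :=
  (x 0 0, \row_j x 0 (lift 0 j)).

Lemma rV_cons0 n (p : measurableTypeR R * 'rV[R]_n) : rV_cons p 0 0 = p.1.
Proof.
rewrite /rV_cons (_ : 0 = lshift n (0 : 'I_1)); last exact/val_inj.
by rewrite (@row_mxEl R 1 1 n) mxE.
Qed.

Lemma rV_consS n (p : measurableTypeR R * 'rV[R]_n) j :
  rV_cons p 0 (lift 0 j) = p.2 0 j.
Proof.
rewrite /rV_cons (_ : lift 0 j = rshift 1 j); last exact/val_inj.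
by rewrite (@row_mxEr R 1 1 n).
Qed.

Lemma rV_consK n : cancel (@rV_cons n) (@rV_uncons n).
Proof.
move=> p; rewrite /rV_uncons rV_cons0; case: p => a v /=; congr pair.
by apply/rowP => j; rewrite mxE rV_consS.
Qed.

Lemma measurable_rV_cons n : measurable_fun setT (@rV_cons n).
Proof.
apply: measurable_fun_rV => i; case: (unliftP 0 i) => [j ->|->].
  rewrite (_ : (fun _ => _) = (fun x : 'rV[R]_n => x 0 j) \o snd); last first.
    by apply/funext => p /=; rewrite rV_consS.
  by apply: measurableT_comp => //; exact: measurable_rV_coord.
rewrite (_ : (fun _ => _) = fst)//.
by apply/funext => p /=; rewrite rV_cons0.
Qed.

Lemma measurable_rV_uncons n : measurable_fun setT (@rV_uncons n).
Proof.
apply/measurable_fun_pairP; split => /=.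
  exact: (@measurable_rV_coord R n.+1 0).
apply: measurable_fun_rV => i.
rewrite (_ : (fun _ => _) = (fun x : 'rV[R]_n.+1 => x 0 (lift 0 i))).
  exact: measurable_rV_coord.
by apply/funext => x /=; rewrite mxE.
Qed.

Section lebesgue_cons.
Variables (n : nat) (m : {sigma_finite_measure set 'rV[R]_n -> \bar R}).

Definition lebesgue_cons : set 'rV[R]_n.+1 -> \bar R :=
  pushforward (@lebesgue_measure R \x m)%E (@rV_cons n).

HB.instance Definition _ := Measure.copy lebesgue_cons
  (measure_function_pushforward__canonical__measure_function_Measure
     (lebesgue_measure \x m)%E (@measurable_rV_cons n)).

Let lebesgue_cons_sigma_finite : sigma_finite setT lebesgue_cons.
Proof.
have /sigma_finiteP[F [TF ndF Foo]] := sigma_finiteT (@lebesgue_measure R).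
have /sigma_finiteP[G [TG ndG Goo]] := sigma_finiteT m.
exists (fun k => @rV_uncons n @^-1` (F k `*` G k)).
  rewrite predeqE => x; split => // _.
  have [k _ Fk] : (\bigcup_i F i) (rV_uncons x).1 by rewrite -TF.
  have [l _ Gl] : (\bigcup_i G i) (rV_uncons x).2 by rewrite -TG.
  exists (maxn k l) => //; split.
  - by move: Fk; exact/subsetPset/ndF/leq_maxl.
  - by move: Gl; exact/subsetPset/ndG/leq_maxr.
move=> k; have [mF Fk] := Foo k; have [mG Gk] := Goo k; split.
  rewrite -[X in measurable X]setTI; apply: measurable_rV_uncons => //.
  exact: measurableX.
rewrite /lebesgue_cons /pushforward -comp_preimage.
rewrite (_ : _ \o _ = id) ?preimage_id; last exact/funext/rV_consK.
by rewrite product_measure1E// lte_mul_pinfty// ge0_fin_numE.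
Qed.

HB.instance Definition _ := Measure_isSigmaFinite.Build _ _ _ lebesgue_cons
  lebesgue_cons_sigma_finite.

End lebesgue_cons.

Fixpoint lebesgue_rV n : {sigma_finite_measure set 'rV[R]_n -> \bar R} :=
  if n is k.+1 then lebesgue_cons (lebesgue_rV k)
  else \d_(0 : 'rV[R]_0).

Lemma lebesgue_rV_box n (B : 'I_n -> set R) :
  (forall i, measurable (B i)) ->
  lebesgue_rV n [set x : 'rV[R]_n | forall i, B i (x 0 i)] =
  (\prod_(i < n) @lebesgue_measure R (B i))%E.
Proof.
elim: n B => [|n IHn] B mB.
  by rewrite big_ord0 /= diracE mem_set// => -[].
have mbox : measurable [set x : 'rV[R]_n | forall i, B (lift 0 i) (x 0 i)].
  rewrite (_ : [set _ | _] =
      \bigcap_i ((fun x : 'rV[R]_n => x 0 i) @^-1` B (lift 0 i))); last first.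
    by rewrite predeqE => x; split => [Bx i _|Bx i]; exact: Bx.
  apply: fin_bigcap_measurable => // i _.
  by rewrite -[X in measurable X]setTI; exact: measurable_rV_coord.
rewrite big_ord_recl -IHn// /= /lebesgue_cons /pushforward.
rewrite -product_measure1E//; last exact: mB.
congr (product_measure1 _ _ _); rewrite predeqE => -[a v]; split => /= [Bp|[Ba Bv] i].
  split; first by have := Bp 0; rewrite rV_cons0.
  by move=> i; have := Bp (lift 0 i); rewrite rV_consS.
by case: (unliftP 0 i) => [j ->|->]; rewrite ?rV_consS ?rV_cons0.
Qed.

End lebesgue_rV.

Section euclidean.
Variables (R : realType) (n : nat).

(* The norm of the library on 'rV[R]_n is the sup norm. *)
Definition enorm (x : 'rV[R]_n) : R := Num.sqrt (\sum_(i < n) x 0 i ^+ 2).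

Definition dotv (x y : 'rV[R]_n) : R := \sum_(i < n) x 0 i * y 0 i.

Definition tensor (a b : 'rV[R]_n) : 'M[R]_n := \matrix_(i, j) (a 0 i * b 0 j).

(* A v, vectors being rows *)
Definition apply_mx (A : 'M[R]_n) (v : 'rV[R]_n) : 'rV[R]_n := v *m A^T.

Definition unit_ball_volume : R :=
  fine (lebesgue_rV R n [set x | enorm x < 1]).

End euclidean.

Section sobolev.
Variables (R : realType) (n : nat).
Local Notation mu := (lebesgue_rV R n).
Implicit Types (u g psi : 'rV[R]_n -> R) (Du : 'rV[R]_n -> 'rV[R]_n).

Definition partial (i : 'I_n) psi : 'rV[R]_n -> R := 'D_(delta_mx 0 i) psi.

Fixpoint Ck (k : nat) psi : Prop :=
  continuous psi /\
  if k is l.+1 then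
    forall i : 'I_n, (forall x, derivable psi x (delta_mx 0 i)) /\
      Ck l (partial i psi)
  else True.

Definition test_function psi : Prop :=
  (forall k, Ck k psi) /\ compact (closure [set x | psi x != 0]).

Definition weak_partial (i : 'I_n) u g : Prop :=
  forall psi, test_function psi ->
    \int[mu]_x (u x * partial i psi x) = - \int[mu]_x (g x * psi x).

Definition weak_gradient_L2 u Du : Prop :=
  forall i : 'I_n, (fun x => Du x 0 i) \in Lfun mu 2%:E /\
    weak_partial i u (fun x => Du x 0 i).

Definition W12 u : Prop :=
  u \in Lfun mu 2%:E /\ exists Du, weak_gradient_L2 u Du.

End sobolev.

Section kernels.
Variables (R : realType) (n : nat).
Local Notation mu := (lebesgue_rV R n).
Implicit Types (u phi : 'rV[R]_n -> R).

Definition rescale (eps : R) phi (x : 'rV[R]_n) : R :=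
  eps ^- n * phi (eps^-1 *: x).

(* The value is a dummy one at the points x where the integrand is not
   integrable; for u in L^2 and phi in L^1 these form a null set. *)
Definition convolution u phi (x : 'rV[R]_n) : R :=
  \int[mu]_y (u (x - y) * phi y).

Definition second_moment phi : 'M[R]_n :=
  \matrix_(i, j) \int[mu]_y (tensor y y i j * phi y).

Definition radial_coef (phit : R -> R) : R :=
  unit_ball_volume R n *
  \int[@lebesgue_measure R]_(r in `[0, +oo[) (r ^+ n.+1 * phit r).

End kernels.

Definition C2 (R : realType) (f : R -> R) : Prop :=
  [/\ forall x, derivable f x 1, forall x, derivable f^`() x 1
    & continuous f^`(2)].

(* Main.v *)
Require Import Defs.
From HB Require Import structures.
From mathcomp Require Import all_boot all_order all_algebra.
From mathcomp Require Import all_classical all_reals all_analysis.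
From mathcomp Require Import measurable_realfun.
From mathcomp Require Import fingroup perm ring lra.

Set Implicit Arguments.
Unset Strict Implicit.
Unset Printing Implicit Defensive.
Import Order.TTheory GRing.Theory Num.Theory.
Import numFieldNormedType.Exports.

Local Open Scope ring_scope.
Local Open Scope classical_set_scope.

(** Put r(a, c) = f a - f c - f' c (a - c), the first-order Taylor remainder of
    [f]; since f'' is bounded by M, |r(a, c)| <= M (a - c)^2.  The idea is to
    avoid expanding [f u_eps] directly.  For fixed z the integral of
    f (u (x - eps z)) does not depend on z, by translation invariance, so
    averaging r(u (x - eps z), u x) with the weight phi z leaves only the
    linear term, whose average is minus the integral of f'(u) (u_eps - u).  This is
    also the linear term occurring in r(u_eps, u), and it cancels:

      eps^-2 \int (f(u) - f(u_eps))
        = \int phi(z) (eps^-2 \int r(u(x - eps z), u(x)) dx) dz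
          - eps^-2 \int r(u_eps, u)                    [energy_identity].

    In the first term, the difference quotient (u(x - eps z) - u(x)) / eps
    tends to - z . Du in L^2 for every z, so the inner integral tends to
    \int f''(u) (z . Du)^2 / 2, and it is bounded by 10 M times the squared L^2
    norm of z . Du; the finite second moment of phi then allows dominated
    convergence in z, and integrating the quadratic form in z against phi
    produces the matrix of second moments [integral_limit_energy].  The second
    term vanishes in the limit: it is at most M times the squared L^2 norm of
    (u_eps - u) / eps, which, phi having mean zero, is the phi-average in z of the
    errors (u(x - eps z) - u(x)) / eps + z . Du(x), and so by Jensen's
    inequality its squared norm is at most the phi-average of theirs
    [sqint_mean_dilate_le].

    The L^2 limit of the difference quotients comes from the identity
    u(x - z) - u(x) = - \int_0^1 z . Du(x - t z) dt for almost every x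
    [weak_FTC], together with the L^2 continuity of translations
    [L2_translation_continuousP].  The identity is tested against products of
    one-variable smooth compactly supported functions, for which it is the
    fundamental theorem of calculus followed by Fubini and the definition of a
    weak derivative; these products suffice because they approximate the
    indicators of open boxes, and open boxes generate the measurable sets
    [fundamental_lemma].

    When phi depends on |y| only, it is invariant under the reflections and the
    permutations of the coordinates, so its second moments form a scalar matrix,
    whose value is found from the trace \int |y|^2 phi in polar coordinates
    [second_moment_radial].  Polar coordinates are needed for functions of |y|
    alone: the image of Lebesgue measure under y |-> |y| has density
    n omega_n r^(n-1), because the ball of radius r has volume omega_n r^n. *)

(** * Open boxes generate the measurable sets *)

Section open_boxes.
Variables (R : realType) (n : nat).
Local Notation mu := (lebesgue_rV R n).

Definition open_box (a b : 'I_n -> R) : set 'rV[R]_n :=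
  [set x | forall i, (`]a i, b i[%classic : set R) (x 0 i)].

Definition open_boxes : set (set 'rV[R]_n) :=
  [set A | exists a b, A = open_box a b].

Lemma measurable_open_box a b : measurable (open_box a b).
Proof.
rewrite (_ : open_box a b =
    \bigcap_i ((fun x : 'rV[R]_n => x 0 i) @^-1` `]a i, b i[%classic)).
  apply: fin_bigcap_measurable => // i _.
  by rewrite -[X in measurable X]setTI; exact: measurable_rV_coord.
by rewrite predeqE => x; split => [Bx i _|Bx i]; exact: Bx.
Qed.

Lemma open_boxesI : setI_closed open_boxes.
Proof.
move=> _ _ [a [b ->]] [c [d ->]].
exists (fun i => Num.max (a i) (c i)), (fun i => Num.min (b i) (d i)).
rewrite predeqE => x; split=> [[h k] i|h].
  by have := h i; have := k i; rewrite /= !in_itv/= gt_max lt_min;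
     move=> /andP[-> ->] /andP[-> ->].
by split=> i; have := h i; rewrite /= !in_itv/= gt_max lt_min;
   move=> /andP[/andP[? ?] /andP[? ?]]; apply/andP.
Qed.

Definition cube (k : nat) := open_box (fun=> - k%:R) (fun=> k%:R).

Lemma mem_cube k (x : 'rV[R]_n) : (forall i, `|x 0 i| < k%:R) -> cube k x.
Proof. by move=> h i; rewrite /= in_itv/= -ltr_norml. Qed.

Lemma cube_bound (x : 'rV[R]_n) : exists k : nat, forall i, `|x 0 i| < k%:R.
Proof.
exists (Num.truncn (\sum_i `|x 0 i|)).+1 => i.
apply: le_lt_trans (truncnS_gt _).
by rewrite (bigD1 i)//= lerDl sumr_ge0.
Qed.

(** Exhaustion by cubes makes Lebesgue measure sigma-finite along open boxes, and
    reduces statements about measurable sets to sets of finite measure. *)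
Lemma bigcup_cube : \bigcup_k cube k = setT.
Proof.
rewrite -subTset => x _; have [k xk] := cube_bound x.
by exists k => //; exact: mem_cube.
Qed.

Lemma nd_cube : nondecreasing_seq cube.
Proof.
move=> k l kl; apply/subsetPset => x xk i; have := xk i.
rewrite /= !in_itv/= -!ltr_norml => /lt_le_trans; apply.
by rewrite ler_nat.
Qed.

(** The cylinder over an open interval is the countable union of the boxes
    obtained by cutting it with the cubes, so the boxes generate the cylinders. *)
Lemma measurable_rVE : @measurable _ 'rV[R]_n = <<s open_boxes >>.
Proof.
rewrite eqEsubset; split; last first.
  apply: smallest_sub; first exact: sigma_algebra_measurable.
  by move=> _ [a [b ->]]; exact: measurable_open_box.
apply: smallest_sub; first exact: smallest_sigma_algebra.
rewrite -bigcup_seq/=; apply: bigcup_sub => i _ A [B mB <-].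
rewrite setTI; have : <<s @RGenOpens.G R >> B.
  have := RGenOpens.measurableE R.
  by rewrite predeqE => /(_ B)[+ _]; exact.
move: B {mB}; apply: smallest_sub.
  split => /=.
  - by rewrite preimage_set0; exact: sigma_algebra0.
  - by move=> B hB; rewrite setTD preimage_setC; exact: sigma_algebraC.
  - by move=> F hF; rewrite preimage_bigcup; exact: sigma_algebra_bigcup.
move=> _ [c [d ->]] /=.
rewrite [X in <<s _ >> X](_ : _ = \bigcup_k
    open_box (fun j => if j == i then c else - k%:R)
             (fun j => if j == i then d else k%:R)).
  by apply: sigma_algebra_bigcup => k; apply: sub_sigma_algebra; do 2 eexists.
rewrite predeqE => x; split => /= [xi|[k _ /(_ i)]]; last by rewrite eqxx.
have [k xk] := cube_bound x; exists k => // j.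
by case: eqP => [->//|_]; exact: mem_cube.
Qed.

Lemma lebesgue_open_box a b : mu (open_box a b) =
  (\prod_(i < n) Num.max 0 (b i - a i))%:E.
Proof.
rewrite (lebesgue_rV_box (B := fun i => `]a i, b i[%classic))//.
rewrite -prodEFin; apply: eq_bigr => i _.
rewrite lebesgue_measure_itv/= lte_fin.
case: ltP => ab; first by rewrite max_r// subr_ge0 ltW.
by rewrite max_l// subr_le0.
Qed.

Lemma lebesgue_open_box_lty a b : (mu (open_box a b) < +oo)%E.
Proof. by rewrite lebesgue_open_box ltry. Qed.

(** Open boxes form a pi-system containing an exhausting sequence of cubes of
    finite volume, so they determine a measure.  Every change of variables below
    rests on this. *)
Lemma lebesgue_rV_unique (m : {measure set 'rV[R]_n -> \bar R}) :
  (forall a b, m (open_box a b) = mu (open_box a b)) ->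
  forall A, measurable A -> m A = mu A.
Proof.
move=> h A mA; symmetry.
apply: (measure_unique open_boxes cube) => //.
- exact: measurable_rVE.
- exact: open_boxesI.
- by move=> k; do 2 eexists.
- exact: bigcup_cube.
- by move=> _ [a [b ->]]; rewrite h.
- by move=> k; exact: lebesgue_open_box_lty.
Qed.

(** Dynkin's pi-lambda argument; it extends a property linear and monotonically
    continuous in A from open boxes to measurable sets. *)
Lemma rV_lambda_system (H : set (set 'rV[R]_n)) :
  lambda_system setT H -> open_boxes `<=` H ->
  forall A, measurable A -> H A.
Proof.
move=> HH GH A; rewrite measurable_rVE; move: A.
exact: (lambda_system_subset open_boxesI HH GH).
Qed.

End open_boxes.

(** * Changes of variables along the axes *)

(** Distributivity may fail for infinite values of opposite signs; a positive
    finite factor is harmless, even when the difference is oo - oo, whatever value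
    that has. *)
Lemma gt0_muleBr (R : realType) (k : R) (x y : \bar R) : 0 < k ->
  (0 <= x)%E -> (0 <= y)%E -> (k%:E * x - k%:E * y = k%:E * (x - y))%E.
Proof.
move=> k0; case: x => [p| |]// _; case: y => [q| |]// _.
- by rewrite -?EFinM -?EFinB; congr EFin; rewrite mulrBr.
- by rewrite gt0_muley ?lte_fin//= gt0_muleNy ?lte_fin.
- by rewrite gt0_muley ?lte_fin//= gt0_muley ?lte_fin.
- by rewrite gt0_muley ?lte_fin//= gt0_muleNy ?lte_fin.
Qed.

Section axis_map.
Variables (R : realType) (n : nat).
Local Notation mu := (lebesgue_rV R n).
Implicit Types (s : {perm 'I_n}) (c t a b : 'I_n -> R).

(** Permuting and rescaling the coordinates, then translating: the affine maps
    sending open boxes to open boxes.  Translations, dilations, reflections and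
    exchanges of coordinates are all of this form. *)
Definition axis_map (s : {perm 'I_n}) (c t : 'I_n -> R) (x : 'rV[R]_n) : 'rV[R]_n :=
  \row_i (c i * x 0 (s i) + t i).

Lemma measurable_axis_map s c t : measurable_fun setT (axis_map s c t).
Proof.
apply: measurable_fun_rV => i.
rewrite (_ : (fun _ => _) = (fun x : 'rV[R]_n => c i * x 0 (s i) + t i)).
  apply: measurable_funD => //; apply: measurable_funM => //.
  exact: measurable_rV_coord.
by apply/funext => x; rewrite mxE.
Qed.

HB.instance Definition _ s c t :=
  isMeasurableFun.Build _ _ _ _ (axis_map s c t) (measurable_axis_map s c t).

Lemma preimage_axis_map_open_box s c t a b : (forall i, c i != 0) ->
  axis_map s c t @^-1` open_box a b =
  open_box (fun j => let i := (s^-1)%g j in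
              ((if 0 < c i then a i else b i) - t i) / c i)
           (fun j => let i := (s^-1)%g j in
              ((if 0 < c i then b i else a i) - t i) / c i).
Proof.
move=> c0; have aux k (y p q r : R) : k != 0 ->
    (p < k * y + r < q) = (((if 0 < k then p else q) - r) / k < y <
                           ((if 0 < k then q else p) - r) / k).
  move=> k0; case: (ltP 0 k) => [kp|kn].
    by rewrite ltr_pdivrMr// ltr_pdivlMr// ltrBlDr ltrBrDr mulrC.
  have {}kn : k < 0 by rewrite lt_neqAle k0.
  by rewrite ltr_ndivrMr// ltr_ndivlMr// ltrBrDr ltrBlDr [y * _]mulrC andbC.
rewrite predeqE => x /=; split => [h j|h i].
  by have := h ((s^-1)%g j); rewrite /= mxE permKV !in_itv/= aux.
by have := h (s i); rewrite /= mxE permK !in_itv/= aux.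
Qed.

(** Both sides are measures of A, and on open boxes the equality is the
    product formula for the volume. *)
Lemma lebesgue_axis_map s c t (A : set 'rV[R]_n) : (forall i, c i != 0) ->
  measurable A ->
  ((\prod_i `|c i|)%:E * mu (axis_map s c t @^-1` A) = mu A)%E.
Proof.
move=> c0 mA.
have k0 : 0 <= \prod_i `|c i| by apply: prodr_ge0.
have -> : ((\prod_i `|c i|)%:E * mu (axis_map s c t @^-1` A))%E =
    mscale (NngNum k0) (pushforward mu (axis_map s c t)) A by [].
move: A mA; apply: lebesgue_rV_unique => a b.
transitivity ((\prod_i `|c i|)%:E * mu (axis_map s c t @^-1` open_box a b))%E => //.
rewrite preimage_axis_map_open_box// !lebesgue_open_box.
rewrite -EFinM; congr EFin.
rewrite [X in _ * X](reindex_inj (@perm_inj _ s))/= -big_split/=.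
apply: eq_bigr => i _; rewrite permK.
rewrite maxr_pMr// mulr0; congr Num.max.
case: ltP => [cp|cn]; first by rewrite gtr0_norm//; field.
by rewrite ler0_norm//; field.
Qed.

Lemma ge0_integral_axis_map s c t (g : 'rV[R]_n -> \bar R) :
  (forall i, c i != 0) -> measurable_fun setT g -> (forall x, 0 <= g x)%E ->
  (\int[mu]_x g x = (\prod_i `|c i|)%:E * \int[mu]_x g (axis_map s c t x))%E.
Proof.
move=> c0 mg g0.
have k0 : 0 <= \prod_i `|c i| by apply: prodr_ge0.
rewrite -[in RHS](@ge0_integral_pushforward _ _ _ _ _ _ (measurable_axis_map s c t) mu setT g)//.
rewrite -(@ge0_integral_mscale _ _ _ (pushforward mu (axis_map s c t)) setT measurableT (NngNum k0))//.
apply: eq_measure_integral => A mA _.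
by rewrite -[LHS](lebesgue_axis_map s t c0 mA).
Qed.

(** The formula holds separately for the positive and the negative part, so it
    remains true at infinite values of the integral; a convolution has such values
    at exceptional points. *)
Lemma integral_axis_map s c t (g : 'rV[R]_n -> \bar R) :
  (forall i, c i != 0) -> measurable_fun setT g ->
  (\int[mu]_x g x = (\prod_i `|c i|)%:E * \int[mu]_x g (axis_map s c t x))%E.
Proof.
move=> c0 mg; have kp : 0 < \prod_i `|c i| by apply: prodr_gt0 => i _; rewrite normr_gt0.
rewrite [in LHS]integralE [in RHS]integralE.
rewrite (ge0_integral_axis_map s t c0 (measurable_funepos mg))//.
rewrite (ge0_integral_axis_map s t c0 (measurable_funeneg mg))//.
rewrite -[fun x => g (axis_map s c t x)]/(g \o axis_map s c t).
rewrite [in RHS]funepos_comp [in RHS]funeneg_comp.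
rewrite gt0_muleBr => //; apply: integral_ge0 => x _.
  exact: funepos_ge0.
exact: funeneg_ge0.
Qed.

Lemma Rintegral_axis_map s c t (g : 'rV[R]_n -> R) :
  (forall i, c i != 0) -> measurable_fun setT g ->
  \int[mu]_x g x = \prod_i `|c i| * \int[mu]_x g (axis_map s c t x).
Proof.
move=> c0 mg; rewrite /Rintegral (integral_axis_map s t c0); last exact/measurable_EFinP.
have : 0 < \prod_i `|c i| by apply: prodr_gt0 => i _; rewrite normr_gt0.
move: (\prod_i _) => k k0; case: (integral _ _ _) => [r| |]//=.
  by rewrite gt0_muley ?lte_fin//= mulr0.
by rewrite gt0_muleNy ?lte_fin//= mulr0.
Qed.
End axis_map.

Section translation.
Variables (R : realType) (n : nat).
Local Notation mu := (lebesgue_rV R n).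
Implicit Types (x h : 'rV[R]_n).

(* dilation by k followed by translation by h *)
Let axis_mapE (k : R) h x : axis_map 1 (fun=> k) (fun i => h 0 i) x = k *: x + h.
Proof. by apply/rowP => i; rewrite !mxE perm1. Qed.

Lemma measurable_affine (k : R) h : measurable_fun setT (fun x : 'rV[R]_n => k *: x + h).
Proof.
rewrite (_ : (fun _ => _) = axis_map 1 (fun=> k) (fun i => h 0 i)).
  exact: measurable_axis_map.
by apply/funext => x; rewrite axis_mapE.
Qed.

Lemma measurable_subr h : measurable_fun setT (fun x : 'rV[R]_n => x - h).
Proof.
rewrite (_ : (fun _ => _) = (fun x : 'rV[R]_n => 1 *: x + (- h))).
  exact: measurable_affine.
by apply/funext => x; rewrite scale1r.
Qed.

Lemma ge0_integral_shift h (g : 'rV[R]_n -> \bar R) :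
  measurable_fun setT g -> (forall x, 0 <= g x)%E ->
  (\int[mu]_x g (x - h)%R = \int[mu]_x g x)%E.
Proof.
move=> mg g0; rewrite [RHS](ge0_integral_axis_map 1 (c := fun=> 1) (fun i => (- h) 0 i))//.
rewrite normr1 big1// mul1e; apply: eq_integral => x _.
by rewrite axis_mapE scale1r.
Qed.

Lemma Rintegral_shift h (g : 'rV[R]_n -> R) : measurable_fun setT g ->
  \int[mu]_x g (x - h) = \int[mu]_x g x.
Proof.
move=> mg; rewrite [RHS](Rintegral_axis_map 1 (c := fun=> 1) (fun i => (- h) 0 i))//.
rewrite normr1 big1// mul1r; apply: eq_Rintegral => x _.
by rewrite axis_mapE scale1r.
Qed.

Lemma ge0_integral_dilate (k : R) (g : 'rV[R]_n -> \bar R) : 0 < k ->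
  measurable_fun setT g -> (forall x, 0 <= g x)%E ->
  (\int[mu]_x g x = (k ^+ n)%:E * \int[mu]_x g (k *: x)%R)%E.
Proof.
move=> k0 mg g0; rewrite (ge0_integral_axis_map 1 (c := fun=> k) (fun i => (0 : 'rV[R]_n) 0 i))//; last first.
  by move=> _; rewrite gt_eqF.
rewrite big_const_ord iter_mulr_1 gtr0_norm//; congr (_ * _)%E.
by apply: eq_integral => x _; rewrite axis_mapE addr0.
Qed.

Lemma Rintegral_dilate (k : R) (g : 'rV[R]_n -> R) : 0 < k ->
  measurable_fun setT g ->
  \int[mu]_x g x = k ^+ n * \int[mu]_x g (k *: x).
Proof.
move=> k0 mg; rewrite (Rintegral_axis_map 1 (c := fun=> k) (fun i => (0 : 'rV[R]_n) 0 i))//; last first.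
  by move=> _; rewrite gt_eqF.
rewrite big_const_ord iter_mulr_1 gtr0_norm//; congr (_ * _).
by apply: eq_Rintegral => x _; rewrite axis_mapE addr0.
Qed.

End translation.

(** * Square-integrable functions *)

Section ereal_limits.
Variable R : realType.
Local Open Scope ereal_scope.

(** The squared L^2 norms below take values in the extended reals; this criterion
    expresses their convergence to zero by inequalities between extended reals. *)
Lemma ge0_cvge0P (u : nat -> \bar R) : (forall k, 0 <= u k) ->
  (u k @[k --> \oo] --> 0 <->
   forall e : R, (0 < e)%R -> \forall k \near \oo, u k <= e%:E).
Proof.
move=> u0; split=> [/fine_cvgP[ufin /cvgrPdist_le uc] e e0|h].
  have := uc _ e0; apply: filterS2 ufin => k ufin.
  by rewrite sub0r normrN ger0_norm ?fine_ge0//= -lee_fin fineK.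
have ufin e : (0 < e)%R -> \forall k \near \oo, u k <= e%:E /\ u k \is a fin_num.
  move=> /h; apply: filterS => k uk; split=> //.
  by rewrite ge0_fin_numE//; apply: le_lt_trans uk _; rewrite ltry.
apply/fine_cvgP; split; first by apply: filterS (ufin 1%R ltr01) => k [].
apply/cvgrPdist_le => e /ufin; apply: filterS => k [ue uf].
by rewrite sub0r normrN ger0_norm ?fine_ge0//= -lee_fin fineK.
Qed.

End ereal_limits.

Section square_integrable.
Context d (T : measurableType d) (R : realType).
Variable mu : {measure set T -> \bar R}.
Implicit Types f g h : T -> R.
Local Open Scope ereal_scope.

(** The square of the L^2 norm, with values in the extended reals so that it is
    meaningful before integrability is known. *)
Definition sqint g := \int[mu]_x (g x ^+ 2)%:E.

Definition L2 g := measurable_fun setT g /\ sqint g < +oo.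

Lemma Lfun2_L2 g : g \in Lfun mu 2%:E -> L2 g.
Proof.
move=> g2; split; first exact: (set_mem (sub_Lfun_mfun g2)).
have /integrableP[_] := Lfun2_integrable_sqr g2.
by under eq_integral do rewrite /= ger0_norm ?sqr_ge0//.
Qed.

Lemma sqint_ge0 g : 0 <= sqint g.
Proof. by apply: integral_ge0 => x _; rewrite lee_fin sqr_ge0. Qed.

Lemma measurable_sqr g : measurable_fun setT g ->
  measurable_fun setT (fun x => (g x ^+ 2)%:E).
Proof. by move=> mg; apply/measurable_EFinP; exact: measurable_funX. Qed.
Hint Resolve measurable_sqr : core.

Lemma le_sqint f g (C : R) : (0 <= C)%R -> measurable_fun setT f ->
  measurable_fun setT g -> (forall x, f x ^+ 2 <= C * g x ^+ 2)%R ->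
  sqint f <= C%:E * sqint g.
Proof.
move=> C0 mf mg fg; rewrite /sqint -ge0_integralZl//.
- apply: ge0_le_integral => //.
  + by move=> x _; rewrite lee_fin sqr_ge0.
  + exact: measurable_sqr.
  + by apply: measurable_funeM; exact: measurable_sqr.
  + by move=> x _; rewrite -EFinM lee_fin.
- exact: measurable_sqr.
- by move=> x _; rewrite lee_fin sqr_ge0.
Qed.

(** From (a + b)^2 <= 2 a^2 + 2 b^2: a substitute for the triangle inequality that
    avoids square roots. *)
Lemma sqintD f g : measurable_fun setT f -> measurable_fun setT g ->
  sqint (fun x => f x + g x)%R <= 2%:E * sqint f + 2%:E * sqint g.
Proof.
move=> mf mg; rewrite /sqint -!ge0_integralZl//; try (by move=> x _; rewrite lee_fin sqr_ge0);
  try exact: measurable_sqr.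
rewrite -ge0_integralD//; try (by move=> x _; rewrite -EFinM lee_fin mulr_ge0// sqr_ge0);
  try (by apply: measurable_funeM; exact: measurable_sqr).
apply: ge0_le_integral => //.
- by move=> x _; rewrite lee_fin sqr_ge0.
- by apply: measurable_sqr; exact: measurable_funD.
- by apply: emeasurable_funD; apply: measurable_funeM; exact: measurable_sqr.
- move=> x _; rewrite -!EFinM -EFinD lee_fin.
  by have := sqr_ge0 (f x - g x)%R; rewrite !expr2; lra.
Qed.

Lemma sqintN f : sqint (fun x => - f x)%R = sqint f.
Proof. by apply: eq_integral => x _; rewrite sqrrN. Qed.

Lemma sqintB f g : measurable_fun setT f -> measurable_fun setT g ->
  sqint (fun x => f x - g x)%R <= 2%:E * sqint f + 2%:E * sqint g.
Proof.
move=> mf mg; rewrite -(sqintN g).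
apply: (@sqintD f (fun x => - g x)%R) => //; exact: measurableT_comp.
Qed.

Lemma sqintZ (c : R) g : measurable_fun setT g ->
  sqint (fun x => c * g x)%R = (c ^+ 2)%:E * sqint g.
Proof.
move=> mg; rewrite /sqint -ge0_integralZl//.
- by apply: eq_integral => x _; rewrite exprMn.
- exact: measurable_sqr.
- by move=> x _; rewrite lee_fin sqr_ge0.
- by rewrite lee_fin sqr_ge0.
Qed.

Lemma sqint_indic (A : set T) : measurable A -> sqint \1_A = mu A.
Proof.
move=> mA; rewrite -(setIT A) -integral_indic// setIT.
apply: eq_integral => x _; congr EFin; rewrite indicE.
by case: (x \in A); rewrite ?expr1n ?expr0n.
Qed.

Lemma L2_indic (A : set T) : measurable A -> mu A < +oo -> L2 \1_A.
Proof. by move=> mA fA; split; [exact: measurable_indic|rewrite sqint_indic]. Qed.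

Lemma L2_le f g (C : R) : (0 <= C)%R -> measurable_fun setT f -> L2 g ->
  (forall x, f x ^+ 2 <= C * g x ^+ 2)%R -> L2 f.
Proof.
move=> C0 mf [mg g2] fg; split => //.
by apply: le_lt_trans (le_sqint C0 mf mg fg) _; rewrite lte_mul_pinfty.
Qed.

Lemma L2D f g : L2 f -> L2 g -> L2 (fun x => f x + g x)%R.
Proof.
move=> [mf f2] [mg g2]; split; first exact: measurable_funD.
by apply: le_lt_trans (sqintD mf mg) _; rewrite lte_add_pinfty// lte_mul_pinfty.
Qed.

Lemma L2Z (c : R) f : L2 f -> L2 (fun x => c * f x)%R.
Proof.
move=> f2; apply: (@L2_le _ f (c ^+ 2)%R) => //; first by rewrite sqr_ge0.
  by case: f2 => mf _; exact: measurable_funM.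
by move=> x; rewrite exprMn.
Qed.

Lemma L2N f : L2 f -> L2 (fun x => - f x)%R.
Proof.
by move=> [mf f2]; split; [exact: measurableT_comp|rewrite sqintN].
Qed.

Lemma L2B f g : L2 f -> L2 g -> L2 (fun x => f x - g x)%R.
Proof. by move=> f2 /L2N; exact: L2D. Qed.

Lemma L2_0 : L2 (fun=> 0%R).
Proof.
split; first exact: measurable_cst.
by rewrite /sqint integral0_eq// => x _; rewrite expr0n.
Qed.

Lemma L2_sum (I : Type) (s : seq I) (F : I -> T -> R) : (forall i, L2 (F i)) ->
  L2 (fun x => \sum_(i <- s) F i x)%R.
Proof.
move=> F2; elim: s => [|i s IHs].
  by under eq_fun do rewrite big_nil; exact: L2_0.
by under eq_fun do rewrite big_cons; exact: L2D.
Qed.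

Lemma integrable_sqr g : L2 g -> mu.-integrable setT (fun x => (g x ^+ 2)%:E).
Proof.
move=> [mg g2]; apply/integrableP; split; first exact: measurable_sqr.
by under eq_integral do rewrite gee0_abs ?lee_fin ?sqr_ge0//.
Qed.

Lemma integrable_mul f g : L2 f -> L2 g ->
  mu.-integrable setT (fun x => (f x * g x)%:E).
Proof.
move=> f2 g2; apply: (@le_integrable _ _ _ _ _ _ _ (fun x => (f x ^+ 2)%:E + (g x ^+ 2)%:E)) => //.
- by apply/measurable_EFinP; case: f2 g2 => mf _ [mg _]; exact: measurable_funM.
- move=> x _; rewrite -EFinD lee_fin (@ger0_norm _ (_ + _)%R) ?addr_ge0 ?sqr_ge0//.
  have := sqr_ge0 (f x - g x)%R; have := sqr_ge0 (f x + g x)%R.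
  have := sqr_ge0 (f x)%R; have := sqr_ge0 (g x)%R.
  by rewrite ler_norml !expr2; lra.
- by apply: integrableD => //; exact: integrable_sqr.
Qed.

Lemma sqint_eq f g : f =1 g -> sqint f = sqint g.
Proof. by move=> fg; apply: eq_integral => x _; rewrite fg. Qed.

End square_integrable.

Lemma Rintegral_sum d (T : measurableType d) (R : realType)
    (mu : {measure set T -> \bar R}) (I : Type) (s : seq I) (F : I -> T -> R) :
  (forall i, mu.-integrable setT (fun x => (F i x)%:E)) ->
  \int[mu]_x (\sum_(i <- s) F i x) = \sum_(i <- s) \int[mu]_x F i x.
Proof.
move=> iF; elim: s => [|i s IH].
  rewrite big_nil; under eq_Rintegral do rewrite big_nil.
  by rewrite /Rintegral integral0.
rewrite big_cons; under eq_Rintegral do rewrite big_cons.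
rewrite RintegralD ?IH//; first exact: iF.
rewrite (_ : _ \o _ = (fun x => \sum_(j <- s) (F j x)%:E)%E); first exact: integrable_sum.
by apply/funext => x; rewrite /= sumEFin.
Qed.

(** * Continuity of translations in L^2 *)

(** Dominated convergence in L^2. *)
Lemma sqint_cvg0 d (T : measurableType d) (R : realType)
    (mu : {measure set T -> \bar R}) (F : nat -> T -> R) (G : T -> R) :
  (forall k, measurable_fun setT (F k)) ->
  {ae mu, forall x, F k x @[k --> \oo] --> 0} ->
  (forall k x, F k x ^+ 2 <= G x) ->
  mu.-integrable setT (EFin \o G) ->
  sqint mu (F k) @[k --> \oo] --> 0%E.
Proof.
move=> mF F0 FG iG.
rewrite (_ : 0%E = \int[mu]_x (cst 0%E x))%E; last by rewrite integral0.
have [] := @dominated_convergence _ _ _ mu setT measurableT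
  (fun k x => (F k x ^+ 2)%:E) (cst 0%E) (EFin \o G) _ _ _ iG _ => //.
- by move=> k; exact: measurable_sqr.
- apply: filterS F0 => x Fx _; apply: cvg_EFin; first exact: nearW.
  have -> : fine \o (fun n => (F n x ^+ 2)%:E) = (fun n => F n x * F n x).
    by apply/funext => k /=; rewrite expr2.
  by have := cvgM Fx Fx; rewrite mulr0; exact.
- by apply: nearW => x k _; rewrite /= lee_fin ger0_norm ?sqr_ge0.
Qed.

Section translation_continuity.
Variables (R : realType) (n : nat).
Local Notation mu := (lebesgue_rV R n).
Implicit Types (x : 'rV[R]_n) (g : 'rV[R]_n -> R) (h : nat -> 'rV[R]_n).

Definition null_seq h := forall i, h k 0 i @[k --> \oo] --> (0 : R).

Definition L2_translation_continuous g := L2 mu g /\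
  forall h, null_seq h -> sqint mu (fun x => g (x - h k) - g x) @[k --> \oo] --> 0%E.

Lemma measurable_shift (g : 'rV[R]_n -> R) (t : 'rV[R]_n) : measurable_fun setT g ->
  measurable_fun setT (fun x => g (x - t)).
Proof. by move=> mg; apply: (measurableT_comp mg); exact: measurable_subr. Qed.

Lemma sqint_shift g (t : 'rV[R]_n) : measurable_fun setT g ->
  sqint mu (fun x => g (x - t)) = sqint mu g.
Proof.
move=> mg; rewrite /sqint -[RHS](ge0_integral_shift t)//; first exact: measurable_sqr.
by move=> x; rewrite lee_fin sqr_ge0.
Qed.

Lemma L2_shift g (t : 'rV[R]_n) : L2 mu g -> L2 mu (fun x => g (x - t)).
Proof.
by move=> [mg g2]; split; [exact: measurable_shift|rewrite sqint_shift].
Qed.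

(** Translations are isometries, so with g' close to g the error in replacing g by
    g' in g (x - h) - g x is small uniformly in h: the class of functions
    with continuous translates is closed in L^2. *)
Lemma translation_continuous_approx g : L2 mu g ->
  (forall e : R, 0 < e -> exists g', L2_translation_continuous g' /\
     (sqint mu (fun x => g x - g' x)%R <= e%:E)%E) ->
  L2_translation_continuous g.
Proof.
move=> g2 happ; split => // h h0.
apply/ge0_cvge0P; first by move=> k; exact: sqint_ge0.
move=> e e0; have e10 : 0 < e / 10 by rewrite divr_gt0.
have [g' [[g'2 tg'] gg']] := happ _ e10.
have := tg' h h0 => /ge0_cvge0P => /(_ (fun k => sqint_ge0 _ _)) /(_ _ e10).
apply: filterS => k hk.
have [mg _] := g2; have [mg' _] := g'2.
have m1 : measurable_fun setT (fun x => g x - g' x) by exact: measurable_funB.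
have m2 := measurable_shift (h k) m1.
have m3 : measurable_fun setT (fun x => g' (x - h k) - g' x).
  by apply: measurable_funB => //; exact: measurable_shift.
have -> : (fun x => g (x - h k) - g x) =
    (fun x => (g (x - h k) - g' (x - h k) - (g x - g' x)) + (g' (x - h k) - g' x)).
  by apply/funext => x; ring.
have m4 : measurable_fun setT
    (fun x => g (x - h k) - g' (x - h k) - (g x - g' x)) by exact: measurable_funB.
(* the constant 10 is 2 * (2 + 2) + 2 *)
apply: (le_trans (sqintD _ m4 m3)).
apply: (@le_trans _ _ (2%:E * (2%:E * (e / 10)%:E + 2%:E * (e / 10)%:E) + 2%:E * (e / 10)%:E)%E).
  apply: leeD; apply: lee_wpmul2l => //; apply: (le_trans (sqintB _ m2 m1)).
  by rewrite (sqint_shift _ m1); apply: leeD; exact: lee_wpmul2l.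
by rewrite -?EFinM -?EFinD -?EFinM -?EFinD lee_fin; lra.
Qed.

Lemma translation_continuousD g1 g2 : L2_translation_continuous g1 ->
  L2_translation_continuous g2 -> L2_translation_continuous (fun x => g1 x + g2 x).
Proof.
move=> [l1 t1] [l2 t2]; split; first exact: L2D.
move=> h h0.
apply: (@squeeze_cvge _ _ _ _ (cst 0%E) _
  (fun k => 2%:E * sqint mu (fun x => g1 (x - h k) - g1 x)%R +
            2%:E * sqint mu (fun x => g2 (x - h k) - g2 x)%R)%E).
- apply: nearW => k; rewrite sqint_ge0/=.
  have -> : (fun x => g1 (x - h k) + g2 (x - h k) - (g1 x + g2 x)) =
      (fun x => (g1 (x - h k) - g1 x) + (g2 (x - h k) - g2 x)).
    by apply/funext => x; ring.
  by apply: sqintD; apply: measurable_funB; [exact: measurable_shift l1.1|exact: l1.1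
    |exact: measurable_shift l2.1|exact: l2.1].
- exact: cvg_cst.
- have c1 := cvgeZl (isT : 2%:E \is a fin_num) (t1 h h0).
  have c2 := cvgeZl (isT : 2%:E \is a fin_num) (t2 h h0).
  rewrite !mule0 in c1 c2; rewrite -[X in _ --> X](adde0 0%E).
  exact: cvgeD.
Qed.

Lemma translation_continuousZ (c : R) g : L2_translation_continuous g ->
  L2_translation_continuous (fun x => c * g x).
Proof.
move=> [l t]; split; first exact: L2Z.
move=> h h0.
have -> : (fun k => sqint mu (fun x => c * g (x - h k) - c * g x)) =
    (fun k => (c ^+ 2)%:E * sqint mu (fun x => g (x - h k) - g x)%R)%E.
  apply/funext => k; rewrite -sqintZ.
    by apply: sqint_eq => x; rewrite mulrBr.
  by apply: measurable_funB; [exact: measurable_shift l.1|exact: l.1].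
by rewrite -(mule0 (c ^+ 2)%:E); apply: cvgeZl => //; exact: t.
Qed.

Lemma open_box_near a b h x : null_seq h -> open_box a b x ->
  \forall k \near \oo, open_box a b (x - h k).
Proof.
move=> h0 xab.
have H i : \forall k \near \oo, (`]a i, b i[%classic : set R) ((x - h k) 0 i).
  have xi := xab i; rewrite /= in_itv/= in xi; case/andP: xi => ax xb.
  have := h0 i => /cvgrPdist_lt /(_ (Num.min (x 0 i - a i) (b i - x 0 i))).
  rewrite lt_min !subr_gt0 ax xb => /(_ isT); apply: filterS => k.
  rewrite sub0r normrN lt_min => /andP[]; rewrite !ltr_norml => /andP[l1 l2] /andP[l3 l4].
  by rewrite /= in_itv/= !mxE; lra.
by apply: filter_forall => i; exact: H.
Qed.

(** As the translates of the indicator have the same norm, the integral of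
    (1_A(x - h) - 1_A(x))^2 is twice the volume of the part of A that the
    translated box misses.  That part shrinks to nothing because the box is
    open. *)
Lemma translation_continuous_open_box a b :
  L2_translation_continuous \1_(open_box a b).
Proof.
set A := open_box a b; have mA : measurable A by exact: measurable_open_box.
have L1 : L2 mu (\1_A : _ -> R) by apply: L2_indic => //; exact: lebesgue_open_box_lty.
split=> // h h0.
have mAk k : measurable_fun setT (fun x => \1_A (x - h k) : R).
  by apply: measurable_shift; exact: measurable_indic.
(* the part of A missed by the translated box *)
have dct : sqint mu (fun x => \1_A x * (1 - \1_A (x - h k))) @[k --> \oo] --> 0%E.
  apply: (sqint_cvg0 (G := fun x => \1_A x ^+ 2)).
  - move=> k; apply: measurable_funM; first exact: measurable_indic.
    exact: measurable_funB.
  - apply: nearW => x; have [xA|xA] := boolP (x \in A); last first.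
      by rewrite indicE (negbTE xA); under eq_fun do rewrite mul0r; exact: cvg_cst.
    apply: cvg_near_cst; have := open_box_near h0 (set_mem xA).
    by apply: filterS => k hk; rewrite !indicE xA mem_set// mul1r subrr.
  - move=> k x; rewrite !indicE; case: (x \in A); case: (_ \in A);
      by rewrite ?(mul0r,mul1r,subrr,subr0,expr0n,expr1n).
  - exact: integrable_sqr.
have -> : (fun k => sqint mu (fun x => \1_A (x - h k) - \1_A x)) =
    (fun k => sqint mu (fun x => \1_A x * (1 - \1_A (x - h k)))%R +
              sqint mu (fun x => \1_A x * (1 - \1_A (x - h k)))%R)%E.
  apply/funext => k; set B := fun x => \1_A (x - h k) : R.
  have B2 : L2 mu B by exact: L2_shift.
  have [mB _] := B2; have [mA1 _] := L1.
  have iAA := integrable_sqr L1; have iBB := integrable_sqr B2.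
  have iAB := integrable_mul L1 B2.
  have mAAB := integrableB measurableT iAA iAB.
  have mBAB := integrableB measurableT iBB iAB.
  have idem x : \1_A x ^+ 2 = \1_A x :> R.
    by rewrite indicE; case: (x \in A); rewrite ?expr0n ?expr1n.
  have idemB x : B x ^+ 2 = B x by exact: idem.
  transitivity (\int[mu]_x (((\1_A x ^+ 2)%R%:E - (\1_A x * B x)%R%:E) +
      ((B x ^+ 2)%R%:E - (\1_A x * B x)%R%:E)))%E.
    apply: eq_integral => x _; rewrite -!EFinB -EFinD; congr EFin.
    by rewrite /B; ring.
  rewrite integralD//; congr (_ + _)%E.
    apply: eq_integral => x _; rewrite -!EFinB; congr EFin.
    by rewrite exprMn idem -/(B x) sqrrB expr1n mul1r idemB; ring.
  rewrite integralB// [X in (X - _)%E](_ : _ = sqint mu \1_A); last exact: sqint_shift.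
  rewrite -integralB//; apply: eq_integral => x _; rewrite -!EFinB; congr EFin.
  by rewrite -/(B x); have := idemB x; have := idem x; rewrite !expr2; nra.
by rewrite -[X in _ --> X](adde0 0%E); exact: cvgeD.
Qed.

(** Cutting with a cube keeps all sets at hand of finite measure.  The sets with the
    property form a lambda-system: it is stable under proper differences
    by linearity, under increasing unions by closedness. *)
Lemma translation_continuous_indic_cube (A : set 'rV[R]_n) m : measurable A ->
  L2_translation_continuous \1_(A `&` cube m).
Proof.
move=> mA; suff : [set A | measurable A /\ L2_translation_continuous \1_(A `&` cube m)] A by case.
move: A mA; apply: rV_lambda_system; last first.
  move=> _ [a [b ->]]; split; first exact: measurable_open_box.
  have [c [d ->]] : open_boxes (open_box a b `&` cube m).
    by apply: open_boxesI; do 2 eexists.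
  exact: translation_continuous_open_box.
have mcube : measurable (@cube R n m) by exact: measurable_open_box.
split => //.
- by split; [exact: measurableT|rewrite setTI; exact: translation_continuous_open_box].
- move=> A B BA [mA tA] [mB tB]; split; first exact: measurableD.
  rewrite (_ : \1_(_ `&` _) = (fun x => \1_(A `&` cube m) x + (-1) * \1_(B `&` cube m) x)).
    by apply: translation_continuousD => //; exact: translation_continuousZ.
  apply/funext => x; rewrite setDE !indicE !in_setI in_setC.
  have [xB|xB] := boolP (x \in B); last by rewrite mulr0 addr0 andbT.
  by rewrite (mem_set (BA _ (set_mem xB)))/= mulN1r subrr.
- move=> F ndF HF; have mF i : measurable (F i) by have [] := HF i.
  have mUF : measurable (\bigcup_i F i) by exact: bigcupT_measurable.
  split=> //; apply: translation_continuous_approx.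
    apply: L2_indic; first exact: measurableI.
    apply: le_lt_trans (lebesgue_open_box_lty (fun=> - m%:R) (fun=> m%:R)).
    by apply: le_measure; [apply/mem_set; exact: measurableI|apply/mem_set; exact: mcube|exact: subIsetr].
  move=> e e0.
  have : sqint mu (fun x => \1_((\bigcup_i F i) `&` cube m) x - \1_(F k `&` cube m) x)
      @[k --> \oo] --> 0%E.
    apply: (sqint_cvg0 (G := fun x => \1_(cube m) x ^+ 2)).
    + by move=> k; apply: measurable_funB; apply: measurable_indic; exact: measurableI.
    + apply: nearW => x; rewrite !indicE in_setI.
      have [[k _ Fk]|xF] := pselect ((\bigcup_i F i) x).
        apply: cvg_near_cst; exists k => // l /= kl.
        have Fl : F l x by have /subsetPset := ndF _ _ kl; exact.
        rewrite indicE in_setI (mem_set Fl) mem_set ?subrr//.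
        by exists l.
      apply: cvg_near_cst; apply: nearW => k; rewrite indicE in_setI.
      have nFk : ~ F k x by move=> Fk; apply: xF; exists k.
      by rewrite (memNset xF) (memNset nFk) subrr.
    + move=> k x; rewrite !indicE !in_setI.
      case: (x \in \bigcup_i F i); case: (x \in F k); case: (x \in cube m);
      by rewrite /= ?subrr ?subr0 ?sub0r ?sqrrN ?expr0n ?expr1n.
    + by apply: integrable_sqr; apply: L2_indic => //; exact: lebesgue_open_box_lty.
  move=> /ge0_cvge0P => /(_ (fun k => sqint_ge0 _ _)) /(_ _ e0) [k _ /(_ k (leqnn k))] hk.
  by exists \1_(F k `&` cube m); split => //; have [] := HF k.
Qed.

Import HBNNSimple.

(** A nonnegative function is the increasing limit of simple functions; these
    are cut off to cubes so as to be square integrable. *)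
Lemma L2_translation_continuous_ge0 g : L2 mu g -> (forall x, 0 <= g x) ->
  L2_translation_continuous g.
Proof.
move=> g2 g0; apply: translation_continuous_approx => // e e0.
have mg : measurable_fun setT (EFin \o g) by apply/measurable_EFinP; exact: g2.1.
have g0' x : setT x -> (0 <= (EFin \o g) x)%E by rewrite lee_fin.
pose s := nnsfun_approx measurableT mg.
have sg k x : s k x <= g x.
  by have := le_approx k g0' (I : setT x); rewrite -nnsfun_approxE lee_fin.
have : sqint mu (fun x => g x - s k x * \1_(cube k) x) @[k --> \oo] --> 0%E.
  apply: (sqint_cvg0 (G := fun x => g x ^+ 2)).
  - move=> k; apply: measurable_funB; first exact: g2.1.
    by apply: measurable_funM => //; apply: measurable_indic; exact: measurable_open_box.
  - apply: nearW => x.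
    have := cvg_nnsfun_approx measurableT mg g0' (I : setT x) => /fine_cvgP[_ sx].
    rewrite -[X in _ --> X](subrr (g x)); apply: cvgB; first exact: cvg_cst.
    rewrite -[X in _ --> X]mulr1; apply: cvgM => //.
    apply: cvg_near_cst; have [k _ xk] : (\bigcup_k cube k) x by rewrite bigcup_cube.
    exists k => // l /= kl; rewrite indicE mem_set//.
    by have /subsetPset := @nd_cube R n _ _ kl; exact.
  - move=> k x; rewrite lerXn2r ?nnegrE//.
      rewrite subr_ge0 (le_trans _ (sg k x))// ler_piMr ?indicE ?lern1 ?leq_b1//.
    by rewrite lerBlDr lerDl mulr_ge0.
  - exact: integrable_sqr.
move=> /ge0_cvge0P => /(_ (fun k => sqint_ge0 _ _)) /(_ _ e0) [k _ /(_ k (leqnn k))] hk.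
exists (fun x => s k x * \1_(cube k) x); split => //.
rewrite (_ : (fun _ => _) = (fun x => \sum_(y <- finmap.enum_fset (fset_set (range (s k))))
    y * \1_(s k @^-1` [set y] `&` cube k) x)); last first.
  apply/funext => x; rewrite {1}fimfunE fsbig_finite//= mulr_suml.
  by apply: eq_bigr => y _; rewrite -mulrA !indicE in_setI -natrM mulnb.
elim: (finmap.enum_fset _) => [|y r IH].
  under eq_fun do rewrite big_nil; split; first exact: L2_0.
  move=> h _; under eq_fun do rewrite /sqint integral0_eq ?subrr ?expr0n//.
  exact: cvg_cst.
under eq_fun do rewrite big_cons; apply: translation_continuousD => //.
apply: translation_continuousZ; apply: translation_continuous_indic_cube.
by rewrite -[X in measurable X]setTI; exact: measurable_funPT.
Qed.

Theorem L2_translation_continuousP g : L2 mu g -> L2_translation_continuous g.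
Proof.
move=> g2; have [mg _] := g2.
have -> : g = (fun x => g^\+ x + (-1) * g^\- x).
  by rewrite -[LHS]funrposBneg; apply/funext => x; rewrite mulN1r.
apply: translation_continuousD; last apply: translation_continuousZ.
  apply: L2_translation_continuous_ge0 => //.
  apply: (@L2_le _ _ _ _ _ g 1) => //; first exact: measurable_funrpos.
  by move=> x; rewrite mul1r -[g x ^+ 2]real_normK ?num_real// lerXn2r ?nnegrE// /funrpos ge_max normr_ge0 ler_norm.
apply: L2_translation_continuous_ge0 => //.
apply: (@L2_le _ _ _ _ _ g 1) => //; first exact: measurable_funrneg.
by move=> x; rewrite mul1r -[g x ^+ 2]real_normK ?num_real// lerXn2r ?nnegrE// /funrneg ge_max normr_ge0 -normrN ler_norm.
Qed.

End translation_continuity.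

(** * A smooth flat function *)

Section smooth_line.
Variable R : realType.
Implicit Types (f g : R -> R) (k m : nat).

Lemma is_derive_ext (V : normedModType R) (f g : V -> R) (x v : V) (df dg : R) :
  is_derive x v f df -> f =1 g -> df = dg -> is_derive x v g dg.
Proof. by move=> fd /funext <- <-. Qed.

(** Differentiability to order k, stated with explicit derivatives so that
    sums, products and affine substitutions are handled by induction on k. *)
Fixpoint smooth_upto k g : Prop :=
  if k is l.+1 then
    exists dg : R -> R, (forall x : R, is_derive x (1 : R) g (dg x)) /\ smooth_upto l dg
  else continuous g.

Definition smooth g := forall k, smooth_upto k g.

Lemma is_derive_continuous g (dg : R -> R) : (forall x : R, is_derive x (1 : R) g (dg x)) -> continuous g.
Proof.
move=> gd x; apply: differentiable_continuous; apply/derivable1_diffP.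
by case: (gd x).
Qed.

Lemma smooth_uptoS k g : smooth_upto k.+1 g -> smooth_upto k g.
Proof.
elim: k g => [|k IH] g [dg [gd dgk]]; first exact: is_derive_continuous gd.
by exists dg; split => //; exact: IH.
Qed.

Lemma smooth_uptoD k f g : smooth_upto k f -> smooth_upto k g ->
  smooth_upto k (fun x => f x + g x).
Proof.
elim: k f g => [|k IH] f g.
  by move=> cf cg x; apply: cvgD; [exact: cf|exact: cg].
move=> [df [fd dfk]] [dg [gd dgk]]; exists (fun x => df x + dg x); split.
  by move=> x; exact: is_deriveD.
exact: IH.
Qed.

Lemma smooth_uptoM k f g : smooth_upto k f -> smooth_upto k g ->
  smooth_upto k (fun x => f x * g x).
Proof.
elim: k f g => [|k IH] f g.
  by move=> cf cg x; apply: cvgM; [exact: cf|exact: cg].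
move=> fk gk; move: (fk) (gk) => [df [fd dfk]] [dg [gd dgk]].
exists (fun x => f x * dg x + g x * df x); split.
  by move=> x; have := is_deriveM (f := f) (g := g); exact.
by apply: smooth_uptoD; apply: IH => //; exact: smooth_uptoS.
Qed.

Lemma smooth_upto_cst k (c : R) : smooth_upto k (fun=> c).
Proof.
elim: k c => [|k IH] c; first by move=> x; exact: cvg_cst.
by exists (fun=> 0); split => // x; exact: is_derive_cst.
Qed.

Lemma smooth_upto_affine k g (a b : R) : smooth_upto k g ->
  smooth_upto k (fun x => g (a * x + b)).
Proof.
have da x : is_derive x (1 : R) (fun x : R => a * x + b) a.
  have : is_derive x 1 ((a \*: (id : R -> R)) + cst b) (a *: 1 + 0).
    by apply: is_deriveD.
  by rewrite addr0 /GRing.scale/= mulr1.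
elim: k g => [|k IH] g.
  move=> cg x; apply: (continuous_comp (f := fun x : R => a * x + b)); last exact: cg.
  exact: (is_derive_continuous da).
move=> [dg [gd dgk]]; exists (fun x => dg (a * x + b) * a); split.
  by move=> x; apply: (is_derive1_comp (f := g) (g := fun x => a * x + b)).
by apply: smooth_uptoM; [exact: IH|exact: smooth_upto_cst].
Qed.

(** The function x^-m exp(-1/x), extended by 0 to the nonpositive numbers.  The
    parameter m makes the family stable under differentiation: the derivative of a
    member is a combination of two others, whence smoothness.  The case m = 0 is
    the classical smooth function that is flat at 0. *)
Definition flat_exp m (x : R) : R := if 0 < x then x ^- m * expR (- x^-1) else 0.

(** With t = 1/x the claim is t^(m+2) <= (m+2)^(m+2) exp t, which
    follows from t/(m+2) <= exp(t/(m+2)).  The bound by x^2 makes [flat_exp m]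
    differentiable at 0 with derivative 0. *)
Lemma flat_exp_le m x : `|flat_exp m x| <= (m.+2 ^ m.+2)%:R * x ^+ 2.
Proof.
rewrite /flat_exp; case: ifPn => [x0|_]; last by rewrite normr0 mulr_ge0 ?sqr_ge0.
rewrite ger0_norm; last by rewrite mulr_ge0 ?expR_ge0// invr_ge0 exprn_ge0// ltW.
have t0 : 0 < x^-1 by rewrite invr_gt0.
have H : (x^-1 / m.+2%:R) ^+ m.+2 <= expR (x^-1).
  rewrite -[in leRHS](divfK (_ : m.+2%:R != 0 :> R) x^-1) ?pnatr_eq0// [in leRHS]mulrC [in leRHS]expRM_natl.
  rewrite lerXn2r ?nnegrE ?expR_ge0 ?divr_ge0 ?ltW//.
  by apply: (lt_le_trans _ (expR_ge1Dx _)); rewrite ltrDr.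
rewrite expRN ler_pdivrMr ?expR_gt0//.
suff -> : x ^- m = (m.+2 ^ m.+2)%:R * x ^+ 2 * (x^-1 / m.+2%:R) ^+ m.+2.
  by apply: ler_wpM2l => //; rewrite mulr_ge0 ?sqr_ge0.
have := @expf_neq0 R m.+2%:R m.+2; rewrite pnatr_eq0 => /(_ isT).
have := @expf_neq0 R x m; rewrite gt_eqF// => /(_ isT).
rewrite expr_div_n natrX exprVn (_ : x ^+ m.+2 = x ^+ m * x ^+ 2); last by rewrite -exprD addn2.
move: (_ ^+ m.+2) (x ^+ m) => A X X0 A0; field.
by rewrite X0 A0 gt_eqF.
Qed.

Lemma is_derive_flat_exp m (x : R) :
  is_derive x (1 : R) (flat_exp m) (- m%:R * flat_exp m.+1 x + flat_exp m.+2 x).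
Proof.
have [x0|x0|<-] := ltgtP 0 x.
- rewrite {2 3}/flat_exp x0.
  have H : is_derive x (1 : R) (fun y : R => y ^- m * expR (- y^-1))
     (- m%:R * (x ^- m.+1 * expR (- x^-1)) + x ^- m.+2 * expR (- x^-1)).
    have iV : is_derive x (1 : R) (fun y : R => y^-1) (- x ^- 2).
      have := @is_deriveV _ id x 1 1 (lt0r_neq0 x0) _.
      by rewrite /GRing.scale/= mulr1; apply.
    have iE : is_derive x (1 : R) (fun y : R => expR (- y^-1)) (expR (- x^-1) * x ^- 2).
      apply: (is_derive1_comp (f := expR) (g := fun y => - y^-1)).
      rewrite -[X in is_derive _ _ _ X]opprK; exact: is_deriveN.
    have iX := @is_deriveX R R (fun y : R => y^-1) m x 1 _ iV.
    apply: (is_derive_ext (is_deriveM iX iE)).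
      by move=> y; rewrite -exprVn exprfctE.
    rewrite exprfctE /GRing.scale/= -!exprVn.
    move: (x^-1) (expR _) => v E; case: m {iX} => [|m]; last by rewrite /= !exprS; ring.
    by rewrite /= !exprS; ring.
  case: H => H1 <-; apply: DeriveDef.
    apply: near_eq_derivable H1.
    by near=> y; rewrite /flat_exp ifT//; near: y; exact: lt_nbhsr.
  apply: near_eq_derive.
  by near=> y; rewrite /flat_exp ifT//; near: y; exact: lt_nbhsr.
- rewrite {2 3}/flat_exp ltNge ltW//= mulr0 addr0.
  have [H1 H2] := is_derive_cst (0 : R) x (1 : R).
  rewrite -[X in is_derive _ _ _ X]H2; apply: DeriveDef.
    apply: near_eq_derivable H1.
    by near=> y; rewrite /flat_exp ifF//; apply/negbTE; rewrite -leNgt ltW//; near: y; exact: lt_nbhsl.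
  apply: near_eq_derive.
  by near=> y; rewrite /flat_exp ifF//; apply/negbTE; rewrite -leNgt ltW//; near: y; exact: lt_nbhsl.
- have f0 : flat_exp^~ 0 = fun=> 0 by apply/funext => k; rewrite /flat_exp ltxx.
  rewrite !(congr1 (@^~ _) f0) mulr0 addr0.
  have : (fun h : R => h^-1 *: (flat_exp m (h *: 1 + 0) - flat_exp m 0)) @ 0^' --> (0 : R).
    rewrite (congr1 (@^~ m) f0); set C : R := (m.+2 ^ m.+2)%:R.
    have C0 : 0 <= C by exact: ler0n.
    apply/cvgrPdist_lt => e e0; near=> h.
    have h0 : h != 0 by near: h; exact: nbhs_dnbhs_neq.
    rewrite subr0 addr0 sub0r normrN /GRing.scale/= mulr1 normrM normfV.
    rewrite ltr_pdivrMl ?normr_gt0//.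
    apply: le_lt_trans (flat_exp_le m h) _; rewrite -/C -[h ^+ 2]real_normK ?num_real//.
    rewrite expr2 mulrCA ltr_pM2l ?normr_gt0//.
    apply: (@le_lt_trans _ _ ((C + 1) * `|h|)); first by rewrite ler_wpM2r// lerDl.
    rewrite mulrC -ltr_pdivlMr ?ltr_wpDl//.
    by near: h; apply: dnbhs0_lt; rewrite divr_gt0// ltr_wpDl.
  move=> H; apply: DeriveDef; first by apply/cvg_ex; exists 0.
  exact/cvg_lim.
Unshelve. all: by end_near. Qed.

Lemma smooth_flat_exp m : smooth (flat_exp m).
Proof.
move=> k; elim: k m => [|k IH] m; first exact: (is_derive_continuous (is_derive_flat_exp m)).
exists (fun x => - m%:R * flat_exp m.+1 x + flat_exp m.+2 x); split.
  exact: is_derive_flat_exp.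
by apply: smooth_uptoD => //; apply: smooth_uptoM => //; exact: smooth_upto_cst.
Qed.

End smooth_line.

(** * Product test functions *)

Section bumps.
Variable R : realType.

Lemma smooth_derive (g : R -> R) : smooth g ->
  (forall x, is_derive x (1 : R) g (g^`() x)) /\ smooth g^`().
Proof.
move=> sg; split=> [x|k].
  by have [dg [gd _]] := sg 1%N; rewrite derive1E; apply: DeriveDef => //; case: (gd x).
have [dg [gd dgk]] := sg k.+1; rewrite (_ : g^`() = dg)//.
by apply/funext => x; rewrite derive1E; case: (gd x).
Qed.

Lemma smooth_continuous (g : R -> R) : smooth g -> continuous g.
Proof. by move=> /(_ 0%N). Qed.

(** Supported in [a, b] and, thanks to the dilation factor k + 1, increasing to the
    indicator of ]a, b[ as k grows. *)
Definition bump (k : nat) (a b x : R) : R :=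
  flat_exp 0 (k.+1%:R * (x - a)) * flat_exp 0 (k.+1%:R * (b - x)).

Lemma flat_exp0_itv (x : R) : 0 <= flat_exp 0 x <= 1.
Proof.
rewrite /flat_exp; case: ifPn => x0; last by rewrite lexx ler01.
by rewrite expr0 invr1 mul1r expR_ge0 -expR0 ler_expR oppr_le0 invr_ge0 ltW.
Qed.

Lemma bump_itv k a b x : 0 <= bump k a b x <= 1.
Proof.
have /andP[h1 h2] := flat_exp0_itv (k.+1%:R * (x - a)).
have /andP[h3 h4] := flat_exp0_itv (k.+1%:R * (b - x)).
by rewrite mulr_ge0//= mulr_ile1.
Qed.

Lemma bump_out k a b x : ~~ (a < x < b) -> bump k a b x = 0.
Proof.
rewrite negb_and -!leNgt /bump /flat_exp !pmulr_rgt0 ?ltr0Sn// !subr_gt0.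
by move=> /orP[|] h; [rewrite [a < x]ltNge h mul0r|rewrite [x < b]ltNge h mulr0].
Qed.

Lemma smooth_bump k a b : smooth (bump k a b).
Proof.
move=> m; apply: smooth_uptoM.
  rewrite (_ : (fun x => _) = (fun x => flat_exp 0 (k.+1%:R * x + (- (k.+1%:R * a))))).
    by apply: smooth_upto_affine; exact: smooth_flat_exp.
  by apply/funext => x; rewrite mulrBr.
rewrite (_ : (fun x => _) = (fun x => flat_exp 0 (- k.+1%:R * x + k.+1%:R * b))).
  by apply: smooth_upto_affine; exact: smooth_flat_exp.
by apply/funext => x; rewrite mulrBr mulNr addrC.
Qed.

Lemma flat_exp0_cvg1 (c : R) : 0 < c -> flat_exp 0 (k.+1%:R * c) @[k --> \oo] --> (1 : R).
Proof.
move=> c0; rewrite (_ : (fun k => _) = (fun k => expR (- (harmonic k * c^-1)))); last first.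
  by apply/funext => k; rewrite /flat_exp mulr_gt0// expr0 invr1 mul1r invfM.
rewrite -[X in _ --> X](@expR0 R) -oppr0 -(mul0r c^-1).
apply: (cvg_comp (fun k => - (harmonic k / c)) expR); last exact: continuous_expR.
by apply: cvgN; apply: cvgM; [exact: cvg_harmonic|exact: cvg_cst].
Qed.

Lemma bump_cvg a b x : bump k a b x @[k --> \oo] --> ((a < x < b)%R%:R : R).
Proof.
have [/andP[ax xb]|h] := boolP (a < x < b); last first.
  by under eq_fun do rewrite bump_out//; exact: cvg_cst.
rewrite /= -[X in _ --> X](mulr1 1).
by apply: cvgM; apply: flat_exp0_cvg1; rewrite subr_gt0.
Qed.

End bumps.

Section tensor_functions.
Variables (R : realType) (n : nat).
Implicit Types (g : 'I_n -> R -> R) (x z : 'rV[R]_n).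

(** Products of functions of one variable.  They form the only test functions used:
    their partial derivatives are again such products, so smoothness in several
    variables reduces to smoothness on the line. *)
Definition tensor_fun g x : R := \prod_(i < n) g i (x 0 i).

Definition derive_factor g (i : 'I_n) : 'I_n -> R -> R :=
  fun j => if j == i then (g j)^`() else g j.

Definition smooth_factors g := forall i, smooth (g i).

(** One radius for all the factors, so that the product vanishes outside a
    cube. *)
Definition supported_factors (L : R) g := forall i y, L < `|y| -> g i y = 0.

Lemma smooth_derive_factor g i : smooth_factors g -> smooth_factors (derive_factor g i).
Proof.
move=> sg j; rewrite /derive_factor; case: eqP => // _.
by have [] := smooth_derive (sg j).
Qed.

Lemma supported_derive_factor L g i : supported_factors L g ->
  supported_factors L (derive_factor g i).
Proof.
move=> sg j y Ly; rewrite /derive_factor; case: eqP => [_|_]; last exact: sg.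
rewrite derive1E -(derive_cst (0 : R) y (1 : R)); apply: near_eq_derive.
have : open [set y : R | L < `|y|].
  apply: (@open_comp _ _ (fun y : R => `|y|) [set y | L < y]).
    by move=> ? _; exact: norm_continuous.
  exact: open_gt.
rewrite openE => /(_ y Ly); rewrite /interior /=.
by apply: filterS => w; exact: sg.
Qed.

Lemma is_derive_prod (s : seq 'I_n) (F dF : 'I_n -> R -> R) (t : R) : uniq s ->
  (forall i, is_derive t (1 : R) (F i) (dF i t)) ->
  is_derive t (1 : R) (fun u => \prod_(i <- s) F i u)
    (\sum_(i <- s) \prod_(j <- s) (if j == i then dF j t else F j t)).
Proof.
move=> + Fd; elim: s => [_|i s IH /=/andP[si us]].
  rewrite big_nil; apply: (is_derive_ext (is_derive_cst (1 : R) t (1 : R))) => //.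
  by move=> u; rewrite big_nil.
apply: (is_derive_ext (is_deriveM (Fd i) (IH us))).
  by move=> u; rewrite big_cons.
rewrite /GRing.scale/= big_cons addrC; congr (_ + _).
  rewrite big_cons eqxx mulrC; congr (_ * _).
  rewrite !big_seq; apply: eq_bigr => j js.
  by rewrite ifN//; apply: contraNneq si => <-.
rewrite mulr_sumr !big_seq; apply: eq_bigr => j js.
by rewrite big_cons ifN//; apply: contraNneq si => ->.
Qed.

Lemma tensor_fun_path g x z (t : R) : smooth_factors g ->
  is_derive t (1 : R) (fun u : R => tensor_fun g (x + u *: z))
    (\sum_i z 0 i * tensor_fun (derive_factor g i) (x + t *: z)).
Proof.
move=> sg.
have Fd i : is_derive t (1 : R) (fun u : R => g i (x 0 i + u * z 0 i))
     ((derive1 (g i)) (x 0 i + t * z 0 i) * z 0 i).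
  apply: (is_derive1_comp (f := g i) (g := fun u => x 0 i + u * z 0 i)).
    exact: (smooth_derive (sg i)).1.
  have := is_deriveD (is_derive_cst (x 0 i) t (1 : R))
    (is_deriveM (is_derive_id t (1 : R)) (is_derive_cst (z 0 i) t (1 : R))).
  by rewrite /GRing.scale/= mulr0 add0r mulr1 add0r; apply.
apply: (is_derive_ext (is_derive_prod
  (F := fun i u => g i (x 0 i + u * z 0 i))
  (dF := fun i t => (derive1 (g i)) (x 0 i + t * z 0 i) * z 0 i)
  (index_enum_uniq _) Fd)).
  by move=> u; apply: eq_bigr => i _; rewrite !mxE.
apply: eq_bigr => i _; rewrite /tensor_fun (bigD1 i)//= [in RHS](bigD1 i)//=.
rewrite eqxx /derive_factor eqxx !mxE mulrA [z 0 i * _]mulrC; congr (_ * _).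
by apply: eq_bigr => j /negbTE ->; rewrite !mxE.
Qed.

(** A directional derivative is a derivative along a line. *)
Lemma is_derive_path (f : 'rV[R]_n -> R) x z (d : R) :
  is_derive (0 : R) (1 : R) (fun u : R => f (x + u *: z)) d -> is_derive x z f d.
Proof.
have E : (fun h : R => h^-1 *: (f (h *: z + x) - f x)) =
    (fun h : R => h^-1 *: (f (x + (h *: 1 + 0) *: z) - f (x + 0 *: z))).
  by apply/funext => h; rewrite addr0 scale0r addr0 [h *: 1]mulr1 [h *: z + x]addrC.
move=> [h1 h2]; apply: DeriveDef; first by rewrite /derivable E; exact: h1.
by rewrite /derive E; exact: h2.
Qed.

Lemma is_derive_tensor_fun g i x : smooth_factors g ->
  is_derive x (delta_mx 0 i) (tensor_fun g) (tensor_fun (derive_factor g i) x).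
Proof.
move=> sg; apply: is_derive_path.
apply: (is_derive_ext (tensor_fun_path x (delta_mx 0 i) 0 sg)) => //.
rewrite (bigD1 i)//= big1 ?addr0; last first.
  by move=> j ji; rewrite mxE (negbTE ji) andbF mul0r.
by rewrite mxE !eqxx mul1r scale0r addr0.
Qed.

Lemma partial_tensor_fun g i : smooth_factors g ->
  partial i (tensor_fun g) = tensor_fun (derive_factor g i).
Proof.
by move=> sg; apply/funext => x; case: (is_derive_tensor_fun i x sg).
Qed.

Lemma continuous_tensor_fun g : smooth_factors g -> continuous (tensor_fun g).
Proof.
move=> sg; rewrite /tensor_fun; elim: (index_enum _) => [|i s IH].
  by under eq_fun do rewrite big_nil; exact: cst_continuous.
under eq_fun do rewrite big_cons; move=> x.
have := @continuous_comp _ _ _ (fun x : 'rV[R]_n => x 0 i) (g i) x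
  (@coord_continuous R 1 n 0 i x) (smooth_continuous (sg i) (x := x 0 i)).
by move=> /continuousM; apply; exact: IH.
Qed.

Lemma Ck_tensor_fun k g : smooth_factors g -> Ck k (tensor_fun g).
Proof.
elim: k g => [|k IH] g sg; first by split => //; exact: continuous_tensor_fun.
split; first exact: continuous_tensor_fun.
move=> i; split; first by move=> x; case: (is_derive_tensor_fun i x sg).
by rewrite partial_tensor_fun//; apply: IH; exact: smooth_derive_factor.
Qed.

(** The support lies in a closed cube, hence is bounded and closed. *)
Lemma tensor_fun_test L g : smooth_factors g -> supported_factors L g ->
  test_function (tensor_fun g).
Proof.
move=> sg Lg; split; first by move=> k; exact: Ck_tensor_fun.
apply: bounded_closed_compact; last exact: closed_closure.
have cl : closed [set x : 'rV[R]_n | `|x| <= `|L|].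
  apply: (@closed_comp _ _ (fun y : 'rV[R]_n => `|y|) [set y | y <= `|L|]).
    by move=> ? _; exact: norm_continuous.
  exact: closed_le.
have sub : closure [set x | tensor_fun g x != 0] `<=` [set x : 'rV[R]_n | `|x| <= `|L|].
  rewrite [X in _ `<=` X]((closure_id _).1 cl); apply: closure_subset => x /=.
  move=> gx; rewrite [leLHS]/Num.Def.normr/= mx_normrE; apply/bigmax_leP.
  split => // -[i j] _ /=; rewrite ord1 leNgt; apply/negP => Lx.
  case/negP: gx; rewrite /tensor_fun (bigD1 j)//= (Lg j) ?mul0r//.
  exact: le_lt_trans (ler_norm L) Lx.
exists `|L|; split; first exact: num_real.
by move=> M LM x /sub /= xL; exact: le_trans xL (ltW LM).
Qed.

End tensor_functions.

(** * Weighted means and averages of translates *)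

Section weighted_mean.
Context d (Y : measurableType d) (R : realType).
Variable m : {measure set Y -> \bar R}.
Variable k : Y -> R.
Hypotheses (mk : measurable_fun setT k) (k0 : forall y, 0 <= k y).
Hypothesis k1 : (\int[m]_y (k y)%:E = 1)%E.
Implicit Types G : Y -> R.

Lemma integrable_weight : m.-integrable setT (EFin \o k).
Proof.
apply/integrableP; split; first exact/measurable_EFinP.
by under eq_integral do rewrite /= ger0_norm//; rewrite k1 ltry.
Qed.

(** |G| <= 1 + G^2, and the weight k is integrable. *)
Lemma integrable_weighted G : measurable_fun setT G ->
  (\int[m]_y (G y ^+ 2 * k y)%:E < +oo)%E ->
  m.-integrable setT (fun y => (G y ^+ 2 * k y)%:E) /\
  m.-integrable setT (fun y => (G y * k y)%:E).
Proof.
move=> mG fG.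
have i2 : m.-integrable setT (fun y => (G y ^+ 2 * k y)%:E).
  apply/integrableP; split.
    by apply/measurable_EFinP; apply: measurable_funM => //; exact: measurable_funX.
  rewrite (eq_integral (fun y => (G y ^+ 2 * k y)%:E))// => y _.
  by rewrite gee0_abs// lee_fin mulr_ge0// sqr_ge0.
split => //.
apply: (le_integrable measurableT _ _ (integrableD measurableT integrable_weight i2)).
  by apply/measurable_EFinP; exact: measurable_funM.
move=> y _ /=; rewrite lee_fin normrM (ger0_norm (k0 y)) [leRHS]ger0_norm; last first.
  by rewrite addr_ge0// mulr_ge0// sqr_ge0.
rewrite -[X in _ <= X + _]mul1r -mulrDl ler_wpM2r// -[G y ^+ 2]real_normK ?num_real//.
by have := sqr_ge0 (`|G y| - 1); have := normr_ge0 (G y); rewrite !expr2; nra.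
Qed.

(** Jensen's inequality for the square: the weighted variance of G around
    its mean is nonnegative.  When the right-hand side is finite, G is integrable
    against the weight; when it is infinite there is nothing to prove. *)
Lemma sqr_weighted_mean_le G : measurable_fun setT G ->
  (((\int[m]_y (G y * k y)) ^+ 2)%:E <= \int[m]_y (G y ^+ 2 * k y)%:E)%E.
Proof.
move=> mG; have [fG|] := ltP (\int[m]_y (G y ^+ 2 * k y)%:E)%E +oo%E; last first.
  by rewrite leye_eq => /eqP ->; exact: leey.
have [i2 i1] := integrable_weighted mG fG.
set c := \int[m]_y (G y * k y).
have : 0 <= \int[m]_y ((G y - c) ^+ 2 * k y).
  by apply: Rintegral_ge0 => y _; rewrite mulr_ge0// sqr_ge0.
have -> : \int[m]_y ((G y - c) ^+ 2 * k y) =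
    \int[m]_y ((G y ^+ 2 * k y + (- 2 * c) * (G y * k y)) + c ^+ 2 * k y).
  by apply: eq_Rintegral => y _; ring.
have iz := integrableZl measurableT (- 2 * c) i1.
have ik := integrableZl measurableT (c ^+ 2) integrable_weight.
rewrite RintegralD//; last exact: (integrableD measurableT i2 iz).
rewrite RintegralD// RintegralZl// RintegralZl//; last exact: integrable_weight.
rewrite -/c {2}/Rintegral k1/= mulr1 => h.
have finG : (\int[m]_y (G y ^+ 2 * k y)%:E)%E \is a fin_num by exact: integrable_fin_num.
by rewrite -(fineK finG) lee_fin; rewrite /Rintegral in h; nra.
Qed.

(** A perturbation l of weighted mean zero may be added inside the mean for free.
    It is used with l the linear term z . Du of the expansion of u, which the mean
    zero condition on the kernel removes. *)
Lemma sqr_weighted_mean_affine_le G (l : Y -> R) (c : R) : measurable_fun setT G ->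
  measurable_fun setT l -> m.-integrable setT (fun y => (l y * k y)%:E) ->
  \int[m]_y (l y * k y) = 0 ->
  (((\int[m]_y (G y * k y) - c) ^+ 2)%:E <= \int[m]_y ((G y - c + l y) ^+ 2 * k y)%:E)%E.
Proof.
move=> mG ml il l0; have mH : measurable_fun setT (fun y => G y - c + l y).
  by apply: measurable_funD => //; exact: measurable_funB.
have [fH|] := ltP (\int[m]_y ((G y - c + l y) ^+ 2 * k y)%:E)%E +oo%E; last first.
  by rewrite leye_eq => /eqP ->; exact: leey.
have [_ iH] := integrable_weighted mH fH.
suff -> : \int[m]_y (G y * k y) - c = \int[m]_y ((G y - c + l y) * k y).
  exact: sqr_weighted_mean_le.
have ic := integrableZl measurableT c integrable_weight.
have iHc := integrableD measurableT iH ic.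
have -> : \int[m]_y (G y * k y) =
    \int[m]_y (((G y - c + l y) * k y + c * k y) - l y * k y).
  by apply: eq_Rintegral => y _; ring.
rewrite RintegralB// RintegralD// l0 subr0 RintegralZl//; last exact: integrable_weight.
by rewrite [X in c * X]/Rintegral k1/= mulr1 addrK.
Qed.

End weighted_mean.

Section Rintegral_Fubini.
Context d1 d2 (X : measurableType d1) (Y : measurableType d2) (R : realType).
Variable m1 : {sigma_finite_measure set X -> \bar R}.
Variable m2 : {sigma_finite_measure set Y -> \bar R}.

(** The inner integrals are finite for almost every value of the outer variable
    only, hence the passage through extended reals. *)
Lemma Rintegral_Fubini (F : X * Y -> R) :
  (m1 \x m2)%E.-integrable setT (EFin \o F) ->
  \int[m1]_x (\int[m2]_y F (x, y)) = \int[m2]_y (\int[m1]_x F (x, y)).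
Proof.
move=> iF.
have e1 : (\int[m1]_x (\int[m2]_y F (x, y))%:E = \int[m1]_x \int[m2]_y (F (x, y))%:E)%E.
  apply: ae_eq_integral => //.
  - apply/measurable_EFinP; apply: (measurableT_comp (fine_measurable measurableT)).
    exact: (measurable_fubini_F iF).
  - exact: (measurable_fubini_F iF).
  - have := ae_integrable1 iF; apply: filterS => x ix _.
    by rewrite /Rintegral fineK//; exact: integrable_fin_num.
have e2 : (\int[m2]_y (\int[m1]_x F (x, y))%:E = \int[m2]_y \int[m1]_x (F (x, y))%:E)%E.
  apply: ae_eq_integral => //.
  - apply/measurable_EFinP; apply: (measurableT_comp (fine_measurable measurableT)).
    exact: (measurable_fubini_G iF).
  - exact: (measurable_fubini_G iF).
  - have := ae_integrable2 iF; apply: filterS => x ix _.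
    by rewrite /Rintegral fineK//; exact: integrable_fin_num.
by rewrite /Rintegral e1 e2; congr fine; exact: (Fubini iF).
Qed.

Lemma measurable_Rintegral2 (F : X * Y -> R) : measurable_fun setT F ->
  measurable_fun setT (fun x => \int[m2]_y F (x, y)).
Proof.
move=> mF; apply: (measurableT_comp (fine_measurable measurableT)).
rewrite (_ : (fun x => _) = (fun x => (\int[m2]_y (EFin \o F)^\+ (x, y) - \int[m2]_y (EFin \o F)^\- (x, y))%E)); last first.
  apply/funext => x; rewrite integralE; congr (_ - _)%E; apply: eq_integral => y _.
    by rewrite !funeposE.
  by rewrite !funenegE.
have mFE : measurable_fun setT (EFin \o F) by exact/measurable_EFinP.
apply: emeasurable_funB.
  apply: (@measurable_fun_fubini_tonelli_F _ _ _ _ _ m2 (EFin \o F)^\+%E) => //.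
  exact: measurable_funepos.
apply: (@measurable_fun_fubini_tonelli_F _ _ _ _ _ m2 (EFin \o F)^\-%E) => //.
exact: measurable_funeneg.
Qed.

End Rintegral_Fubini.

Section averaged_translates.
Variables (R : realType) (n : nat).
Local Notation mu := (lebesgue_rV R n).
Context d (Y : measurableType d).
Variable m : {sigma_finite_measure set Y -> \bar R}.
Variables (k : Y -> R) (tau : Y -> 'rV[R]_n).
Hypotheses (mk : measurable_fun setT k) (k0 : forall y, 0 <= k y).
Hypothesis k1 : (\int[m]_y (k y)%:E = 1)%E.
Hypothesis mtau : measurable_fun setT tau.
Implicit Types a b : 'rV[R]_n -> R.

(** Averages of translates along a family of vectors tau, with weight k.  The
    convolution is the case tau z = eps z with weight phi, and the mean of a function over
    the segment from x to x - z is the case tau t = t z with weight the indicator of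
    [0, 1]. *)
Definition average_translate b (x : 'rV[R]_n) : R := \int[m]_y (b (x - tau y) * k y).

Lemma measurable_pair_shift b : measurable_fun setT b ->
  measurable_fun setT (fun p : 'rV[R]_n * Y => b (p.1 - tau p.2)).
Proof.
move=> mb; apply: (measurableT_comp mb); apply: measurable_fun_rV => i.
rewrite (_ : (fun t => _) = (fun p : 'rV[R]_n * Y => p.1 0 i - tau p.2 0 i)); last first.
  by apply/funext => p; rewrite !mxE.
apply: measurable_funB.
  by apply: (measurableT_comp (measurable_rV_coord i)).
apply: (measurableT_comp (measurable_rV_coord i)).
exact: measurableT_comp.
Qed.

Lemma measurable_average_translate b : measurable_fun setT b ->
  measurable_fun setT (average_translate b).
Proof.
move=> mb; apply: (@measurable_Rintegral2 _ _ _ _ _ m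
  (fun p : 'rV[R]_n * Y => b (p.1 - tau p.2) * k p.2)).
apply: measurable_funM; first exact: measurable_pair_shift.
exact: measurableT_comp.
Qed.

(** By 2 |a b| <= a^2 + b^2 and translation invariance, the x-integral at fixed y
    is at most k y times the sum of the squared norms. *)
Lemma integrable_pair_shift a b : L2 mu a -> L2 mu b ->
  (mu \x m)%E.-integrable setT
    (fun p : 'rV[R]_n * Y => (a p.1 * (b (p.1 - tau p.2) * k p.2))%:E).
Proof.
move=> a2 b2; have [ma fa] := a2; have [mb fb] := b2.
have mF : measurable_fun setT
    (fun p : 'rV[R]_n * Y => (a p.1 * (b (p.1 - tau p.2) * k p.2))%:E).
  apply/measurable_EFinP; apply: measurable_funM; first exact: measurableT_comp.
  apply: measurable_funM; first exact: measurable_pair_shift.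
  exact: measurableT_comp.
apply/integrable21ltyP => //.
apply: (@le_lt_trans _ _ (\int[m]_y ((sqint mu a + sqint mu b) * (k y)%:E))%E).
  apply: ge0_le_integral => //.
  - by move=> y _; exact: integral_ge0.
  - apply: (@measurable_fun_fubini_tonelli_G _ _ _ _ _ mu
      (fun p : 'rV[R]_n * Y => `|(a p.1 * (b (p.1 - tau p.2) * k p.2))%:E|)%E) => //.
    exact: measurableT_comp.
  - by apply: measurable_funeM; exact/measurable_EFinP.
  - move=> y _; rewrite -(sqint_shift (tau y) mb).
    have mbs := measurable_shift (tau y) mb.
    rewrite /sqint -ge0_integralD//; try (by move=> x _; rewrite lee_fin sqr_ge0);
      try exact: measurable_sqr.
    rewrite -ge0_integralZr ?lee_fin//; last 2 first.
    + by apply: emeasurable_funD; exact: measurable_sqr.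
    + by move=> x _; rewrite adde_ge0// lee_fin sqr_ge0.
    apply: ge0_le_integral => //.
    + apply: measurableT_comp => //; apply/measurable_EFinP.
      exact: (measurable_funM ma (measurable_funM mbs (measurable_cst (k y)))).
    + apply: emeasurable_funM; last exact: measurable_cst.
      by apply: emeasurable_funD; exact: measurable_sqr.
    + move=> x _ /=; rewrite -EFinD -EFinM lee_fin mulrA normrM (ger0_norm (k0 y)) ler_wpM2r//.
      rewrite ler_norml; have := sqr_ge0 (a x - b (x - tau y)); have := sqr_ge0 (a x + b (x - tau y)).
      by have := sqr_ge0 (a x); have := sqr_ge0 (b (x - tau y)); rewrite !expr2; lra.
have mkE : measurable_fun setT (EFin \o k) by exact/measurable_EFinP.
rewrite ge0_integralZl//; last 2 first.
- by move=> y _; rewrite lee_fin.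
- by rewrite adde_ge0// sqint_ge0.
by rewrite k1 mule1 lte_add_pinfty.
Qed.

(** Duality between averaging translates and pairing: translations are moved
    out of the x-integral. *)
Lemma average_translate_Fubini a b : L2 mu a -> L2 mu b ->
  \int[mu]_x (a x * average_translate b x) =
  \int[m]_y (k y * \int[mu]_x (a x * b (x - tau y))).
Proof.
move=> a2 b2; have iF := integrable_pair_shift a2 b2.
transitivity (\int[mu]_x \int[m]_y (a x * (b (x - tau y) * k y))).
  have mF : measurable_fun setT
      (fun p : 'rV[R]_n * Y => a p.1 * (b (p.1 - tau p.2) * k p.2)).
    by apply/measurable_EFinP; exact: measurable_int iF.
  rewrite /Rintegral; congr fine; apply: ae_eq_integral => //.
  - apply/measurable_EFinP; apply: measurable_funM; first exact: a2.1.
    by apply: measurable_average_translate; exact: b2.1.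
  - by apply/measurable_EFinP; exact: (measurable_Rintegral2 m mF).
  - have := ae_integrable1 iF; apply: filterS => x ix _; congr EFin.
    have [ax0|ax0] := eqVneq (a x) 0.
      by rewrite /Rintegral integral0_eq ?ax0 ?mul0r// => y _; rewrite mul0r.
    have ibk : m.-integrable setT (EFin \o (fun y => b (x - tau y) * k y)).
      have := integrableZl measurableT (a x)^-1 ix.
      by apply: eq_integrable => // y _; rewrite /= -EFinM mulKf.
    by rewrite -[RHS]/(\int[m]_y (a x * (b (x - tau y) * k y))) RintegralZl.
rewrite (Rintegral_Fubini iF); apply: eq_Rintegral => y _.
rewrite -RintegralZl//; last by apply: integrable_mul => //; exact: L2_shift.
by apply: eq_Rintegral => x _; ring.
Qed.

(** Integrated Jensen inequality: a pointwise bound by a weighted mean square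
    becomes, by Tonelli, a bound of the norm by the weighted mean of the squared
    norms. *)
Lemma sqint_weighted_mean_le (F : 'rV[R]_n -> R) (G : 'rV[R]_n * Y -> R) :
  measurable_fun setT F -> measurable_fun setT G ->
  (forall x, ((F x ^+ 2)%:E <= \int[m]_y (G (x, y) ^+ 2 * k y)%:E)%E) ->
  (sqint mu F <= \int[m]_y ((k y)%:E * sqint mu (fun x => G (x, y))))%E.
Proof.
move=> mF mG FG.
have mGx x : measurable_fun setT (fun y => G (x, y)) by exact: measurableT_comp.
have mGy y : measurable_fun setT (fun x => G (x, y)) by exact: measurableT_comp.
have mG2 : measurable_fun setT (fun p : 'rV[R]_n * Y => (G p ^+ 2 * k p.2)%:E).
  apply/measurable_EFinP; apply: measurable_funM; first exact: measurable_funX.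
  exact: measurableT_comp.
have pos x y : (0 <= (G (x, y) ^+ 2 * k y)%:E)%E by rewrite lee_fin mulr_ge0// sqr_ge0.
apply: (@le_trans _ _ (\int[mu]_x \int[m]_y (G (x, y) ^+ 2 * k y)%:E)%E).
  apply: ge0_le_integral => //.
  - by move=> x _; rewrite lee_fin sqr_ge0.
  - exact: measurable_sqr.
  - by apply: (@measurable_fun_fubini_tonelli_F _ _ _ _ _ m
      (fun p : 'rV[R]_n * Y => (G p ^+ 2 * k p.2)%:E)) => // -[].
rewrite (@fubini_tonelli _ _ _ _ _ mu m (fun p : 'rV[R]_n * Y => (G p ^+ 2 * k p.2)%:E))//; last by case.
apply: ge0_le_integral => //=.
- by move=> y _; exact: integral_ge0.
- by apply: (@measurable_fun_fubini_tonelli_G _ _ _ _ _ mu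
    (fun p : 'rV[R]_n * Y => (G p ^+ 2 * k p.2)%:E)) => // -[].
- apply: emeasurable_funM; first exact/measurable_EFinP.
  apply: (@measurable_fun_fubini_tonelli_G _ _ _ _ _ mu (fun p : 'rV[R]_n * Y => (G p ^+ 2)%:E)).
    by apply/measurable_EFinP; exact: measurable_funX.
  by case=> x y; rewrite lee_fin sqr_ge0.
move=> y _; rewrite muleC -ge0_integralZr//.
- exact: measurable_sqr.
- by move=> x _; rewrite lee_fin sqr_ge0.
- by rewrite lee_fin.
Qed.

End averaged_translates.

(** * The fundamental lemma of the calculus of variations *)

Section fundamental_lemma.
Variables (R : realType) (n : nat).
Local Notation mu := (lebesgue_rV R n).
Implicit Types (g : 'I_n -> R -> R) (a b : 'I_n -> R) (x z : 'rV[R]_n) (v : 'rV[R]_n -> R).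

Lemma measurable_tensor_fun g : smooth_factors g -> measurable_fun setT (tensor_fun g).
Proof.
move=> sg; apply: measurable_prod => i _.
apply: (measurableT_comp _ (measurable_rV_coord i)).
by apply: continuous_measurable_fun; exact: smooth_continuous.
Qed.

(** The extreme value theorem on [-L, L]. *)
Lemma supported_bounded (L : R) (f : R -> R) : continuous f ->
  (forall y, L < `|y| -> f y = 0) -> exists2 M, 0 <= M & forall y, `|f y| <= M.
Proof.
move=> cf fL.
have [L0|L0] := ltP L 0.
  by exists 0 => // y; rewrite fL ?normr0// (lt_le_trans L0).
have [||c _ hc] := @EVT_max R (fun y => `|f y|) (- L) L; first lra.
  apply: continuous_subspaceT => y; apply: (continuous_comp (g := fun z : R => `|z|)).
    exact: cf.
  exact: norm_continuous.
exists `|f c| => // y; have [Ly|yL] := ltP L `|y|; first by rewrite fL// normr0.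
by apply: hc; rewrite in_itv/= -ler_norml.
Qed.

Lemma L2_tensor_fun L g : smooth_factors g -> supported_factors L g ->
  L2 mu (tensor_fun g).
Proof.
move=> sg Lg.
have /(_ _)/cid2 Mg i := supported_bounded (smooth_continuous (sg i)) (Lg i).
pose M i := sval (Mg i).
have M0 i : 0 <= M i by rewrite /M; case: (Mg i).
have gM i y : `|g i y| <= M i by rewrite /M; case: (Mg i).
have [m Lm] : exists m : nat, L < m%:R.
  by exists (Num.truncn L).+1; exact: truncnS_gt.
apply: (@L2_le _ _ _ _ _ \1_(cube m) ((\prod_i M i) ^+ 2)).
- exact: sqr_ge0.
- exact: measurable_tensor_fun.
- by apply: L2_indic; [exact: measurable_open_box|exact: lebesgue_open_box_lty].
move=> x; have [xm|xm] := pselect (cube m x).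
  rewrite indicE mem_set// expr1n mulr1 -real_normK ?num_real// lerXn2r ?nnegrE//.
    by apply: prodr_ge0.
  by rewrite normr_prod; apply: ler_prod => i _; rewrite normr_ge0 gM.
have -> : tensor_fun g x = 0; last by rewrite expr0n mulr_ge0// sqr_ge0.
apply: contrapT => gx; apply: xm; apply: mem_cube => i.
rewrite ltNge; apply/negP => mx; apply: gx.
by rewrite /tensor_fun (bigD1 i)//= Lg ?mul0r// (lt_le_trans Lm).
Qed.

Definition bump_factors k a b : 'I_n -> R -> R := fun i => bump k (a i) (b i).

Lemma smooth_bump_factors k a b : smooth_factors (bump_factors k a b).
Proof. by move=> i; exact: smooth_bump. Qed.

Lemma supported_bump_factors k a b :
  supported_factors (\sum_i (`|a i| + `|b i|)) (bump_factors k a b).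
Proof.
move=> i y; rewrite (bigD1 i)//= => ly; apply: bump_out.
have h : 0 <= \sum_(j < n | j != i) (`|a j| + `|b j|) by apply: sumr_ge0 => j _; rewrite addr_ge0.
apply/negP => /andP[ay yb].
have : `|y| <= `|a i| + `|b i|; last by lra.
have := ler_norm (a i); have := ler_norm (b i); have := ler_norm (- a i); have := ler_norm (- b i).
rewrite !normrN => h1 h2 h3 h4; have := normr_ge0 (a i); have := normr_ge0 (b i).
by rewrite ler_norml; lra.
Qed.

Lemma indic_open_box a b x :
  \1_(open_box a b) x = \prod_i (a i < x 0 i < b i)%R%:R :> R.
Proof.
rewrite indicE; have [xB|xB] := pselect (open_box a b x).
  by rewrite mem_set// big1// => i _; have := xB i; rewrite /= in_itv/= => ->.
rewrite memNset//; symmetry.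
have [i hi] : exists i, ~~ (a i < x 0 i < b i).
  apply/existsP; apply: contra_notT xB; rewrite negb_exists => /forallP h i.
  by rewrite /= in_itv/=; have := h i; rewrite negbK.
by rewrite (bigD1 i)//= (negbTE hi) mul0r.
Qed.

Lemma bump_factors_cvg a b x :
  tensor_fun (bump_factors k a b) x @[k --> \oo] --> (\1_(open_box a b) x : R).
Proof.
rewrite indic_open_box /tensor_fun; elim: (index_enum _) => [|i s IH].
  by rewrite big_nil; under eq_fun do rewrite big_nil; exact: cvg_cst.
rewrite big_cons; under eq_fun do rewrite big_cons.
by apply: cvgM => //; exact: bump_cvg.
Qed.

(** The indicator to which the bumps converge is also their majorant in dominated
    convergence. *)
Lemma bump_factors_le k a b x :
  `|tensor_fun (bump_factors k a b) x| <= \1_(open_box a b) x.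
Proof.
rewrite indic_open_box normr_prod; apply: ler_prod => i _; rewrite normr_ge0/=.
case: (boolP (a i < x 0 i < b i)) => h; last by rewrite /bump_factors bump_out// normr0.
by have /andP[h0 h1] := bump_itv k (a i) (b i) (x 0 i); rewrite ger0_norm.
Qed.

(** The limit, by dominated convergence, of the integrals against the bumps. *)
Lemma integral_open_box_eq0 v a b : L2 mu v ->
  (forall g L, smooth_factors g -> supported_factors L g ->
     \int[mu]_x (v x * tensor_fun g x) = 0) ->
  (\int[mu]_x (v x * \1_(open_box a b) x)%:E = 0)%E.
Proof.
move=> v2 hv; have B2 : L2 mu \1_(open_box a b).
  by apply: L2_indic; [exact: measurable_open_box|exact: lebesgue_open_box_lty].
have T2 k := L2_tensor_fun (@smooth_bump_factors k a b) (@supported_bump_factors k a b).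
have [||_ _ h] := @dominated_convergence _ _ _ mu setT measurableT
  (fun k x => (v x * tensor_fun (bump_factors k a b) x)%:E)
  (fun x => (v x * \1_(open_box a b) x)%:E)
  (fun x => `|(v x * \1_(open_box a b) x)%R%:E|%E)
  (fun k => measurable_int _ (integrable_mul v2 (T2 k)))
  (measurable_int _ (integrable_mul v2 B2)) _ (integrable_abse (integrable_mul v2 B2)) _.
- apply: nearW => x _; apply: cvg_EFin; first exact: nearW.
  by apply: cvgM; [exact: cvg_cst|exact: bump_factors_cvg].
- apply: nearW => x k _; rewrite !abse_EFin lee_fin !normrM ler_wpM2l//.
  by apply: (le_trans (bump_factors_le k a b x)); exact: ler_norm.
have z k : (\int[mu]_x (v x * tensor_fun (bump_factors k a b) x)%:E = 0)%E.
  have := hv _ _ (@smooth_bump_factors k a b) (@supported_bump_factors k a b).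
  rewrite /Rintegral => e; rewrite -[LHS]fineK ?e//.
  by apply: integrable_fin_num => //; exact: integrable_mul.
apply: (cvg_unique _ h) => //.
by rewrite (_ : (fun k => _) = (fun=> 0%E)); [exact: cvg_cst|exact/funext].
Qed.

(** The cube keeps the indicators square integrable, so that v is integrable on the
    sets at hand and the pi-lambda argument applies. *)
Lemma integral_cube_eq0 v (A : set 'rV[R]_n) m : L2 mu v ->
  (forall g L, smooth_factors g -> supported_factors L g ->
     \int[mu]_x (v x * tensor_fun g x) = 0) ->
  measurable A ->
  (\int[mu]_x (v x * \1_(A `&` cube m) x)%:E = 0)%E.
Proof.
move=> v2 hv mA.
suff : [set A | measurable A /\ (\int[mu]_x (v x * \1_(A `&` cube m) x)%:E = 0)%E] A by case.
have mcube : measurable (@cube R n m) by exact: measurable_open_box.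
have L2A B : measurable B -> L2 mu \1_(B `&` cube m).
  move=> mB; apply: L2_indic; first exact: measurableI.
  apply: le_lt_trans (lebesgue_open_box_lty (fun=> - m%:R) (fun=> m%:R)).
  by apply: le_measure; [apply/mem_set; exact: measurableI|apply/mem_set; exact: mcube|exact: subIsetr].
have iA B : measurable B -> mu.-integrable setT (fun x => (v x * \1_(B `&` cube m) x)%:E).
  by move=> mB; apply: integrable_mul => //; exact: L2A.
move: A mA; apply: rV_lambda_system; last first.
  move=> _ [a [b ->]]; split; first exact: measurable_open_box.
  have [c [d ->]] : open_boxes (open_box a b `&` cube m).
    by apply: open_boxesI; do 2 eexists.
  exact: integral_open_box_eq0.
split => //.
- by split; [exact: measurableT|rewrite setTI; exact: integral_open_box_eq0].
- move=> A B BA [mA tA] [mB tB]; split; first exact: measurableD.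
  rewrite (_ : (fun x => _) = (fun x => (v x * \1_(A `&` cube m) x)%:E - (v x * \1_(B `&` cube m) x)%:E)%E).
    rewrite integralB//; last 2 first.
    - exact: iA.
    - exact: iA.
    by rewrite tA tB subee.
  apply/funext => x; rewrite -EFinB -mulrBr setDE !indicE !in_setI in_setC.
  have [xB|xB] := boolP (x \in B); last by rewrite subr0 andbT.
  by rewrite (mem_set (BA _ (set_mem xB)))/= subrr.
- move=> F ndF HF; have mF i : measurable (F i) by have [] := HF i.
  have mUF : measurable (\bigcup_i F i) by exact: bigcupT_measurable.
  split=> //.
  have [||_ _ h] := @dominated_convergence _ _ _ mu setT measurableT
    (fun k x => (v x * \1_(F k `&` cube m) x)%:E)
    (fun x => (v x * \1_((\bigcup_i F i) `&` cube m) x)%:E)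
    (fun x => `|(v x * \1_((\bigcup_i F i) `&` cube m) x)%R%:E|%E)
    (fun k => measurable_int _ (iA _ (mF k)))
    (measurable_int _ (iA _ mUF)) _ (integrable_abse (iA _ mUF)) _.
  + apply: nearW => x _; have [[k _ Fk]|xF] := pselect ((\bigcup_i F i) x).
      apply: cvg_near_cst; exists k => // l /= kl.
      have Fl : F l x by have /subsetPset := ndF _ _ kl; exact.
      have Ul : (\bigcup_i F i) x by exists l.
      by rewrite !indicE !in_setI (mem_set Fl) (mem_set Ul).
    apply: cvg_near_cst; apply: nearW => k; rewrite !indicE !in_setI.
    have nFk : ~ F k x by move=> Fk; apply: xF; exists k.
    by rewrite (memNset xF) (memNset nFk).
  + apply: nearW => x k _; rewrite !abse_EFin lee_fin !normrM ler_wpM2l//.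
    rewrite !indicE !in_setI !ger0_norm ?ler0n// ler_nat.
    have [Fk|//] := boolP (x \in F k).
    have Uk : (\bigcup_i F i) x by exists k => //; exact: set_mem.
    by rewrite (mem_set Uk).
  apply: (cvg_unique _ h) => //.
  rewrite (_ : (fun k => _) = (fun=> 0%E)); first exact: cvg_cst.
  by apply/funext => k; have [] := HF k.
Qed.

Lemma ae_eq0_cube v : measurable_fun setT v ->
  (forall m, {ae mu, forall x, setT x -> (v x * \1_(@cube R n m) x)%:E = 0%E}) ->
  {ae mu, forall x, v x = 0}.
Proof.
move=> mv h.
have := @negligible_bigcup _ _ _ mu (fun m => ~` [set x | setT x -> (v x * \1_(@cube R n m) x)%:E = 0%E]) h.
apply: negligibleS => x /= vx.
have [k _ xk] : (\bigcup_k cube k) x by rewrite bigcup_cube.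
exists k => //= => /(_ I)[]; rewrite indicE mem_set// mulr1; exact: vx.
Qed.

(** Vanishing against product test functions gives vanishing against indicators
    of open boxes in the limit, then of bounded measurable sets by the
    pi-lambda argument, and so v = 0 almost everywhere on each cube. *)
Theorem fundamental_lemma v : L2 mu v ->
  (forall g L, smooth_factors g -> supported_factors L g ->
     \int[mu]_x (v x * tensor_fun g x) = 0) ->
  {ae mu, forall x, v x = 0}.
Proof.
move=> v2 hv; apply: ae_eq0_cube => [|m]; first exact: v2.1.
have C2 : L2 mu (\1_(cube m) : 'rV[R]_n -> R).
  by apply: L2_indic; [exact: measurable_open_box|exact: lebesgue_open_box_lty].
apply: (@integral_ae_eq _ _ _ mu setT measurableT (cst 0%E) (fun x => (v x * \1_(cube m) x)%:E)).
- exact: integrable_mul.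
- exact: measurable_cst.
move=> E _ mE; rewrite integral0 -[RHS](integral_cube_eq0 m v2 hv mE) integral_mkcond.
apply: eq_integral => x _; rewrite patchE !indicE in_setI.
by case: (x \in E); rewrite //= mulr0.
Qed.

End fundamental_lemma.

(** * Difference quotients of functions with a weak gradient *)

Section difference_quotient.
Variables (R : realType) (n : nat).
Local Notation mu := (lebesgue_rV R n).
Local Notation leb := (@lebesgue_measure R).
Implicit Types (x z h : 'rV[R]_n) (g : 'I_n -> R -> R) (L : R) (u w : 'rV[R]_n -> R) (Du : 'rV[R]_n -> 'rV[R]_n).

Definition unit_weight : measurableTypeR R -> R := \1_(`[0, 1]%classic).

Lemma measurable_unit_weight : measurable_fun setT unit_weight.
Proof. exact: measurable_indic. Qed.

Lemma unit_weight_ge0 t : 0 <= unit_weight t.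
Proof. by rewrite /unit_weight indicE. Qed.

Lemma integral_unit_weight : (\int[leb]_t (unit_weight t)%:E = 1)%E.
Proof.
rewrite integral_indic// setIT; have := @lebesgue_measure_itv R `[0, 1]%R.
by rewrite /= lte_fin ltr01 sube0.
Qed.

Definition segment z (t : measurableTypeR R) : 'rV[R]_n := t *: z.

Lemma measurable_segment z : measurable_fun setT (segment z).
Proof.
apply: measurable_fun_rV => i.
rewrite (_ : (fun t => _) = (fun t : measurableTypeR R => t * z 0 i)).
  exact: measurable_funM.
by apply/funext => t; rewrite mxE.
Qed.

Definition segment_mean z w := average_translate leb unit_weight (segment z) w.

Lemma ge0_integral_unit_weight_le (C : \bar R) (F : R -> \bar R) :
  measurable_fun setT F -> (0 <= C)%E ->
  (forall t, 0 <= F t <= C)%E ->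
  (\int[leb]_t ((unit_weight t)%:E * F t) <= C)%E.
Proof.
move=> mF C0 FC.
have mk : measurable_fun setT (EFin \o unit_weight) by apply/measurable_EFinP; exact: measurable_unit_weight.
apply: (@le_trans _ _ (\int[leb]_t ((unit_weight t)%:E * C))%E).
  apply: ge0_le_integral => //.
  - by move=> t _; rewrite mule_ge0 ?lee_fin ?unit_weight_ge0//; have /andP[] := FC t.
  - exact: emeasurable_funM.
  - exact: emeasurable_funM.
  - by move=> t _; rewrite lee_wpmul2l ?lee_fin ?unit_weight_ge0//; have /andP[] := FC t.
rewrite ge0_integralZr//; last by move=> t _; rewrite lee_fin unit_weight_ge0.
by rewrite integral_unit_weight mul1e.
Qed.

Lemma measurable_sqint_pair d (Y : measurableType d) (G : 'rV[R]_n * Y -> R) :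
  measurable_fun setT G -> measurable_fun setT (fun y => sqint mu (fun x => G (x, y))).
Proof.
move=> mG.
apply: (@measurable_fun_fubini_tonelli_G _ _ _ _ _ mu (fun p : 'rV[R]_n * Y => (G p ^+ 2)%:E)).
  by apply/measurable_EFinP; exact: measurable_funX.
by move=> p; rewrite lee_fin sqr_ge0.
Qed.

Lemma L2_segment_mean z w : L2 mu w -> L2 mu (segment_mean z w).
Proof.
move=> [mw w2]; split.
  apply: measurable_average_translate => //; first exact: measurable_unit_weight.
  exact: measurable_segment.
have mG := @measurable_pair_shift _ _ _ _ _ (measurable_segment z) _ mw.
have mS : measurable_fun setT (segment_mean z w).
  apply: measurable_average_translate => //; first exact: measurable_unit_weight.
  exact: measurable_segment.
apply: le_lt_trans (sqint_weighted_mean_le measurable_unit_weight unit_weight_ge0 mS mG _) _.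
  move=> x; apply: (sqr_weighted_mean_le measurable_unit_weight unit_weight_ge0
    integral_unit_weight (G := fun t => w (x - segment z t))).
  exact: measurableT_comp mG (pair1_measurable x).
apply: le_lt_trans w2; apply: ge0_integral_unit_weight_le.
- exact: measurable_sqint_pair mG.
- exact: sqint_ge0.
- by move=> t; rewrite sqint_ge0/= sqint_shift.
Qed.

(** A translate of a product is the product of the translates of its factors, so
    the class of test functions is invariant under translation. *)
Definition shift_factors (h : 'rV[R]_n) (g : 'I_n -> R -> R) : 'I_n -> R -> R :=
  fun i y => g i (y + h 0 i).

Lemma tensor_fun_shift h g x : tensor_fun (shift_factors h g) x = tensor_fun g (x + h).
Proof. by apply: eq_bigr => i _; rewrite mxE. Qed.

Lemma smooth_shift_factors h g : smooth_factors g -> smooth_factors (shift_factors h g).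
Proof.
move=> sg i k; rewrite (_ : shift_factors h g i = (fun y => g i (1 * y + h 0 i))).
  by apply: smooth_upto_affine; exact: sg.
by apply/funext => y; rewrite mul1r.
Qed.

Lemma supported_shift_factors h g L : supported_factors L g ->
  supported_factors (L + \sum_i `|h 0 i|) (shift_factors h g).
Proof.
move=> gL i y; rewrite (bigD1 i)//= => Ly; apply: gL.
have s0 : 0 <= \sum_(j < n | j != i) `|h 0 j| by apply: sumr_ge0.
have : `|y| <= `|y + h 0 i| + `|h 0 i|; last by lra.
by rewrite -{1}(addrK (h 0 i) y); apply: ler_normB.
Qed.

Lemma derive_factor_shift h g i : smooth_factors g ->
  derive_factor (shift_factors h g) i = shift_factors h (derive_factor g i).
Proof.
move=> sg; apply/funext => j; apply/funext => y; rewrite /derive_factor/shift_factors.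
case: eqP => // _; rewrite derive1E.
have [_] : is_derive y (1 : R) (fun y => g j (y + h 0 j)) (derive1 (g j) (y + h 0 j) * 1).
  apply: (is_derive1_comp (f := g j) (g := fun y => y + h 0 j)).
    exact: (smooth_derive (sg j)).1.
  have := is_deriveD (is_derive_id y (1 : R)) (is_derive_cst (h 0 j) y (1 : R)).
  by rewrite addr0; apply.
by rewrite mulr1.
Qed.

Definition directional_derivative z g x : R :=
  \sum_i z 0 i * tensor_fun (derive_factor g i) x.

Lemma L2_directional_derivative z g L : smooth_factors g -> supported_factors L g ->
  L2 mu (directional_derivative z g).
Proof.
move=> sg gL; apply: L2_sum => i; apply: L2Z; apply: (@L2_tensor_fun _ _ L).
  exact: smooth_derive_factor.
exact: supported_derive_factor.
Qed.

(** The fundamental theorem of calculus along the segment from x to x + z, written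
    as an average of translates so that it can be dualised. *)
Lemma tensor_fun_FTC z g x : smooth_factors g ->
  tensor_fun g (x + z) - tensor_fun g x =
  segment_mean (- z) (directional_derivative z g) x.
Proof.
move=> sg; pose F (t : R) := tensor_fun g (x + t *: z).
pose f (t : R) := directional_derivative z g (x + t *: z).
have dF t : is_derive t (1 : R) F (f t) by exact: tensor_fun_path.
have cF : continuous F by exact: is_derive_continuous dF.
have cf : continuous f.
  rewrite /f /directional_derivative; elim: (index_enum _) => [|i s IH].
    by under eq_fun do rewrite big_nil; exact: cst_continuous.
  under eq_fun do rewrite big_cons; move=> t; apply: cvgD; last exact: IH.
  apply: cvgM; first exact: cvg_cst.
  exact: (is_derive_continuous (fun t => tensor_fun_path x z t (smooth_derive_factor i sg))).
have FTC : (\int[leb]_(t in `[0%R, 1%R]) (f t)%:E = (F 1)%:E - (F 0)%:E)%E.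
  apply: continuous_FTC2 => //.
  - exact: continuous_subspaceT.
  - split.
    + by move=> t _; case: (dF t).
    + by apply: cvg_at_right_filter; exact: cF.
    + by apply: cvg_at_left_filter; exact: cF.
  - by move=> t _; rewrite derive1E; case: (dF t).
rewrite /segment_mean /average_translate /Rintegral.
rewrite (_ : integral _ _ _ = (F 1)%:E - (F 0)%:E)%E.
  by rewrite /F scale1r scale0r addr0.
rewrite -FTC [RHS]integral_mkcond; apply: eq_integral => t _.
rewrite patchE /unit_weight indicE /f /segment scalerN opprK.
by case: (t \in _); rewrite ?mulr1// mulr0.
Qed.

Lemma L2_dotv z Du : (forall i, L2 mu (fun x => Du x 0 i)) -> L2 mu (fun x => dotv z (Du x)).
Proof. by move=> D2; apply: L2_sum => i; apply: L2Z. Qed.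

(** The definition of the weak gradient, tested with the translate of
    [tensor_fun g] by h and combined linearly with the coordinates of z. *)
Lemma weak_directional_derivative u Du z h g L :
  L2 mu u -> weak_gradient_L2 u Du ->
  smooth_factors g -> supported_factors L g ->
  \int[mu]_x (u x * directional_derivative z g (x + h)) =
  - \int[mu]_x (tensor_fun g x * dotv z (Du (x - h))).
Proof.
move=> u2 wD sg gL.
have D2 i : L2 mu (fun x => Du x 0 i) by exact: Lfun2_L2 (wD i).1.
have sh := smooth_shift_factors h sg; have hL := supported_shift_factors (h := h) gL.
have T2 := L2_tensor_fun sh hL.
have dT2 i := L2_tensor_fun (smooth_derive_factor i sh) (supported_derive_factor i hL).
transitivity (\int[mu]_x \sum_i (z 0 i * (u x * tensor_fun (derive_factor (shift_factors h g) i) x))).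
  apply: eq_Rintegral => x _; rewrite /directional_derivative mulr_sumr.
  by apply: eq_bigr => i _; rewrite derive_factor_shift// tensor_fun_shift; ring.
rewrite Rintegral_sum; last first.
  by move=> i; exact: (integrableZl measurableT (z 0 i) (integrable_mul u2 (dT2 i))).
transitivity (- \int[mu]_x \sum_i (z 0 i * (Du x 0 i * tensor_fun (shift_factors h g) x))).
  rewrite Rintegral_sum; last first.
    by move=> i; exact: (integrableZl measurableT (z 0 i) (integrable_mul (D2 i) T2)).
  rewrite -sumrN; apply: eq_bigr => i _.
  rewrite RintegralZl//; last exact: integrable_mul.
  rewrite RintegralZl//; last exact: integrable_mul.
  rewrite -mulrN; congr (_ * _).
  have := (wD i).2 _ (tensor_fun_test sh hL).
  by rewrite partial_tensor_fun.
congr (- _).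
have [mD _] := L2_dotv z D2.
have mT := measurable_tensor_fun sg.
rewrite -[LHS](Rintegral_shift h).
  apply: eq_Rintegral => x _; rewrite tensor_fun_shift subrK /dotv mulr_sumr.
  by apply: eq_bigr => i _; ring.
rewrite (_ : (fun x => _) = (fun x => tensor_fun (shift_factors h g) x * dotv z (Du x))).
  by apply: measurable_funM => //; case: T2.
apply/funext => x; rewrite /dotv mulr_sumr.
by apply: eq_bigr => i _; ring.
Qed.

(** Pair the left-hand side with a product test function and move all the
    translations onto it: the difference u (x - z) - u x becomes the difference
    of two translates of the test function, an average of directional derivatives along
    the segment, and each of them is transferred to Du by the weak derivative.
    The two averages then cancel. *)
Lemma weak_FTC u Du z : L2 mu u -> weak_gradient_L2 u Du ->
  {ae mu, forall x, u (x - z) - u x + segment_mean z (fun x => dotv z (Du x)) x = 0}.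
Proof.
move=> u2 wD; set w := fun x => dotv z (Du x).
have D2 i : L2 mu (fun x => Du x 0 i) by exact: Lfun2_L2 (wD i).1.
have w2 : L2 mu w by exact: L2_dotv.
have W2 := L2_segment_mean z w2.
have u2z := L2_shift z u2.
apply: fundamental_lemma.
  by apply: L2D => //; exact: L2B.
move=> g L sg gL.
have T2 := L2_tensor_fun sg gL.
have T2z : L2 mu (fun x => tensor_fun g (x + z)).
  by have := L2_shift (- z) T2; under eq_fun do rewrite opprK.
have d2 := L2_directional_derivative z sg gL.
transitivity (\int[mu]_x (u (x - z) * tensor_fun g x - u x * tensor_fun g x +
    tensor_fun g x * segment_mean z w x)).
  by apply: eq_Rintegral => x _; ring.
have i1 := integrable_mul u2z T2; have i2 := integrable_mul u2 T2.
have i3 := integrable_mul T2 W2.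
rewrite RintegralD//; last exact: (integrableB measurableT i1 i2).
rewrite RintegralB//.
have -> : \int[mu]_x (u (x - z) * tensor_fun g x) = \int[mu]_x (u x * tensor_fun g (x + z)).
  rewrite -[LHS](Rintegral_shift (- z)).
    by apply: eq_Rintegral => x _; rewrite opprK addrK.
  by apply: measurable_funM; [exact: u2z.1|exact: T2.1].
rewrite -RintegralB//; last exact: integrable_mul.
transitivity (\int[mu]_x (u x * segment_mean (- z) (directional_derivative z g) x) +
   \int[mu]_x (tensor_fun g x * segment_mean z w x)).
  by congr (_ + _); apply: eq_Rintegral => x _; rewrite -mulrBr tensor_fun_FTC.
rewrite (average_translate_Fubini measurable_unit_weight unit_weight_ge0
   integral_unit_weight (measurable_segment (- z)) u2 d2).
have -> : \int[mu]_x (tensor_fun g x * segment_mean z w x) =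
    - \int[mu]_x (- tensor_fun g x * segment_mean z w x).
  rewrite -mulN1r -RintegralZl//; last exact: (integrable_mul (L2N T2) W2).
  by apply: eq_Rintegral => x _; ring.
rewrite (average_translate_Fubini measurable_unit_weight unit_weight_ge0
   integral_unit_weight (measurable_segment z) (L2N T2) w2).
(* the two averages over t agree term by term *)
apply/eqP; rewrite subr_eq0; apply/eqP; apply: eq_Rintegral => t _; congr (_ * _).
have := weak_directional_derivative z (t *: z) u2 wD sg gL.
move=> e; transitivity (\int[mu]_x (u x * directional_derivative z g (x + t *: z))).
  by apply: eq_Rintegral => x _; rewrite /segment scalerN opprK.
rewrite e -mulN1r -RintegralZl//; last first.
  exact: (integrable_mul T2 (L2_shift (t *: z) w2)).
by apply: eq_Rintegral => x _; rewrite /w; ring.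
Qed.

(** By [weak_FTC] the function on the left is the mean over t in [0, 1] of
    z . Du(x) - z . Du(x - t z); apply Jensen's inequality. *)
Lemma difference_quotient_le u Du z : L2 mu u -> weak_gradient_L2 u Du ->
  (sqint mu (fun x => u (x - z) - u x + dotv z (Du x))%R <=
   \int[leb]_t ((unit_weight t)%:E *
     sqint mu (fun x => dotv z (Du x) - dotv z (Du (x - t *: z)))%R))%E.
Proof.
move=> u2 wD; set w := fun x => dotv z (Du x).
have D2 i : L2 mu (fun x => Du x 0 i) by exact: Lfun2_L2 (wD i).1.
have w2 : L2 mu w by exact: L2_dotv.
have [mw fw] := w2.
have W2 := L2_segment_mean z w2.
have mG : measurable_fun setT
    (fun p : 'rV[R]_n * measurableTypeR R => w p.1 - w (p.1 - segment z p.2)).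
  apply: measurable_funB; first exact: measurableT_comp.
  exact: measurable_pair_shift (measurable_segment z) _ mw.
have -> : sqint mu (fun x => u (x - z) - u x + w x) =
    sqint mu (fun x => segment_mean z w x - w x).
  apply: ae_eq_integral => //.
  - apply: measurable_sqr; apply: measurable_funD => //; apply: measurable_funB; last exact: u2.1.
    exact: measurable_shift u2.1.
  - by apply: measurable_sqr; apply: measurable_funB => //; exact: W2.1.
  - have := weak_FTC z u2 wD; apply: filterS => x ux _; congr EFin.
    have -> : u (x - z) - u x = - segment_mean z w x by apply/eqP; rewrite -addr_eq0 ux.
    by ring.
apply: (sqint_weighted_mean_le measurable_unit_weight unit_weight_ge0 _ mG).
  by apply: measurable_funB => //; exact: W2.1.
move=> x /=.
have mwx : measurable_fun setT (fun t => w (x - segment z t)).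
  exact: measurableT_comp (measurable_pair_shift (measurable_segment z) mw) (pair1_measurable x).
apply: le_trans (sqr_weighted_mean_affine_le (l := fun=> 0) measurable_unit_weight unit_weight_ge0
  integral_unit_weight (w x) mwx _ _ _) _.
- exact: measurable_cst.
- by under eq_fun do rewrite mul0r; exact: integrable0.
- by under eq_Rintegral do rewrite mul0r; rewrite /Rintegral integral0.
rewrite le_eqVlt; apply/orP; left; apply/eqP; apply: eq_integral => t _; congr EFin; ring.
Qed.

End difference_quotient.

(** * The Taylor remainder *)

Section taylor.
Variables (R : realType) (f : R -> R).
Hypothesis f_C2 : C2 f.
Variable M : R.
Hypothesis fM : forall x : R, `|(f^`(2))%classic x| <= M.
Hypotheses (f0 : f 0 = 0) (df0 : derive1 f 0 = 0).

Local Notation f1 := (derive1 f).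
Local Notation f2 := (f^`(2))%classic.

Lemma C2_is_derive (x : R) : is_derive x (1 : R) f (f1 x).
Proof. by case: f_C2 => h _ _; rewrite derive1E; exact: (DeriveDef (h x) erefl). Qed.

Lemma C2_is_derive_derive1 (x : R) : is_derive x (1 : R) f1 (f2 x).
Proof.
have [_ h _] := f_C2; rewrite -[f2 x]/(derive1 f1 x) derive1E.
exact: (DeriveDef (h x) erefl).
Qed.

Lemma bound_derive2_ge0 : 0 <= M.
Proof. exact: le_trans (normr_ge0 _) (fM 0). Qed.

(** The two distance bounds replace betweenness and do not depend on the order of
    the end points. *)
Lemma MVT_unordered (g dg : R -> R) (a c : R) :
  (forall x : R, is_derive x (1 : R) g (dg x)) ->
  exists s, [/\ g a - g c = dg s * (a - c), `|s - c| <= `|a - c| & `|s - a| <= `|a - c|].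
Proof.
move=> gd; have cg := is_derive_continuous gd.
have [ac|ca|->] := ltgtP a c.
- have [|s] := @MVT R g dg a c ac (fun x _ => gd x); first exact: continuous_subspaceT.
  rewrite in_itv/= => /andP[as_ sc] e; exists s; split.
  + by rewrite -opprB e -mulrN opprB.
  + by rewrite ltr0_norm ?subr_lt0// ltr0_norm ?subr_lt0//; lra.
  + by rewrite gtr0_norm ?subr_gt0// ltr0_norm ?subr_lt0//; lra.
- have [|s] := @MVT R g dg c a ca (fun x _ => gd x); first exact: continuous_subspaceT.
  rewrite in_itv/= => /andP[as_ sc] e; exists s; split => //.
  + by rewrite gtr0_norm ?subr_gt0// gtr0_norm ?subr_gt0//; lra.
  + by rewrite ltr0_norm ?subr_lt0// gtr0_norm ?subr_gt0//; lra.
- by exists c; rewrite !subrr mulr0 normr0; split.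
Qed.

Lemma derive1_lipschitz a c : `|f1 a - f1 c| <= M * `|a - c|.
Proof.
have [s [-> _ _]] := MVT_unordered a c C2_is_derive_derive1.
by rewrite normrM ler_wpM2r.
Qed.

Definition taylor_rem (a c : R) := f a - f c - f1 c * (a - c).

Lemma taylor_rem_le a c : `|taylor_rem a c| <= M * (a - c) ^+ 2.
Proof.
rewrite /taylor_rem; have [s [-> sc _]] := MVT_unordered a c C2_is_derive.
rewrite -mulrBl normrM -[_ ^+ 2]real_normK ?num_real// expr2 mulrA ler_wpM2r//.
apply: le_trans (derive1_lipschitz _ _) _; rewrite ler_wpM2l//; exact: bound_derive2_ge0.
Qed.

(** The mean value theorem applied twice, first to the second-order remainder, then to
    its derivative. *)
Lemma taylor_rem_second_le a c e :
  (forall s, `|s - c| <= `|a - c| -> `|f2 s - f2 c| <= e) ->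
  `|taylor_rem a c - 2^-1 * f2 c * (a - c) ^+ 2| <= e * (a - c) ^+ 2.
Proof.
move=> he.
(* up to a constant, the second-order remainder at c, and its derivative *)
pose g s := f s - f1 c * s - 2^-1 * f2 c * (s - c) ^+ 2.
pose g1 s := f1 s - f1 c - f2 c * (s - c).
have gd (x : R) : is_derive x (1 : R) g (g1 x).
  have d1 := C2_is_derive x.
  have d2 : is_derive x (1 : R) (fun s : R => f1 c * s) (f1 c).
    have := is_deriveM (is_derive_cst (f1 c) x (1 : R)) (is_derive_id x (1 : R)).
    by rewrite /GRing.scale/= mulr0 addr0 mulr1; apply.
  have d3 : is_derive x (1 : R) (fun s : R => s - c) 1.
    have := is_deriveB (is_derive_id x (1 : R)) (is_derive_cst c x (1 : R)).
    by rewrite subr0; apply.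
  have d4 := is_deriveM (is_derive_cst (2^-1 * f2 c) x (1 : R)) (is_deriveM d3 d3).
  apply: (is_derive_ext (is_deriveB (is_deriveB d1 d2) d4)).
    by move=> s; rewrite /g expr2.
  by rewrite /g1 /GRing.scale/=; field.
have g1d (x : R) : is_derive x (1 : R) g1 (f2 x - f2 c).
  have d1 := C2_is_derive_derive1 x.
  have d3 : is_derive x (1 : R) (fun s : R => s - c) 1.
    have := is_deriveB (is_derive_id x (1 : R)) (is_derive_cst c x (1 : R)).
    by rewrite subr0; apply.
  have d4 := is_deriveM (is_derive_cst (f2 c) x (1 : R)) d3.
  apply: (is_derive_ext (is_deriveB (is_deriveB d1 (is_derive_cst (f1 c) x (1 : R))) d4)) => //.
  by rewrite /GRing.scale/= mulr0 addr0 mulr1 subr0.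
have -> : taylor_rem a c - 2^-1 * f2 c * (a - c) ^+ 2 = g a - g c.
  by rewrite /taylor_rem /g; ring.
have [s [-> sc _]] := MVT_unordered a c gd.
have -> : g1 s = g1 s - g1 c by rewrite /g1 !subrr mulr0 !subr0.
have [t [-> tc _]] := MVT_unordered s c g1d.
rewrite !normrM -[(a - c) ^+ 2]real_normK ?num_real// expr2 mulrA ler_wpM2r//.
by apply: ler_pM => //; apply: he; exact: le_trans tc sc.
Qed.

(** Along increments of size e_k with slopes q_k tending to p, the second-order
    remainder is o(e_k^2) by the continuity of f'' at c. *)
Lemma taylor_rem_cvg (e q : nat -> R) (c p : R) :
  (forall k, 0 < e k) -> e k @[k --> \oo] --> 0 -> q k @[k --> \oo] --> p ->
  (e k ^- 2 * taylor_rem (c + e k * q k) c) @[k --> \oo] --> 2^-1 * f2 c * p ^+ 2.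
Proof.
move=> e0 ec qp.
have c2 : continuous f2 by case: f_C2.
have qsq : (q k ^+ 2) @[k --> \oo] --> p ^+ 2.
  by rewrite expr2; under eq_fun do rewrite expr2; exact: cvgM.
have eq0 : (e k * q k) @[k --> \oo] --> 0 by rewrite -(mul0r p); exact: cvgM.
pose rem k := e k ^- 2 * taylor_rem (c + e k * q k) c - 2^-1 * f2 c * q k ^+ 2.
have remc : rem k @[k --> \oo] --> 0.
  apply/cvgrPdist_le => d d0.
  (* p^2 + 1 eventually bounds q_k^2 *)
  have C0 : 0 < p ^+ 2 + 1 by rewrite ltr_wpDl ?sqr_ge0.
  have := c2 c => /cvgrPdist_le /(_ (d / (p ^+ 2 + 1))).
  rewrite divr_gt0// => /(_ isT)[r /= r0 hr].
  near=> k; rewrite sub0r normrN.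
  have ek : `|e k * q k| < r.
    by near: k; have := eq0 => /cvgrPdist_lt /(_ _ r0); apply: filterS => k; rewrite sub0r normrN.
  have qk : q k ^+ 2 <= p ^+ 2 + 1.
    near: k; have := qsq => /cvgrPdist_le /(_ 1 ltr01); apply: filterS => k.
    by rewrite ler_norml; lra.
  have aux : `|taylor_rem (c + e k * q k) c - 2^-1 * f2 c * (c + e k * q k - c) ^+ 2| <=
      d / (p ^+ 2 + 1) * (c + e k * q k - c) ^+ 2.
    apply: taylor_rem_second_le => s.
    rewrite [c + _]addrC addrK => sc; rewrite distrC; apply: hr.
    by rewrite /= distrC; exact: le_lt_trans sc ek.
  have e2 : 0 < e k ^+ 2 by rewrite exprn_gt0.
  rewrite -(ler_pM2l e2) -[X in X * `|_|](ger0_norm (ltW e2)) -normrM.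
  have -> : e k ^+ 2 * rem k =
      taylor_rem (c + e k * q k) c - 2^-1 * f2 c * (c + e k * q k - c) ^+ 2.
    rewrite /rem [c + _ - c]addrC addKr mulrBr mulrA divff ?gt_eqF// mul1r.
    by congr (_ - _); ring.
  apply: le_trans aux _; rewrite [c + _ - c]addrC addKr exprMn mulrCA ler_pM2l//.
  by rewrite -[leRHS](divfK (lt0r_neq0 C0)) ler_wpM2l// divr_ge0// ltW.
rewrite (_ : (fun k => _) = (fun k => rem k + 2^-1 * f2 c * q k ^+ 2)); last first.
  by apply/funext => k; rewrite /rem subrK.
rewrite -[X in _ --> X]add0r; apply: cvgD => //; apply: cvgM => //; exact: cvg_cst.
Unshelve. all: by end_near. Qed.

Lemma C2_le_sqr (t : R) : `|f t| <= M * t ^+ 2.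
Proof.
by have := taylor_rem_le t 0; rewrite /taylor_rem f0 df0 mul0r !subr0.
Qed.

Lemma derive1_le_norm (t : R) : `|f1 t| <= M * `|t|.
Proof. by have := derive1_lipschitz t 0; rewrite df0 !subr0. Qed.

Lemma C2_measurable : measurable_fun setT f.
Proof. by apply: continuous_measurable_fun; exact: is_derive_continuous C2_is_derive. Qed.

Lemma C2_measurable_derive1 : measurable_fun setT f1.
Proof. by apply: continuous_measurable_fun; exact: is_derive_continuous C2_is_derive_derive1. Qed.

Lemma C2_measurable_derive2 : measurable_fun setT f2.
Proof. by apply: continuous_measurable_fun; case: f_C2. Qed.

End taylor.

(** * Convergence of the difference quotients *)

(** L^2 convergence gives almost everywhere convergence along a subsequence only;
    this principle makes that sufficient.  If a does not converge to l, a
    subsequence a o s stays at a positive distance from l, and then so does every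
    a o s o t, for monotone t or not. *)
Lemma cvg_subsubseq (R : realType) (a : nat -> R) (l : R) :
  (forall s : nat -> nat, (forall k, (k <= s k)%N) ->
     exists t : nat -> nat, a (s (t k)) @[k --> \oo] --> l) ->
  a k @[k --> \oo] --> l.
Proof.
move=> h; apply: contrapT => nal.
have [e e0 he] : exists2 e, 0 < e & forall N, exists k, (N <= k)%N /\ e <= `|l - a k|.
  apply: contrapT => hn; apply: nal; apply/cvgrPdist_lt => e e0.
  apply: contrapT => hk; apply: hn; exists e => // N.
  apply: contrapT => hN; apply: hk; exists N => // k /= Nk.
  by rewrite ltNge; apply/negP => ek; apply: hN; exists k.
have [s sP] := choice he.
have [t tl] := h s (fun k => (sP k).1).
move/cvgrPdist_lt : tl => /(_ _ e0)[k _ /(_ k (leqnn k))].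
by rewrite /= ltNge (sP _).2.
Qed.

(** Fast L^2 convergence to zero.  The series of the squares has finite
    integral, hence it converges almost everywhere, and its sum S is an
    integrable majorant of all the squares at once. *)
Lemma ae_cvg0_summable d (T : measurableType d) (R : realType)
    (mu : {measure set T -> \bar R}) (F : nat -> T -> R) :
  (forall k, measurable_fun setT (F k)) ->
  (forall k, (sqint mu (F k) <= (1 / (2 ^ k.+1)%:R)%:E)%E) ->
  let S := fun x => (\sum_(0 <= k <oo) (F k x ^+ 2)%:E)%E in
  [/\ mu.-integrable setT S, (forall x k, ((F k x ^+ 2)%:E <= S x)%E) &
      {ae mu, forall x, F k x @[k --> \oo] --> 0}].
Proof.
move=> mF hF S.
have pos k x : (0 <= (F k x ^+ 2)%:E)%E by rewrite lee_fin sqr_ge0.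
have S0 x : (0 <= S x)%E by apply: nneseries_ge0.
have mS : measurable_fun setT S.
  by apply: ge0_emeasurable_sum => // k _; exact: measurable_sqr.
have iS : mu.-integrable setT S.
  apply/integrableP; split => //.
  under eq_integral do rewrite gee0_abs//.
  rewrite integral_nneseries//; last by move=> k; exact: measurable_sqr.
  apply: (@le_lt_trans _ _ 1%E); last by rewrite ltry.
  apply: le_trans (epsilon_trick0 xpredT (ler01 : 0 <= 1 :> R)).
  by apply: lee_nneseries => [k _ _|k _]; [exact: sqint_ge0|exact: hF].
split => //.
  move=> x k; apply: le_trans (nneseries_lim_ge (P := xpredT) k.+1 (fun i _ _ => pos i x)).
  by rewrite big_nat_recr//= leeDr// sume_ge0.
have := integrable_ae measurableT iS; apply: filterS => x /(_ I) Sx.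
have : cvgn (series (fun k => F k x ^+ 2)).
  apply: nnseries_is_cvg; first by move=> k; exact: sqr_ge0.
  by move: Sx; rewrite ge0_fin_numE.
move=> /cvg_series_cvg_0.
move=> /cvgrPdist_lt h; apply/cvgrPdist_lt => e e0.
have := h (e ^+ 2); rewrite exprn_gt0// => /(_ isT); apply: filterS => k.
rewrite !sub0r !normrN normrX => he.
by rewrite -(ltr_pXn2r (n := 2))// nnegrE ltW.
Qed.

Section quotient_limits.
Variables (R : realType) (n : nat).
Local Notation mu := (lebesgue_rV R n).
Local Notation leb := (@lebesgue_measure R).
Variables (u : 'rV[R]_n -> R) (Du : 'rV[R]_n -> 'rV[R]_n).
Hypotheses (u2 : L2 mu u) (wD : weak_gradient_L2 u Du).
Implicit Types (z : 'rV[R]_n) (eps : R).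

Let D2 i : L2 mu (fun x => Du x 0 i). Proof. exact: Lfun2_L2 (wD i).1. Qed.
Let w2 z : L2 mu (fun x => dotv z (Du x)). Proof. exact: L2_dotv. Qed.

Definition diff_quotient eps z (x : 'rV[R]_n) : R := eps^-1 * (u (x - eps *: z) - u x).

(** The sign is due to the shift by minus eps z: the quotient tends to
    - z . Du. *)
Definition diff_quotient_error eps z (x : 'rV[R]_n) : R := diff_quotient eps z x + dotv z (Du x).

Lemma L2_diff_quotient eps z : L2 mu (diff_quotient eps z).
Proof. by apply: L2Z; apply: L2B => //; exact: L2_shift. Qed.

Lemma L2_diff_quotient_error eps z : L2 mu (diff_quotient_error eps z).
Proof. by apply: L2D => //; exact: L2_diff_quotient. Qed.

Lemma dotvZl (c : R) z y : dotv (c *: z) y = c * dotv z y.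
Proof. by rewrite /dotv mulr_sumr; apply: eq_bigr => i _; rewrite mxE mulrA. Qed.

Lemma diff_quotient_error_scaled eps z : eps != 0 ->
  (fun x => u (x - eps *: z) - u x + dotv (eps *: z) (Du x)) =
  (fun x => eps * diff_quotient_error eps z x).
Proof.
by move=> e0; apply/funext => x; rewrite /diff_quotient_error /diff_quotient mulrDr mulVKf// dotvZl.
Qed.

Lemma measurable_translate_error z h :
  measurable_fun setT (fun t : measurableTypeR R =>
    sqint mu (fun x => dotv z (Du x) - dotv z (Du (x - t *: h)))).
Proof.
have mG : measurable_fun setT (fun p : 'rV[R]_n * measurableTypeR R =>
    dotv z (Du p.1) - dotv z (Du (p.1 - segment h p.2))).
  apply: measurable_funB; first by apply: (measurableT_comp (w2 z).1).
  exact: measurable_pair_shift (measurable_segment h) _ (w2 z).1.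
exact: measurable_sqint_pair mG.
Qed.

Lemma diff_quotient_error_le eps z : 0 < eps ->
  (sqint mu (diff_quotient_error eps z) <=
   \int[leb]_t ((unit_weight t)%:E *
     sqint mu (fun x => dotv z (Du x) - dotv z (Du (x - t *: (eps *: z))))%R))%E.
Proof.
move=> e0; have := difference_quotient_le (eps *: z) u2 wD.
rewrite (diff_quotient_error_scaled z (lt0r_neq0 e0)) sqintZ; last exact: (L2_diff_quotient_error eps z).1.
have mk : measurable_fun setT (EFin \o (@unit_weight R)).
  by apply/measurable_EFinP; exact: measurable_unit_weight.
rewrite (_ : integral _ _ _ = (eps ^+ 2)%:E * \int[leb]_t ((unit_weight t)%:E *
     sqint mu (fun x => dotv z (Du x) - dotv z (Du (x - t *: (eps *: z))))%R))%E.
  by rewrite lee_pmul2l ?lte_fin ?exprn_gt0.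
rewrite -ge0_integralZl//; last 3 first.
- by apply: emeasurable_funM => //; exact: measurable_translate_error.
- by move=> t _; rewrite mule_ge0 ?sqint_ge0// lee_fin unit_weight_ge0.
- by rewrite lee_fin sqr_ge0.
apply: eq_integral => t _; rewrite muleCA; congr (_ * _)%E.
rewrite -sqintZ.
  by apply: sqint_eq => x; rewrite !dotvZl mulrBr.
apply: measurable_funB; first exact: (w2 z).1.
exact: measurable_shift (w2 z).1.
Qed.

Lemma translate_error_le z h :
  (sqint mu (fun x => dotv z (Du x) - dotv z (Du (x - h)))%R <= 4%:E * sqint mu (fun x => dotv z (Du x)))%E.
Proof.
have [mw _] := w2 z; have mws := measurable_shift h mw.
apply: le_trans (sqintB _ mw mws) _; rewrite (sqint_shift h mw).
by rewrite -ge0_muleDl// -EFinD; rewrite (_ : 2 + 2 = 4 :> R)//; ring.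
Qed.

Lemma diff_quotient_error_bound eps z : 0 < eps ->
  (sqint mu (diff_quotient_error eps z) <= 4%:E * sqint mu (fun x => dotv z (Du x)))%E.
Proof.
move=> e0; apply: le_trans (diff_quotient_error_le z e0) _.
apply: ge0_integral_unit_weight_le.
- exact: measurable_translate_error.
- by rewrite mule_ge0// sqint_ge0.
- by move=> t; rewrite sqint_ge0/= translate_error_le.
Qed.

(** Dominated convergence in t, the pointwise limit being the L^2 continuity of
    translations applied to z . Du. *)
Lemma diff_quotient_error_cvg0 (e : nat -> R) z : (forall k, 0 < e k) ->
  e k @[k --> \oo] --> 0 ->
  sqint mu (diff_quotient_error (e k) z) @[k --> \oo] --> 0%E.
Proof.
move=> e0 ec.
pose T k (t : R) := sqint mu (fun x => dotv z (Du x) - dotv z (Du (x - t *: (e k *: z)))).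
have mkE : measurable_fun setT (EFin \o (@unit_weight R)).
  by apply/measurable_EFinP; exact: measurable_unit_weight.
have C0 : (0 <= 4%:E * sqint mu (fun x => dotv z (Du x)))%E by rewrite mule_ge0// sqint_ge0.
have Cfin : (4%:E * sqint mu (fun x => dotv z (Du x)))%E \is a fin_num.
  by rewrite fin_numM// ge0_fin_numE ?sqint_ge0//; case: (w2 z).
have [|||_ _ h] := @dominated_convergence _ _ _ leb setT measurableT
  (fun k t => ((unit_weight t)%:E * T k t)%E) (cst 0%E)
  (fun t => ((unit_weight t)%:E * (4%:E * sqint mu (fun x => dotv z (Du x))))%E)
  (fun k => emeasurable_funM mkE (measurable_translate_error z (e k *: z)))
  (measurable_cst _) _ _ _.
- apply: nearW => t _; rewrite -(mule0 (unit_weight t)%:E); apply: cvgeZl => //.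
  have [_ /(_ (fun k => t *: (e k *: z)))] := L2_translation_continuousP (w2 z).
  rewrite (_ : (fun k => sqint mu _) = T^~ t).
    apply => i; under eq_fun do rewrite !mxE.
    rewrite -(mulr0 t) -[X in t * X](mul0r (z 0 i)).
    by apply: cvgM; [exact: cvg_cst|apply: cvgM => //; exact: cvg_cst].
  apply/funext => k; rewrite /T -sqintN; apply: sqint_eq => x.
  by rewrite opprB.
- rewrite -(fineK Cfin).
  have := integrable_weight (@measurable_unit_weight R) (@unit_weight_ge0 R) (@integral_unit_weight R).
  by move=> /(integrableZr measurableT (fine (4%:E * sqint mu (fun x => dotv z (Du x))))).
- apply: nearW => t k _; rewrite gee0_abs; last first.
    by rewrite mule_ge0 ?sqint_ge0// lee_fin unit_weight_ge0.
  by rewrite lee_wpmul2l ?lee_fin ?unit_weight_ge0// translate_error_le.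
apply: (@squeeze_cvge _ _ _ _ (cst 0%E) _ (fun k => \int[leb]_t ((unit_weight t)%:E * T k t))%E).
- by apply: nearW => k; rewrite sqint_ge0/= diff_quotient_error_le.
- exact: cvg_cst.
- by rewrite integral0 in h.
Qed.

End quotient_limits.

(** * The energy of a single translation *)

Section translate_energy.
Variables (R : realType) (n : nat).
Local Notation mu := (lebesgue_rV R n).
Variables (f : R -> R) (M : R).
Hypotheses (f_C2 : C2 f) (fM : forall x : R, `|(f^`(2))%classic x| <= M).
Variables (u : 'rV[R]_n -> R) (Du : 'rV[R]_n -> 'rV[R]_n).
Hypotheses (u2 : L2 mu u) (wD : weak_gradient_L2 u Du).
Implicit Types (z : 'rV[R]_n) (eps : R).
Local Notation f2 := (f^`(2))%classic.

Let w2 z : L2 mu (fun x => dotv z (Du x)).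
Proof. by apply: L2_dotv => i; exact: Lfun2_L2 (wD i).1. Qed.

Let M0 : 0 <= M. Proof. exact: bound_derive2_ge0 fM. Qed.

(** The scaling by eps^-2 makes it comparable with the square of the difference
    quotient. *)
Definition scaled_rem eps z (x : 'rV[R]_n) : R :=
  eps ^- 2 * taylor_rem f (u (x - eps *: z)) (u x).

Definition translate_energy eps z : R := \int[mu]_x scaled_rem eps z x.

(** The limit of [translate_energy] as eps tends to 0: the difference quotient has
    become - z . Du, and the remainder its second-order term. *)
Definition limit_energy z : R :=
  \int[mu]_x (2^-1 * f2 (u x) * dotv z (Du x) ^+ 2).

Lemma measurable_taylor_rem d (T : measurableType d) (a c : T -> R) :
  measurable_fun setT a -> measurable_fun setT c ->
  measurable_fun setT (fun x => taylor_rem f (a x) (c x)).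
Proof.
move=> ma mc; apply: measurable_funB.
  apply: measurable_funB; apply: measurableT_comp => //; exact: C2_measurable.
apply: measurable_funM; last exact: measurable_funB.
by apply: measurableT_comp => //; exact: C2_measurable_derive1 f_C2.
Qed.

Lemma measurable_scaled_rem eps z : measurable_fun setT (scaled_rem eps z).
Proof.
apply: measurable_funM => //; apply: measurable_taylor_rem; last exact: u2.1.
exact: measurable_shift u2.1.
Qed.

Lemma scaled_rem_le eps z x : 0 < eps ->
  `|scaled_rem eps z x| <= M * diff_quotient u eps z x ^+ 2.
Proof.
move=> e0; have e2 : 0 < eps ^- 2 by rewrite invr_gt0 exprn_gt0.
rewrite /scaled_rem normrM gtr0_norm// /diff_quotient exprMn mulrCA exprVn ler_pM2l//.
exact: taylor_rem_le.
Qed.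

(** Under fast convergence the difference quotients converge almost everywhere and
    have a common square-integrable majorant, so dominated convergence
    applies to the remainders. *)
Lemma translate_energy_cvg_fast (e : nat -> R) z : (forall k, 0 < e k) ->
  e k @[k --> \oo] --> 0 ->
  (forall k, (sqint mu (diff_quotient_error u Du (e k) z) <= (1 / (2 ^ k.+1)%:R)%:E)%E) ->
  translate_energy (e k) z @[k --> \oo] --> limit_energy z.
Proof.
move=> e0 ec hfast.
have mq k := (L2_diff_quotient_error u2 wD (e k) z).1.
have [iS FS Fae] := ae_cvg0_summable mq hfast.
set S := (fun x => _) in iS FS.
have mlim : measurable_fun setT (fun x => 2^-1 * f2 (u x) * dotv z (Du x) ^+ 2).
  apply: measurable_funM; last by apply: measurable_funX; exact: (w2 z).1.
  apply: measurable_funM => //; apply: (measurableT_comp (C2_measurable_derive2 f_C2)); exact: u2.1.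
have iw := integrable_sqr (w2 z).
have iG : mu.-integrable setT (fun x => M%:E * (2%:E * S x + 2%:E * (dotv z (Du x) ^+ 2)%:E))%E.
  apply: (integrableZl measurableT); apply: integrableD => //; exact: integrableZl.
have [||||il _ h] := @dominated_convergence _ _ _ mu setT measurableT
  (fun k x => (scaled_rem (e k) z x)%:E)
  (fun x => (2^-1 * f2 (u x) * dotv z (Du x) ^+ 2)%:E)
  (fun x => M%:E * (2%:E * S x + 2%:E * (dotv z (Du x) ^+ 2)%:E))%E
  _ _ _ iG _.
- by move=> k; apply/measurable_EFinP; exact: measurable_scaled_rem.
- exact/measurable_EFinP.
- move: Fae; apply: filterS => x Fx _; apply: cvg_EFin; first exact: nearW.
  have qx : diff_quotient u (e k) z x @[k --> \oo] --> - dotv z (Du x).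
    rewrite -[X in _ --> X]sub0r.
    rewrite (_ : (fun k => _) = (fun k => diff_quotient_error u Du (e k) z x - dotv z (Du x))).
      by apply: cvgB => //; exact: cvg_cst.
    by apply/funext => k; rewrite /diff_quotient_error addrK.
  have := taylor_rem_cvg f_C2 (c := u x) e0 ec qx; rewrite sqrrN.
  rewrite (_ : (fun k => e k ^- 2 * _) = (fun k => scaled_rem (e k) z x))//.
  by apply/funext => k; rewrite /scaled_rem /diff_quotient mulVKf ?gt_eqF// addrC subrK.
- apply: nearW => x k _; rewrite abse_EFin.
  apply: (@le_trans _ _ (M * (2 * diff_quotient_error u Du (e k) z x ^+ 2 + 2 * dotv z (Du x) ^+ 2))%:E).
    rewrite lee_fin; apply: le_trans (scaled_rem_le z x (e0 k)) _; rewrite ler_wpM2l//.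
    rewrite /diff_quotient_error; set q := diff_quotient _ _ _ _; set w := dotv _ _.
    by have := sqr_ge0 (q + w + w); rewrite !expr2; lra.
  rewrite EFinM lee_wpmul2l ?lee_fin// EFinD !EFinM leeD2r// lee_wpmul2l//.
  exact: FS.
rewrite /translate_energy /limit_energy /Rintegral; apply: fine_cvg.
by rewrite fineK//; exact: integrable_fin_num.
Qed.

(** Every subsequence has a further one along which the difference quotients
    converge fast in L^2. *)
Lemma translate_energy_cvg (e : nat -> R) z : (forall k, 0 < e k) ->
  e k @[k --> \oo] --> 0 ->
  translate_energy (e k) z @[k --> \oo] --> limit_energy z.
Proof.
move=> e0 ec; apply: cvg_subsubseq => s hs.
have sc : e (s k) @[k --> \oo] --> 0.
  apply/cvgrPdist_lt => d d0; move/cvgrPdist_lt : ec => /(_ _ d0)[N _ hN].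
  by exists N => // k /= Nk; apply: hN; exact: leq_trans Nk (hs k).
have := diff_quotient_error_cvg0 u2 wD z (fun k => e0 (s k)) sc.
move=> /ge0_cvge0P => /(_ (fun k => sqint_ge0 _ _)) h.
have ht k : exists t, (k <= t)%N /\
    (sqint mu (diff_quotient_error u Du (e (s t)) z) <= (1 / (2 ^ k.+1)%:R)%:E)%E.
  have [|N _ hN] := h (1 / (2 ^ k.+1)%:R); first by rewrite divr_gt0// ltr0n expn_gt0.
  by exists (maxn k N); rewrite leq_maxl; split => //; apply: hN; rewrite /= leq_maxr.
have [t tP] := choice ht; exists t.
apply: (@translate_energy_cvg_fast (fun k => e (s (t k)))) => //.
  apply/cvgrPdist_lt => d d0; move/cvgrPdist_lt : sc => /(_ _ d0)[N _ hN].
  by exists N => // k /= Nk; apply: hN; exact: leq_trans Nk (tP k).1.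
by move=> k; exact: (tP k).2.
Qed.

(** The bound is uniform in eps and quadratic in z, which is what the finite second
    moment of the kernel can integrate. *)
Lemma translate_energy_bound eps z : 0 < eps ->
  (`|translate_energy eps z|%R%:E <= (10 * M)%:E * sqint mu (fun x => dotv z (Du x)))%E.
Proof.
move=> e0.
have q2 : L2 mu (diff_quotient u eps z) by exact: L2_diff_quotient.
have [mq fq] := q2.
have iM := integrableZl measurableT M (integrable_sqr q2).
have ir : mu.-integrable setT (EFin \o scaled_rem eps z).
  apply: (le_integrable measurableT _ _ iM).
    by apply/measurable_EFinP; exact: measurable_scaled_rem.
  move=> x _; rewrite /= lee_fin [leRHS]ger0_norm; first exact: scaled_rem_le.
  by apply: mulr_ge0 => //; exact: sqr_ge0.
have [mw fw] := w2 z.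
apply: (@le_trans _ _ (M%:E * sqint mu (diff_quotient u eps z))%E).
  rewrite /translate_energy; apply: (@le_trans _ _ (\int[mu]_x `|scaled_rem eps z x|)%R%:E).
    by rewrite lee_fin; exact: le_normr_Rintegral.
  have inr : mu.-integrable setT (EFin \o (fun x => `|scaled_rem eps z x|)) by exact: integrable_norm.
  rewrite /Rintegral fineK; last exact: integrable_fin_num.
  have mq2 := measurable_sqr mq.
  rewrite /sqint -ge0_integralZl//; last by move=> x _; rewrite lee_fin sqr_ge0.
  apply: ge0_le_integral => //.
  - exact: measurable_int inr.
  - by apply: measurable_funeM; exact: measurable_sqr.
  - by move=> x _; rewrite -EFinM lee_fin scaled_rem_le.
have -> : (10 * M)%:E = (M%:E * 10%:E)%E by rewrite -EFinM mulrC.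
rewrite -muleA lee_wpmul2l ?lee_fin//.
have -> : diff_quotient u eps z = (fun x => diff_quotient_error u Du eps z x - dotv z (Du x)).
  by apply/funext => x; rewrite /diff_quotient_error addrK.
apply: le_trans (sqintB _ (L2_diff_quotient_error u2 wD eps z).1 mw) _.
have := diff_quotient_error_bound u2 wD z e0.
set N := sqint _ _; set W := sqint _ _ => NW.
apply: (@le_trans _ _ (2%:E * (4%:E * W) + 2%:E * W)%E).
  by rewrite leeD2r// lee_wpmul2l.
by rewrite muleA -EFinM -ge0_muleDl ?mulr_ge0// -EFinD; rewrite (_ : 2 * 4 + 2 = 10 :> R)//; ring.
Qed.

End translate_energy.

(** * Convolution with a rescaled kernel *)

Section euclidean_norm.
Variables (R : realType) (n : nat).
Implicit Types x y z : 'rV[R]_n.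

Lemma enorm_sqr x : enorm x ^+ 2 = \sum_i x 0 i ^+ 2.
Proof. by rewrite sqr_sqrtr//; apply: sumr_ge0 => i _; exact: sqr_ge0. Qed.

Lemma enorm_ge0 x : 0 <= enorm x. Proof. exact: sqrtr_ge0. Qed.

Lemma coord_sqr_le x i : x 0 i ^+ 2 <= enorm x ^+ 2.
Proof.
by rewrite enorm_sqr (bigD1 i)//= lerDl; apply: sumr_ge0 => j _; exact: sqr_ge0.
Qed.

(** Cauchy-Schwarz, through Lagrange's identity. *)
Lemma dotv_sqr_le x y : dotv x y ^+ 2 <= enorm x ^+ 2 * enorm y ^+ 2.
Proof.
rewrite !enorm_sqr /dotv expr2 !big_distrlr/=.
have E : \sum_i \sum_j x 0 i ^+ 2 * y 0 j ^+ 2 =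
    2^-1 * \sum_i \sum_j (x 0 i ^+ 2 * y 0 j ^+ 2 + x 0 j ^+ 2 * y 0 i ^+ 2).
  under [in RHS]eq_bigr do rewrite big_split/=.
  rewrite big_split/= [X in _ + X]exchange_big/=.
  by set s := \sum_i _; lra.
rewrite E mulr_sumr; apply: ler_sum => i _; rewrite mulr_sumr; apply: ler_sum => j _.
have := sqr_ge0 (x 0 i * y 0 j - x 0 j * y 0 i); rewrite !expr2; lra.
Qed.

Lemma measurable_enorm : measurable_fun setT (@enorm R n).
Proof.
rewrite /enorm; apply: measurableT_comp.
  by apply: continuous_measurable_fun; exact: sqrt_continuous.
by apply: measurable_sum => i; apply: measurable_funX; exact: measurable_rV_coord.
Qed.

End euclidean_norm.

(** Integrals that are infinite have real value 0, on both sides. *)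
Lemma Rintegral_pos_scale d (T : measurableType d) (R : realType)
    (m : {measure set T -> \bar R}) (c : R) (g : T -> R) : 0 < c ->
  measurable_fun setT g -> \int[m]_x (c * g x) = c * \int[m]_x g x.
Proof.
move=> c0 mg; have mgE : measurable_fun setT (EFin \o g) by exact/measurable_EFinP.
rewrite /Rintegral.
have -> : (\int[m]_x (c * g x)%:E = c%:E * \int[m]_x (g x)%:E)%E.
  rewrite [LHS]integralE [X in (_ * X)%E]integralE -gt0_muleBr//.
  - rewrite -!ge0_integralZl//; try exact: measurable_funepos; try exact: measurable_funeneg;
      try (by rewrite lee_fin ltW); congr (_ - _)%E; apply: eq_integral => x _.
      by rewrite !funeposE EFinM maxe_pMr ?mule0 ?lee_fin ?ltW.
    by rewrite !funenegE EFinM -muleN maxe_pMr ?mule0 ?lee_fin ?ltW.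
  - by apply: integral_ge0 => x _; exact: funepos_ge0.
  - by apply: integral_ge0 => x _; exact: funeneg_ge0.
case: (integral _ _ _) => [r| |]//=.
  by rewrite gt0_muley ?lte_fin//= mulr0.
by rewrite gt0_muleNy ?lte_fin//= mulr0.
Qed.

Section convolution_limit.
Variables (R : realType) (n : nat).
Local Notation mu := (lebesgue_rV R n).
Variable phi : 'rV[R]_n -> R.
Hypotheses (mphi : measurable_fun setT phi) (phi0 : forall x, 0 <= phi x).
Hypothesis phi1 : (\int[mu]_y (phi y)%:E = 1)%E.
Hypothesis phi_mean : forall i : 'I_n, \int[mu]_y (y 0 i * phi y) = 0.
Hypothesis phi_mom2 : (\int[mu]_y (enorm y ^+ 2 * phi y)%:E < +oo)%E.
Variables (u : 'rV[R]_n -> R) (Du : 'rV[R]_n -> 'rV[R]_n).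
Hypotheses (u2 : L2 mu u) (wD : weak_gradient_L2 u Du).
Implicit Types (z x y : 'rV[R]_n) (eps : R).

Let D2 i : L2 mu (fun x => Du x 0 i). Proof. exact: Lfun2_L2 (wD i).1. Qed.
Let w2 z : L2 mu (fun x => dotv z (Du x)). Proof. exact: L2_dotv. Qed.

Definition dilation eps z : 'rV[R]_n := eps *: z.

Lemma measurable_dilation eps : measurable_fun setT (dilation eps).
Proof.
rewrite (_ : dilation eps = fun z => eps *: z + 0); first exact: measurable_affine.
by apply/funext => z; rewrite addr0.
Qed.

(** The convolution of v with the rescaled kernel, after the substitution y = eps z:
    an average of translates with a weight that does not depend on eps. *)
Definition mean_dilate eps := average_translate mu phi (dilation eps).

(** An equality at every point, including those where the integrand of the
    convolution is not integrable. *)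
Lemma convolution_rescale (v : 'rV[R]_n -> R) eps : 0 < eps -> measurable_fun setT v ->
  convolution v (rescale eps phi) = mean_dilate eps v.
Proof.
move=> e0 mv; apply/funext => x; rewrite /convolution.
have mg : measurable_fun setT (fun y => v (x - y) * rescale eps phi y).
  apply: measurable_funM.
    apply: (measurableT_comp mv); rewrite (_ : (fun y => _) = fun y => -1 *: y + x).
      exact: measurable_affine.
    by apply/funext => y; rewrite scaleN1r addrC.
  apply: measurable_funM => //; apply: (measurableT_comp mphi).
  exact: measurable_dilation.
have en0 : 0 < eps ^+ n by rewrite exprn_gt0.
rewrite (Rintegral_dilate e0 mg) /mean_dilate /average_translate.
rewrite (_ : (fun y => v (x - eps *: y) * rescale eps phi (eps *: y)) =
    (fun y => eps ^- n * (v (x - dilation eps y) * phi y))); last first.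
  apply/funext => y; rewrite /rescale /dilation scalerA mulVf ?gt_eqF// scale1r.
  by rewrite mulrCA.
have -> : \int[mu]_x0 (eps ^- n * (v (x - dilation eps x0) * phi x0)) =
    eps ^- n * \int[mu]_x0 (v (x - dilation eps x0) * phi x0).
  apply: Rintegral_pos_scale; first by rewrite invr_gt0.
  apply: measurable_funM => //; apply: (measurableT_comp mv).
  rewrite (_ : (fun y => _) = fun y => - eps *: y + x); first exact: measurable_affine.
  by apply/funext => y; rewrite /dilation scaleNr addrC.
by rewrite mulrA divff ?mul1r// gt_eqF.
Qed.

Lemma integrable_mom2 : mu.-integrable setT (fun z => (enorm z ^+ 2 * phi z)%:E).
Proof.
apply/integrableP; split.
  apply/measurable_EFinP; apply: measurable_funM => //; apply: measurable_funX.
  exact: measurable_enorm.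
rewrite (eq_integral (fun y => (enorm y ^+ 2 * phi y)%:E))// => y _.
by rewrite gee0_abs// lee_fin mulr_ge0// sqr_ge0.
Qed.

Lemma integrable_coord_weight i : mu.-integrable setT (fun z => (z 0 i * phi z)%:E).
Proof.
have mc := @measurable_rV_coord R n i.
have [] := integrable_weighted mphi phi0 phi1 mc _ => //.
apply: le_lt_trans phi_mom2; apply: ge0_le_integral => //.
- by move=> z _; rewrite lee_fin mulr_ge0// sqr_ge0.
- by apply/measurable_EFinP; apply: measurable_funM => //; exact: measurable_funX.
- exact: measurable_int integrable_mom2.
- by move=> z _; rewrite lee_fin ler_wpM2r// coord_sqr_le.
Qed.

Lemma integrable_second_moment i j : mu.-integrable setT (fun z => (z 0 i * z 0 j * phi z)%:E).
Proof.
have mc k := @measurable_rV_coord R n k.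
apply: (le_integrable measurableT _ _ integrable_mom2).
  by apply/measurable_EFinP; apply: measurable_funM => //; exact: measurable_funM.
move=> z _; have h : `|z 0 i * z 0 j| <= enorm z ^+ 2.
  have h1 := coord_sqr_le z i; have h2 := coord_sqr_le z j; rewrite ler_norml.
  have := sqr_ge0 (z 0 i - z 0 j); have := sqr_ge0 (z 0 i + z 0 j).
  by rewrite sqrrD sqrrB; lra.
rewrite /= lee_fin normrM (ger0_norm (phi0 z)).
by apply: le_trans (ler_wpM2r (phi0 z) h) _; exact: ler_norm.
Qed.

Let mDu i : measurable_fun setT (fun x => Du x 0 i). Proof. by case: (D2 i). Qed.

Lemma L2_gradient : L2 mu (fun x => enorm (Du x)).
Proof.
have mE : measurable_fun setT (fun x => enorm (Du x)).
  by apply: (measurableT_comp (@measurable_enorm R n)); exact: measurable_fun_rV.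
split => //.
rewrite /sqint; under eq_integral do rewrite enorm_sqr -sumEFin.
rewrite ge0_integral_sum//.
- by apply: lte_sum_pinfty => i _; case: (D2 i).
- by move=> i; exact: measurable_sqr.
- by move=> i x _; rewrite lee_fin sqr_ge0.
Qed.

Lemma sqint_dotv_le z : (sqint mu (fun x => dotv z (Du x)) <=
  (enorm z ^+ 2)%:E * sqint mu (fun x => enorm (Du x)))%E.
Proof.
apply: le_sqint; first exact: sqr_ge0.
- exact: (w2 z).1.
- exact: L2_gradient.1.
- by move=> x; exact: dotv_sqr_le.
Qed.

Lemma measurable_dotv_pair : measurable_fun setT
  (fun p : 'rV[R]_n * 'rV[R]_n => dotv p.2 (Du p.1)).
Proof.
apply: measurable_sum => i; apply: measurable_funM.
  exact: (measurableT_comp (measurable_rV_coord i) measurable_snd).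
exact: (measurableT_comp (mDu i) measurable_fst).
Qed.

Lemma measurable_diff_quotient_error_pair eps : measurable_fun setT
  (fun p : 'rV[R]_n * 'rV[R]_n => diff_quotient_error u Du eps p.2 p.1).
Proof.
apply: measurable_funD; last exact: measurable_dotv_pair.
apply: measurable_funM => //; apply: measurable_funB.
  exact: measurable_pair_shift (measurable_dilation eps) _ u2.1.
exact: measurableT_comp u2.1 measurable_fst.
Qed.

Lemma measurable_mean_dilate eps : measurable_fun setT (mean_dilate eps u).
Proof. exact: measurable_average_translate mphi (measurable_dilation eps) _ u2.1. Qed.

Lemma dotv_weight_mean y : mu.-integrable setT (fun z => (dotv z y * phi z)%:E) /\
  \int[mu]_z (dotv z y * phi z) = 0.
Proof.
have ii i : mu.-integrable setT (fun z => (y 0 i * (z 0 i * phi z))%:E).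
  exact: (integrableZl measurableT (y 0 i) (integrable_coord_weight i)).
have E : (fun z => dotv z y * phi z) = (fun z => \sum_i (y 0 i * (z 0 i * phi z))).
  by apply/funext => z; rewrite /dotv mulr_suml; apply: eq_bigr => i _; ring.
rewrite (_ : (fun z => (dotv z y * phi z)%:E) = EFin \o (fun z => dotv z y * phi z))// E.
split; last first.
  rewrite Rintegral_sum// big1// => i _.
  by rewrite RintegralZl ?phi_mean ?mulr0//; exact: integrable_coord_weight.
rewrite (_ : _ \o _ = (fun z => \sum_i (y 0 i * (z 0 i * phi z))%:E)%E).
  exact: integrable_sum.
by apply/funext => z; rewrite /= sumEFin.
Qed.

(** As z . Du(x) has mean zero under phi, the quotient (u_eps - u) / eps is
    the mean of the errors (u(x - eps z) - u(x)) / eps + z . Du(x), and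
    Jensen's inequality applies. *)
Lemma sqint_mean_dilate_le eps : 0 < eps ->
  (sqint mu (fun x => eps^-1 * (mean_dilate eps u x - u x))%R <=
   \int[mu]_z ((phi z)%:E * sqint mu (diff_quotient_error u Du eps z)))%E.
Proof.
move=> e0.
apply: (sqint_weighted_mean_le mphi phi0 _ (measurable_diff_quotient_error_pair eps)).
  apply: measurable_funM => //; apply: measurable_funB; last exact: u2.1.
  exact: measurable_mean_dilate.
move=> x /=.
have [il l0] := dotv_weight_mean (Du x).
have e1 : 0 < eps^-1 by rewrite invr_gt0.
have mux : measurable_fun setT (fun z => u (x - dilation eps z)).
  exact: measurableT_comp (measurable_pair_shift (measurable_dilation eps) u2.1) (pair1_measurable x).
have mG : measurable_fun setT (fun z => eps^-1 * u (x - dilation eps z)).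
  exact: measurable_funM.
have ml : measurable_fun setT (fun z => dotv z (Du x)).
  exact: measurableT_comp measurable_dotv_pair (pair1_measurable x).
have := sqr_weighted_mean_affine_le mphi phi0 phi1 (eps^-1 * u x) mG ml il l0.
have -> : \int[mu]_y (eps^-1 * u (x - dilation eps y) * phi y) =
    eps^-1 * mean_dilate eps u x.
  rewrite /mean_dilate /average_translate -Rintegral_pos_scale//.
    by apply: eq_Rintegral => y _; rewrite mulrA.
  exact: measurable_funM.
rewrite -mulrBr => /le_trans; apply.
rewrite le_eqVlt; apply/orP; left; apply/eqP; apply: eq_integral => z _.
by rewrite /diff_quotient_error /diff_quotient mulrBr.
Qed.

Lemma measurable_sqint_diff_quotient_error eps :
  measurable_fun setT (fun z => sqint mu (diff_quotient_error u Du eps z)).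
Proof. exact: measurable_sqint_pair (measurable_diff_quotient_error_pair eps). Qed.

Lemma integrable_weight_mom2 (C : R) : mu.-integrable setT
  (fun z => (C%:E * ((phi z)%:E * ((enorm z ^+ 2)%:E * sqint mu (fun x => enorm (Du x)))))%E).
Proof.
have [_ fD] := L2_gradient.
have Dfin : sqint mu (fun x => enorm (Du x)) \is a fin_num by rewrite ge0_fin_numE ?sqint_ge0.
rewrite -(fineK Dfin); set K := fine _.
have := integrableZl measurableT (C * K) integrable_mom2.
apply: eq_integrable => // z _; rewrite -!EFinM; congr EFin; ring.
Qed.

(** In other words u_eps - u = o(eps) in L^2: the first-order term of the expansion
    is removed by the mean zero condition. *)
Lemma mean_dilate_error_cvg0 (e : nat -> R) : (forall k, 0 < e k) ->
  e k @[k --> \oo] --> 0 ->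
  sqint mu (fun x => (e k)^-1 * (mean_dilate (e k) u x - u x)) @[k --> \oo] --> 0%E.
Proof.
move=> e0 ec.
have mphiE : measurable_fun setT (EFin \o phi) by exact/measurable_EFinP.
have [||||_ _ h] := @dominated_convergence _ _ _ mu setT measurableT
  (fun k z => ((phi z)%:E * sqint mu (diff_quotient_error u Du (e k) z))%E) (cst 0%E)
  _ _ _ _ (integrable_weight_mom2 4) _.
- by move=> k; apply: emeasurable_funM => //; exact: measurable_sqint_diff_quotient_error.
- exact: measurable_cst.
- apply: nearW => z _; rewrite -(mule0 (phi z)%:E); apply: cvgeZl => //.
  exact: diff_quotient_error_cvg0.
- apply: nearW => z k _; rewrite gee0_abs; last by rewrite mule_ge0 ?sqint_ge0// lee_fin.
  rewrite muleCA lee_wpmul2l ?lee_fin//.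
  apply: le_trans (diff_quotient_error_bound u2 wD z (e0 k)) _.
  by rewrite lee_wpmul2l// sqint_dotv_le.
apply: (@squeeze_cvge _ _ _ _ (cst 0%E) _
    (fun k => \int[mu]_z ((phi z)%:E * sqint mu (diff_quotient_error u Du (e k) z)))%E).
- by apply: nearW => k; rewrite sqint_ge0/= sqint_mean_dilate_le.
- exact: cvg_cst.
- by rewrite integral0 in h.
Qed.

(** Derived from the bound on (u_eps - u) / eps, itself finite by the second
    moment condition. *)
Lemma L2_mean_dilate eps : 0 < eps -> L2 mu (mean_dilate eps u).
Proof.
move=> e0; pose q x := eps^-1 * (mean_dilate eps u x - u x).
have mq : measurable_fun setT q.
  apply: measurable_funM => //; apply: measurable_funB; last exact: u2.1.
  exact: measurable_mean_dilate.
have q2 : L2 mu q.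
  split => //; apply: le_lt_trans (sqint_mean_dilate_le e0) _.
  have mphiE : measurable_fun setT (EFin \o phi) by exact/measurable_EFinP.
  have iD := integrable_weight_mom2 4.
  apply: (@le_lt_trans _ _ (\int[mu]_z (4%:E * ((phi z)%:E * ((enorm z ^+ 2)%:E *
      sqint mu (fun x => enorm (Du x)))))))%E.
    apply: ge0_le_integral => //.
    - by move=> z _; rewrite mule_ge0 ?sqint_ge0// lee_fin.
    - by apply: emeasurable_funM => //; exact: measurable_sqint_diff_quotient_error.
    - exact: measurable_int iD.
    - move=> z _; rewrite muleCA lee_wpmul2l ?lee_fin//.
      apply: le_trans (diff_quotient_error_bound u2 wD z e0) _.
      by rewrite lee_wpmul2l// sqint_dotv_le.
  by have := integrable_fin_num measurableT iD; rewrite fin_numElt => /andP[].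
rewrite (_ : mean_dilate eps u = (fun x => u x + eps * q x)).
  by apply: L2D => //; exact: L2Z.
by apply/funext => x; rewrite /q mulVKf ?gt_eqF// addrC subrK.
Qed.

End convolution_limit.

(** * The limit for a general kernel *)

Lemma integrable_fubini_G d1 d2 (X : measurableType d1) (Y : measurableType d2)
    (R : realType) (m1 : {sigma_finite_measure set X -> \bar R})
    (m2 : {sigma_finite_measure set Y -> \bar R}) (F : X * Y -> \bar R) :
  (m1 \x m2)%E.-integrable setT F -> m2.-integrable setT (fubini_G m1 F).
Proof.
move=> iF; have mF := measurable_int _ iF.
apply/integrableP; split; first exact: (measurable_fubini_G iF).
apply: le_lt_trans ((integrable21ltyP m1 m2 mF).1 iF).
apply: ge0_le_integral => //.
- by apply: measurableT_comp => //; exact: (measurable_fubini_G iF).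
- apply: (@measurable_fun_fubini_tonelli_G _ _ _ _ _ m1 (abse \o F)) => //.
    exact: measurableT_comp.
  by move=> p; exact: abse_ge0.
- by move=> y _; apply: le_abse_integral => //; exact: (measurable_fun_pair1 y mF).
Qed.

Section energy_limit.
Variables (R : realType) (n : nat).
Local Notation mu := (lebesgue_rV R n).
Variables (f : R -> R) (M : R).
Hypotheses (f_C2 : C2 f) (fM : forall x : R, `|(f^`(2))%classic x| <= M).
Hypotheses (f_0 : f 0 = 0) (df_0 : derive1 f 0 = 0).
Variable phi : 'rV[R]_n -> R.
Hypotheses (mphi : measurable_fun setT phi) (phi0 : forall x, 0 <= phi x).
Hypothesis phi1 : (\int[mu]_y (phi y)%:E = 1)%E.
Hypothesis phi_mean : forall i : 'I_n, \int[mu]_y (y 0 i * phi y) = 0.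
Hypothesis phi_mom2 : (\int[mu]_y (enorm y ^+ 2 * phi y)%:E < +oo)%E.
Variables (u : 'rV[R]_n -> R) (Du : 'rV[R]_n -> 'rV[R]_n).
Hypotheses (u2 : L2 mu u) (wD : weak_gradient_L2 u Du).
Implicit Types (z x y : 'rV[R]_n) (eps : R) (v : 'rV[R]_n -> R).
Local Notation f1 := (derive1 f).
Local Notation f2 := (f^`(2))%classic.

Let D2 i : L2 mu (fun x => Du x 0 i). Proof. exact: Lfun2_L2 (wD i).1. Qed.
Let M0 : 0 <= M. Proof. exact: bound_derive2_ge0 fM. Qed.

Lemma integrable_comp_C2 v : L2 mu v -> mu.-integrable setT (fun x => (f (v x))%:E).
Proof.
move=> v2; apply: (le_integrable measurableT _ _ (integrableZl measurableT M (integrable_sqr v2))).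
  apply/measurable_EFinP; apply: (measurableT_comp (C2_measurable f_C2)); exact: v2.1.
move=> x _; rewrite /= lee_fin; apply: (le_trans _ (ler_norm _)).
exact: (C2_le_sqr f_C2 fM f_0 df_0).
Qed.

Lemma L2_comp_derive1 v : L2 mu v -> L2 mu (fun x => f1 (v x)).
Proof.
move=> v2; apply: (@L2_le _ _ _ _ _ v (M ^+ 2)) => //; first exact: sqr_ge0.
  by apply: (measurableT_comp (C2_measurable_derive1 f_C2)); exact: v2.1.
move=> x; rewrite -exprMn -real_normK ?num_real// -[leRHS]real_normK ?num_real//.
rewrite lerXn2r ?nnegrE// normrM (ger0_norm M0).
exact: (derive1_le_norm f_C2 fM df_0).
Qed.

(** The linear term is split off only in integrated form, f'(w) being square
    integrable because it vanishes at 0 and is Lipschitz. *)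
Lemma Rintegral_taylor_rem v w : L2 mu v -> L2 mu w ->
  mu.-integrable setT (fun x => (taylor_rem f (v x) (w x))%:E) /\
  \int[mu]_x taylor_rem f (v x) (w x) =
    \int[mu]_x f (v x) - \int[mu]_x f (w x)
    - (\int[mu]_x (f1 (w x) * v x) - \int[mu]_x (f1 (w x) * w x)).
Proof.
move=> v2 w2; have iv := integrable_comp_C2 v2; have iw := integrable_comp_C2 w2.
have ifv := integrable_mul (L2_comp_derive1 w2) v2; have ifw := integrable_mul (L2_comp_derive1 w2) w2.
have E : (fun x => taylor_rem f (v x) (w x)) =
    (fun x => f (v x) - f (w x) - (f1 (w x) * v x - f1 (w x) * w x)).
  by apply/funext => x; rewrite /taylor_rem mulrBr.
have i1 := integrableB measurableT iv iw; have i2 := integrableB measurableT ifv ifw.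
split.
  rewrite (_ : (fun x => _) = EFin \o (fun x => taylor_rem f (v x) (w x)))// E.
  exact: (integrableB measurableT i1 i2).
by rewrite E RintegralB// RintegralB// RintegralB.
Qed.

(** The integral of f (u (x - eps z)) is that of f (u), so [translate_energy] is
    affine in the translate of u; averaging it over z gives the pairing of
    f'(u) with u - u_eps, which is also the linear part of the remainder
    at u_eps. *)
Lemma energy_identity eps : 0 < eps ->
  eps ^- 2 * \int[mu]_x (f (u x) - f (mean_dilate phi eps u x)) =
  \int[mu]_z (phi z * translate_energy f u eps z) -
  \int[mu]_x (eps ^- 2 * taylor_rem f (mean_dilate phi eps u x) (u x)).
Proof.
move=> e0; set v := mean_dilate phi eps u.
have v2 : L2 mu v by exact: (L2_mean_dilate mphi phi0 phi1 phi_mean phi_mom2 u2 wD e0).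
have f1u := L2_comp_derive1 u2.
(* by translation invariance, [translate_energy] is affine in this pairing *)
pose A z := \int[mu]_x (f1 (u x) * u (x - dilation eps z)).
set c := \int[mu]_x (f1 (u x) * u x).
have teE z : translate_energy f u eps z = eps ^- 2 * (c - A z).
  have uz := L2_shift (eps *: z) u2.
  have [iT ET] := Rintegral_taylor_rem uz u2.
  rewrite /translate_energy /scaled_rem RintegralZl// ET; congr (_ * _).
  rewrite (Rintegral_shift (eps *: z) (g := fun x => f (u x))).
    by rewrite subrr sub0r opprB.
  by apply: (measurableT_comp (C2_measurable f_C2)); exact: u2.1.
have iA : mu.-integrable setT (fun z => (phi z * A z)%:E).
  have iF := integrable_pair_shift mphi phi0 phi1 (measurable_dilation eps) f1u u2.
  have := integrable_fubini_G iF; apply: eq_integrable => // z _.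
  rewrite /fubini_G /A -RintegralZl//; last first.
    by apply: integrable_mul => //; exact: L2_shift.
  rewrite /Rintegral fineK.
    by apply: eq_integral => x _; congr EFin; rewrite /=; ring.
  apply: integrable_fin_num => //.
  exact: (integrableZl measurableT (phi z) (integrable_mul f1u (L2_shift _ u2))).
have ic := integrableZl measurableT c (integrable_weight mphi phi0 phi1).
have -> : \int[mu]_z (phi z * translate_energy f u eps z) =
    eps ^- 2 * (c - \int[mu]_z (phi z * A z)).
  transitivity (\int[mu]_z (eps ^- 2 * (c * phi z - phi z * A z))).
    by apply: eq_Rintegral => z _; rewrite teE; ring.
  rewrite RintegralZl//; last exact: (integrableB measurableT ic iA).
  rewrite RintegralB// RintegralZl//; last exact: (integrable_weight mphi phi0 phi1).
  by rewrite [X in c * X]/Rintegral phi1/= mulr1.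
have [iT ET] := Rintegral_taylor_rem v2 u2.
rewrite [X in _ = _ - X]RintegralZl// -mulrBr; congr (_ * _).
rewrite ET RintegralB//; try exact: integrable_comp_C2.
have -> : \int[mu]_x (f1 (u x) * v x) = \int[mu]_z (phi z * A z).
  exact: (average_translate_Fubini mphi phi0 phi1 (measurable_dilation eps) f1u u2).
by rewrite -/c; ring.
Qed.

(** f''(u) is bounded and the gradient square integrable. *)
Lemma integrable_hessian i j :
  mu.-integrable setT (fun x => (f2 (u x) * (Du x 0 i * Du x 0 j))%:E).
Proof.
have h : L2 mu (fun x => f2 (u x) * Du x 0 i).
  apply: (@L2_le _ _ _ _ _ (fun x => Du x 0 i) (M ^+ 2)) => //; first exact: sqr_ge0.
    apply: measurable_funM; last exact: (D2 i).1.
    by apply: (measurableT_comp (C2_measurable_derive2 f_C2)); exact: u2.1.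
  move=> x; rewrite exprMn ler_wpM2r ?sqr_ge0// -real_normK ?num_real//.
  by rewrite lerXn2r ?nnegrE.
have := integrable_mul h (D2 j).
by apply: eq_integrable => // x _; rewrite mulrA.
Qed.

Lemma Rintegral_quadratic (C : 'I_n -> 'I_n -> R) (G : 'I_n -> 'I_n -> 'rV[R]_n -> R) :
  (forall i j, mu.-integrable setT (fun x => (G i j x)%:E)) ->
  \int[mu]_x (\sum_i \sum_j C i j * G i j x) = \sum_i \sum_j C i j * \int[mu]_x G i j x.
Proof.
move=> iG.
have iC i j : mu.-integrable setT (fun x => (C i j * G i j x)%:E).
  exact: (integrableZl measurableT (C i j) (iG i j)).
rewrite Rintegral_sum.
  apply: eq_bigr => i _; rewrite Rintegral_sum//; apply: eq_bigr => j _.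
  by rewrite RintegralZl//; exact: iG.
move=> i; rewrite (_ : (fun x => _) = (fun x => \sum_j (C i j * G i j x)%:E)%E).
  by apply: integrable_sum => // j _.
by apply/funext => x; rewrite sumEFin.
Qed.

(** A quadratic form in z, so that its average depends on the kernel only through
    the second moments. *)
Lemma limit_energyE z : limit_energy f u Du z =
  \sum_i \sum_j (2^-1 * \int[mu]_x (f2 (u x) * (Du x 0 i * Du x 0 j))) * (z 0 i * z 0 j).
Proof.
rewrite /limit_energy.
transitivity (\int[mu]_x \sum_i \sum_j (2^-1 * (z 0 i * z 0 j)) * (f2 (u x) * (Du x 0 i * Du x 0 j))).
  apply: eq_Rintegral => x _; rewrite expr2 /dotv big_distrlr/= mulr_sumr.
  by apply: eq_bigr => i _; rewrite mulr_sumr; apply: eq_bigr => j _; ring.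
rewrite Rintegral_quadratic; last exact: integrable_hessian.
by apply: eq_bigr => i _; apply: eq_bigr => j _; ring.
Qed.

(** The quadratic form [limit_energyE] averaged over z: its coefficients stay and the
    monomials z_i z_j become the second moments. *)
Lemma integral_limit_energy :
  \int[mu]_z (phi z * limit_energy f u Du z) =
  2^-1 * \int[mu]_x (f2 (u x) * dotv (Du x) (apply_mx (second_moment phi) (Du x))).
Proof.
pose B i j := \int[mu]_x (f2 (u x) * (Du x 0 i * Du x 0 j)).
transitivity (\int[mu]_z \sum_i \sum_j (2^-1 * B i j) * (z 0 i * z 0 j * phi z)).
  apply: eq_Rintegral => z _; rewrite limit_energyE mulr_sumr.
  by apply: eq_bigr => i _; rewrite mulr_sumr; apply: eq_bigr => j _; rewrite /B; ring.
rewrite Rintegral_quadratic; last exact: (integrable_second_moment mphi phi0 phi_mom2).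
transitivity (2^-1 * \int[mu]_x \sum_i \sum_j second_moment phi i j *
    (f2 (u x) * (Du x 0 i * Du x 0 j))).
  rewrite Rintegral_quadratic; last exact: integrable_hessian.
  rewrite mulr_sumr; apply: eq_bigr => i _; rewrite mulr_sumr; apply: eq_bigr => j _.
  rewrite mxE -/(B i j) (_ : \int[mu]_y (tensor y y i j * phi y) =
     \int[mu]_y (y 0 i * y 0 j * phi y)); first by ring.
  by apply: eq_Rintegral => y _; rewrite mxE.
congr (_ * _); apply: eq_Rintegral => x _; rewrite /dotv /apply_mx mulr_sumr.
apply: eq_bigr => i _; rewrite mxE !mulr_sumr; apply: eq_bigr => j _.
by rewrite [_^T j i]mxE; ring.
Qed.

Lemma translate_energy_integral_cvg (e : nat -> R) : (forall k, 0 < e k) ->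
  e k @[k --> \oo] --> 0 ->
  \int[mu]_z (phi z * translate_energy f u (e k) z) @[k --> \oo] -->
  \int[mu]_z (phi z * limit_energy f u Du z).
Proof.
move=> e0 ec.
have mte k : measurable_fun setT (translate_energy f u (e k)).
  apply: (@measurable_Rintegral2 _ _ _ _ _ mu (fun p : 'rV[R]_n * 'rV[R]_n =>
    e k ^- 2 * taylor_rem f (u (p.2 - e k *: p.1)) (u p.2))).
  apply: measurable_funM => //; apply: (measurable_taylor_rem f_C2).
    exact: (measurableT_comp (measurable_pair_shift (measurable_dilation (e k)) u2.1)
      (measurable_fun_pair measurable_snd measurable_fst)).
  exact: measurableT_comp u2.1 measurable_snd.
have mle : measurable_fun setT (limit_energy f u Du).
  rewrite (_ : limit_energy f u Du = fun z => \sum_i \sum_j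
      (2^-1 * \int[mu]_x (f2 (u x) * (Du x 0 i * Du x 0 j))) * (z 0 i * z 0 j)); last first.
    by apply/funext => z; rewrite limit_energyE.
  apply: measurable_sum => i; apply: measurable_sum => j; apply: measurable_funM => //.
  by apply: measurable_funM; exact: measurable_rV_coord.
have [||||il _ h] := @dominated_convergence _ _ _ mu setT measurableT
  (fun k z => (phi z * translate_energy f u (e k) z)%:E)
  (fun z => (phi z * limit_energy f u Du z)%:E)
  _ _ _ _ (integrable_weight_mom2 mphi phi0 phi_mom2 wD (10 * M)) _.
- by move=> k; apply/measurable_EFinP; exact: measurable_funM.
- by apply/measurable_EFinP; exact: measurable_funM.
- apply: nearW => z _; apply: cvg_EFin; first exact: nearW.
  have := translate_energy_cvg f_C2 fM u2 wD (z := z) e0 ec.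
  by move=> /(cvgM (cvg_cst (phi z))); exact.
- apply: nearW => z k _; rewrite abse_EFin normrM (ger0_norm (phi0 z)) EFinM muleCA.
  rewrite lee_wpmul2l ?lee_fin//.
  apply: le_trans (translate_energy_bound f_C2 fM u2 wD z (e0 k)) _.
  by rewrite lee_wpmul2l ?lee_fin ?mulr_ge0//; exact: sqint_dotv_le.
rewrite /Rintegral; apply: fine_cvg; rewrite fineK//.
exact: integrable_fin_num.
Qed.

(** The remainder is quadratic in u_eps - u, which is o(eps). *)
Lemma mean_dilate_rem_cvg0 (e : nat -> R) : (forall k, 0 < e k) ->
  e k @[k --> \oo] --> 0 ->
  \int[mu]_x (e k ^- 2 * taylor_rem f (mean_dilate phi (e k) u x) (u x))
    @[k --> \oo] --> 0.
Proof.
move=> e0 ec.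
have h := mean_dilate_error_cvg0 mphi phi0 phi1 phi_mean phi_mom2 u2 wD e0 ec.
have := cvgeZl (isT : M%:E \is a fin_num) h; rewrite mule0 => /fine_cvgP[_ hM].
apply/norm_cvg0P; apply: (squeeze_cvgr (f := fun=> 0)); [|exact: cvg_cst|exact: hM].
apply: nearW => k /=; rewrite normr_ge0/=.
have v2 := L2_mean_dilate mphi phi0 phi1 phi_mean phi_mom2 u2 wD (e0 k).
set q := fun x => (e k)^-1 * (mean_dilate phi (e k) u x - u x).
have q2 : L2 mu q by apply: L2Z; exact: L2B.
have [iT _] := Rintegral_taylor_rem v2 u2.
have ie := integrableZl measurableT (e k ^- 2) iT.
have iM := integrableZl measurableT M (integrable_sqr q2).
apply: le_trans (le_normr_Rintegral measurableT ie) _.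
have -> : fine (M%:E * sqint mu q)%E = \int[mu]_x (M * q x ^+ 2).
  rewrite RintegralZl//; last exact: integrable_sqr.
  by rewrite fineM// ge0_fin_numE ?sqint_ge0//; case: q2.
apply: le_Rintegral => //; first exact: integrable_norm.
move=> x _; rewrite normrM ger0_norm; last by rewrite invr_ge0 exprn_ge0// ltW.
rewrite /q exprMn exprVn mulrCA; apply: ler_wpM2l.
  by rewrite invr_ge0 exprn_ge0// ltW.
exact: (taylor_rem_le f_C2 fM).
Qed.

Theorem energy_cvg :
  (eps ^- 2 * \int[mu]_x (f (u x) - f (convolution u (rescale eps phi) x)))
     @[eps --> 0^'+] -->
  2^-1 * \int[mu]_x (f2 (u x) * dotv (Du x) (apply_mx (second_moment phi) (Du x))).
Proof.
apply/cvg_at_rightP => e [e0 ec].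
rewrite -integral_limit_energy -[X in _ --> X]subr0.
rewrite (_ : (fun k => _) = (fun k => \int[mu]_z (phi z * translate_energy f u (e k) z) -
    \int[mu]_x (e k ^- 2 * taylor_rem f (mean_dilate phi (e k) u x) (u x)))).
  by apply: cvgB; [exact: translate_energy_integral_cvg|exact: mean_dilate_rem_cvg0].
apply/funext => k; rewrite -(energy_identity (e0 k)).
by rewrite (convolution_rescale mphi (e0 k) u2.1).
Qed.

End energy_limit.

(** * Polar coordinates for functions of the norm *)

Section density.
Context d (T : measurableType d) (R : realType).
Variables (m : {measure set T -> \bar R}) (D : T -> R).
Hypotheses (mD : measurable_fun setT D) (D0 : forall x, 0 <= D x).

(** The measurability and sign conditions are arguments so that the measure
    structure can be attached to this function. *)
Definition density_of (mD : measurable_fun setT D) (D0 : forall x, 0 <= D x) (A : set T) : \bar R :=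
  (\int[m]_(x in A) (D x)%:E)%E.

Local Notation nu := (density_of mD D0).

Let mDE : measurable_fun setT (EFin \o D). Proof. exact/measurable_EFinP. Qed.
Let DE0 x : (0 <= (EFin \o D) x)%E. Proof. by rewrite lee_fin. Qed.

Let density0 : nu set0 = 0%E. Proof. exact: integral_set0. Qed.

Let density_ge0 A : (0 <= nu A)%E. Proof. by apply: integral_ge0 => x _; exact: DE0. Qed.

Let density_sigma_additive : semi_sigma_additive nu.
Proof. exact: semi_sigma_additive_nng_induced. Qed.

HB.instance Definition _ := isMeasure.Build _ _ _ nu
  density0 density_ge0 density_sigma_additive.

Import HBNNSimple.

Let integral_density_nnsfun (g : {nnsfun T >-> R}) :
  (\int[nu]_x (g x)%:E = \int[m]_x ((g x)%:E * (D x)%:E))%E.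
Proof.
rewrite integralT_nnsfun sintegralE.
transitivity (\int[m]_x (\sum_(r \in range g) (r * \1_(g @^-1` [set r]) x)%:E * (D x)%:E))%E; last first.
  apply: eq_integral => x _; rewrite [in RHS]fimfunE -fsumEFin// ge0_mule_fsuml//.
  by move=> r; rewrite EFinM nnfun_muleindic_ge0.
rewrite ge0_integral_fsum//; last 2 first.
- move=> r; apply: emeasurable_funM => //; apply/measurable_EFinP.
  by apply: measurable_funM => //; apply: measurable_indic.
- move=> r x _; apply: mule_ge0; last exact: DE0.
  by rewrite EFinM nnfun_muleindic_ge0.
apply: eq_fsbigr => r /set_mem[y _ gy].
have r0 : 0 <= r by rewrite -gy.
under [RHS]eq_integral do rewrite EFinM -muleA.
rewrite ge0_integralZl//; last 2 first.
- by apply: emeasurable_funM => //; apply/measurable_EFinP; exact: measurable_indic.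
- by move=> x _; apply: mule_ge0; [rewrite lee_fin|exact: DE0].
congr (_ * _)%E; transitivity (\int[m]_(x in g @^-1` [set r]) (D x)%:E)%E => //.
rewrite [LHS]integral_mkcond; apply: eq_integral => x _.
by rewrite patchE indicE; case: (x \in _); rewrite ?mul1e ?mul0e.
Qed.

(** First for simple functions, then by monotone convergence. *)
Lemma ge0_integral_density (h : T -> \bar R) : measurable_fun setT h ->
  (forall x, 0 <= h x)%E ->
  (\int[nu]_x h x = \int[m]_x (h x * (D x)%:E))%E.
Proof.
move=> mh h0; pose g := nnsfun_approx measurableT mh.
have gh x : EFin \o (fun k => g k x) @ \oo --> h x by exact: cvg_nnsfun_approx.
have gnd x : {homo (fun k => (g k x)%:E) : a b / (a <= b)%N >-> (a <= b)%E}.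
  by move=> a b ab; rewrite lee_fin; exact/lefP/nd_nnsfun_approx.
transitivity (limn (fun k => \int[nu]_x (g k x)%:E))%E.
  rewrite -monotone_convergence//=.
  - by apply: eq_integral => x _; apply/esym/cvg_lim => //; exact: gh.
  - by move=> k; exact/measurable_EFinP.
  - by move=> k x _; rewrite lee_fin.
transitivity (limn (fun k => \int[m]_x ((g k x)%:E * (D x)%:E)))%E.
  by apply: congr_lim; apply/funext => k; exact: integral_density_nnsfun.
rewrite -monotone_convergence//=.
- apply: eq_integral => x _; apply/cvg_lim => //; apply: cvgeZr => //; exact: gh.
- by move=> k; apply: emeasurable_funM => //; exact/measurable_EFinP.
- by move=> k x _; apply: mule_ge0; [rewrite lee_fin|exact: DE0].
- by move=> x _ a b ab; rewrite lee_wpmul2r ?lee_fin//; exact: gnd.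
Qed.

End density.

Section polar_coordinates.
Variables (R : realType) (n : nat).
Hypothesis n_gt0 : (0 < n)%N.
Local Notation mu := (lebesgue_rV R n).
Local Notation leb := (@lebesgue_measure R).
Implicit Types (x y : 'rV[R]_n) (r : R).
Local Notation omega := (unit_ball_volume R n).

Lemma enormZ r y : enorm (r *: y) = `|r| * enorm y.
Proof.
rewrite /enorm -sqrtr_sqr -sqrtrM ?sqr_ge0//; congr Num.sqrt.
by rewrite mulr_sumr; apply: eq_bigr => i _; rewrite mxE exprMn.
Qed.

Lemma measurable_ball r : measurable [set y : 'rV[R]_n | enorm y < r].
Proof.
have := @measurable_enorm R n measurableT _ (measurable_itv `]-oo, r[%R).
by rewrite setTI (_ : _ @^-1` _ = [set y | enorm y < r]).
Qed.

Lemma unit_ball_fin : mu [set y | enorm y < 1] \is a fin_num.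
Proof.
rewrite ge0_fin_numE//; apply: le_lt_trans (lebesgue_open_box_lty (fun=> - 1%:R) (fun=> 1%:R)).
apply: le_measure.
- by apply/mem_set; exact: measurable_ball.
- by apply/mem_set; exact: measurable_open_box.
move=> y /= y1; apply: (@mem_cube _ _ 1) => i; apply: le_lt_trans y1.
by rewrite -(ler_pXn2r (n := 2))// ?nnegrE ?enorm_ge0// real_normK ?num_real// coord_sqr_le.
Qed.

Lemma unit_ball_volumeE : mu [set y | enorm y < 1] = omega%:E.
Proof. by rewrite fineK// unit_ball_fin. Qed.

Lemma unit_ball_volume_ge0 : 0 <= omega.
Proof. exact: fine_ge0. Qed.

(** Dilation of the unit ball. *)
Lemma ball_volume r : 0 < r -> mu [set y | enorm y < r] = (omega * r ^+ n)%:E.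
Proof.
move=> r0; have mB := measurable_ball r.
transitivity (\int[mu]_y (\1_[set y | enorm y < r] y)%:E)%E.
  by rewrite integral_indic// setIT.
rewrite (ge0_integral_dilate r0)//; last first.
  by apply/measurable_EFinP; exact: measurable_indic.
rewrite mulrC EFinM -unit_ball_volumeE; congr (_ * _)%E.
transitivity (\int[mu]_y (\1_[set y | enorm y < 1] y)%:E)%E; last first.
  by rewrite integral_indic ?setIT//; exact: measurable_ball.
apply: eq_integral => y _; rewrite !indicE.
suff -> : (r *: y \in [set y | enorm y < r]) = (y \in [set y | enorm y < 1]) by [].
have E : (enorm (r *: y) < r) = (enorm y < 1).
  by rewrite enormZ gtr0_norm// -ltr_pdivlMl// mulVf// gt_eqF.
by apply/idP/idP => /set_mem/= h; apply/mem_set; rewrite /= ?E// -E.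
Qed.

(** The derivative of omega_n r^n, the volume of the ball of radius r. *)
Definition sphere_area (r : R) : R := if 0 <= r then n%:R * omega * r ^+ n.-1 else 0.

Lemma measurable_sphere_area : measurable_fun setT sphere_area.
Proof.
rewrite (_ : sphere_area = fun r => \1_(`[0, +oo[%classic) r * (n%:R * omega * r ^+ n.-1)).
  apply: measurable_funM; first exact: measurable_indic.
  by apply: measurable_funM => //; exact: measurable_funX.
apply/funext => r; rewrite /sphere_area indicE mem_setE in_itv/= andbT.
by case: ifP; rewrite ?mul1r ?mul0r.
Qed.

Lemma sphere_area_ge0 r : 0 <= sphere_area r.
Proof.
rewrite /sphere_area; case: ifP => // r0.
by rewrite mulr_ge0 ?exprn_ge0// mulr_ge0// unit_ball_volume_ge0.
Qed.

Lemma integral_sphere_area r : 0 < r ->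
  (\int[leb]_(t in `]-oo, r[) (sphere_area t)%:E = (omega * r ^+ n)%:E)%E.
Proof.
move=> r0.
have -> : (\int[leb]_(t in `]-oo, r[) (sphere_area t)%:E =
    \int[leb]_(t in `[0%R, r[) (n%:R * omega * t ^+ n.-1)%:E)%E.
  rewrite integral_mkcond [RHS]integral_mkcond; apply: eq_integral => t _.
  rewrite !patchE !mem_setE !in_itv/= /sphere_area.
  by case: (leP 0 t) => //=; case: (t < r).
rewrite integral_itv_bndo_bndc; last first.
  by apply/measurable_EFinP/measurable_funTS; apply: measurable_funM => //; exact: measurable_funX.
have dF (t : R) : is_derive t (1 : R) (fun t : R => omega * t ^+ n) (n%:R * omega * t ^+ n.-1).
  have dX := @is_deriveX R R id n t 1 1 (is_derive_id t (1 : R)).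
  apply: (is_derive_ext (is_deriveM (is_derive_cst omega t (1 : R)) dX)).
    by move=> s; rewrite exprfctE.
  by rewrite /GRing.scale/= mulr0 addr0 mulr1 mulrA [omega * _]mulrC.
have cF := is_derive_continuous dF.
rewrite (@continuous_FTC2 R _ (fun t => omega * t ^+ n) 0 r r0).
- by rewrite expr0n gtn_eqF// mulr0 sube0.
- apply: continuous_subspaceT => t; apply: cvgM; first exact: cvg_cst.
  exact: exprn_continuous.
- split.
  + by move=> t _; case: (dF t).
  + by apply: cvg_at_right_filter; exact: cF.
  + by apply: cvg_at_left_filter; exact: cF.
- by move=> t _; rewrite derive1E; case: (dF t).
Qed.

Let menorm : measurable_fun setT (@enorm R n : _ -> measurableTypeR R).
Proof. exact: measurable_enorm. Qed.

(** The half-lines ]-oo, r[ generate the Borel sets, and on them the equality is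
    the volume of the ball of radius r. *)
Lemma pushforward_enorm (A : set (measurableTypeR R)) : measurable A ->
  pushforward mu (@enorm R n) A = density_of leb measurable_sphere_area sphere_area_ge0 A.
Proof.
move=> mA; have eqG (B : set R) : @RGenInftyO.G R B -> pushforward mu (@enorm R n) B =
    density_of leb measurable_sphere_area sphere_area_ge0 B.
  move=> [r ->].
  have -> : pushforward mu (@enorm R n) `]-oo, r[%classic = mu [set y | enorm y < r].
    by congr (mu _); apply/seteqP; split => y /=; rewrite in_itv.
  have [r0|r0] := ltP 0 r.
    by rewrite ball_volume// -integral_sphere_area.
  have -> : [set y : 'rV[R]_n | enorm y < r] = set0.
    apply/seteqP; split => y //= yr; have := le_lt_trans (enorm_ge0 y) yr.
    by rewrite ltNge r0.
  rewrite measure0; symmetry; apply: integral0_eq => t; rewrite /= in_itv/= => tr.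
  by rewrite /sphere_area leNgt (lt_le_trans tr r0).
pose nu1 : {measure set (measurableTypeR R) -> \bar R} :=
  measure_function_pushforward__canonical__measure_function_Measure mu menorm.
pose nu2 : {measure set (measurableTypeR R) -> \bar R} := density_of leb measurable_sphere_area sphere_area_ge0.
apply: (@measure_unique _ R (measurableTypeR R) (@RGenInftyO.G R) (fun k => `]-oo, k%:R[%classic) _ _ _ _ nu1 nu2 _ _ A mA) => //.
- exact: RGenInftyO.measurableE.
- move=> _ _ [r ->] [s ->]; exists (Num.min r s).
  by apply/seteqP; split => t /=; rewrite !in_itv/= lt_min; [move=> [-> ->]|move=> /andP[-> ->]].
- by move=> k; exists k%:R.
- rewrite -subTset => t _; exists (Num.truncn `|t|).+1 => //=.
  by rewrite in_itv/=; apply: le_lt_trans (ler_norm t) (truncnS_gt _).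
- move=> k; rewrite [X in (X < _)%E]eqG; last by exists k%:R.
  case: k => [|k].
    by rewrite /density_of integral0_eq// => t; rewrite /= in_itv/= /sphere_area leNgt => ->.
  by rewrite /density_of integral_sphere_area// ltry.
Qed.

Lemma ge0_integral_polar (h : R -> \bar R) : measurable_fun setT h ->
  (forall r, 0 <= h r)%E ->
  (\int[mu]_y h (enorm y) = \int[leb]_r (h r * (sphere_area r)%:E))%E.
Proof.
move=> mh h0.
rewrite -(ge0_integral_density leb measurable_sphere_area sphere_area_ge0 mh h0).
pose nu1 : {measure set (measurableTypeR R) -> \bar R} :=
  measure_function_pushforward__canonical__measure_function_Measure mu menorm.
transitivity (\int[nu1]_r h r)%E.
  by symmetry; exact: (ge0_integral_pushforward menorm mu).
by apply: eq_measure_integral => A mA _; exact: pushforward_enorm.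
Qed.

End polar_coordinates.

(** * Radial kernels *)

Section radial_kernel.
Variables (R : realType) (n : nat).
Hypothesis n_gt0 : (0 < n)%N.
Local Notation mu := (lebesgue_rV R n).
Local Notation leb := (@lebesgue_measure R).
Variable phi : 'rV[R]_n -> R.
Hypotheses (mphi : measurable_fun setT phi) (phi0 : forall x, 0 <= phi x).
Hypothesis phi_mom2 : (\int[mu]_y (enorm y ^+ 2 * phi y)%:E < +oo)%E.
Variable phit : R -> R.
Hypothesis phiE : forall x : 'rV[R]_n, phi x = phit (enorm x).
Local Notation omega := (unit_ball_volume R n).
Implicit Types (x y z : 'rV[R]_n) (i j k : 'I_n).

Lemma enorm_axis_map (s : {perm 'I_n}) (c : 'I_n -> R) y : (forall i, c i ^+ 2 = 1) ->
  enorm (axis_map s c (fun=> 0) y) = enorm y.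
Proof.
move=> c1; rewrite /enorm [in RHS](reindex_inj (@perm_inj _ s))/=; congr Num.sqrt.
by apply: eq_bigr => i _; rewrite mxE addr0 exprMn c1 mul1r.
Qed.

Lemma measurable_second_moment i j : measurable_fun setT (fun z => z 0 i * z 0 j * phi z).
Proof. by apply: measurable_funM => //; apply: measurable_funM; exact: measurable_rV_coord. Qed.

(** The reflection of the i-th coordinate preserves the norm and changes the sign
    of the integrand. *)
Lemma second_moment_offdiag i j : i != j -> \int[mu]_z (z 0 i * z 0 j * phi z) = 0.
Proof.
move=> ij; pose c k : R := if k == i then -1 else 1.
have c2 k : c k ^+ 2 = 1 by rewrite /c; case: eqP; rewrite ?sqrrN expr1n.
have c0 k : c k != 0 by rewrite -sqrf_eq0 c2 oner_eq0.
have := Rintegral_axis_map 1 (fun=> 0) c0 (measurable_second_moment i j).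
rewrite big1 ?mul1r; last by move=> k _; rewrite /c; case: eqP; rewrite ?normrN normr1.
have -> : \int[mu]_x (axis_map 1 c (fun=> 0) x 0 i * axis_map 1 c (fun=> 0) x 0 j *
    phi (axis_map 1 c (fun=> 0) x)) = \int[mu]_x (- 1 * (x 0 i * x 0 j * phi x)).
  apply: eq_Rintegral => x _; rewrite !phiE enorm_axis_map// !mxE !perm1 /c eqxx.
  by rewrite eq_sym (negbTE ij); ring.
rewrite RintegralZl//; last exact: (integrable_second_moment mphi phi0 phi_mom2).
by move=> h; lra.
Qed.

(** The exchange of the coordinates i and k preserves the norm. *)
Lemma second_moment_swap i k :
  \int[mu]_z (z 0 i * z 0 i * phi z) = \int[mu]_z (z 0 k * z 0 k * phi z).
Proof.
have one0 (l : 'I_n) : (fun=> 1 : R) l != 0 by exact: oner_neq0.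
have := Rintegral_axis_map (tperm i k) (fun=> 0) one0 (measurable_second_moment i i).
rewrite big1 ?mul1r; last by move=> _ _; rewrite normr1.
move=> ->; apply: eq_Rintegral => x _.
rewrite !phiE enorm_axis_map; last by move=> _; rewrite expr1n.
by rewrite !mxE tpermL; ring.
Qed.

(** The trace of the second moment matrix, all of whose diagonal entries are
    equal. *)
Lemma mom2_coord i :
  \int[mu]_z (enorm z ^+ 2 * phi z) = n%:R * \int[mu]_z (z 0 i * z 0 i * phi z).
Proof.
transitivity (\int[mu]_z \sum_(k < n) (z 0 k * z 0 k * phi z)).
  by apply: eq_Rintegral => z _; rewrite enorm_sqr mulr_suml; apply: eq_bigr => k _; rewrite expr2.
rewrite Rintegral_sum; last by move=> k; exact: (integrable_second_moment mphi phi0 phi_mom2).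
rewrite (eq_bigr (fun=> \int[mu]_z (z 0 i * z 0 i * phi z))).
  by rewrite sumr_const card_ord mulr_natl.
by move=> k _; exact: second_moment_swap.
Qed.

(** The radial integrand is expressed through the values of phi on a coordinate
    half-line, where it is measurable.  The density n omega_n r^(n-1) of the norm
    accounts for the exponent n + 1 of the radial integral and for the factor n. *)
Lemma mom2_polar : \int[mu]_z (enorm z ^+ 2 * phi z) = n%:R * radial_coef n phit.
Proof.
pose e1 : 'rV[R]_n := delta_mx 0 (Ordinal n_gt0).
have e1E r : enorm (r *: e1) = `|r|.
  rewrite enormZ /enorm (bigD1 (Ordinal n_gt0))//= big1 ?addr0.
    by rewrite mxE !eqxx expr1n sqrtr1 mulr1.
  by move=> k ki; rewrite mxE (negbTE ki) andbF expr0n.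
pose H r := (r ^+ 2 * phi (r *: e1))%:E.
have mray : measurable_fun setT (fun r : measurableTypeR R => phi (r *: e1)).
  exact: (measurableT_comp mphi (measurable_segment e1)).
have mH : measurable_fun setT (H : measurableTypeR R -> \bar R).
  by apply/measurable_EFinP; apply: measurable_funM => //; exact: measurable_funX.
have H0 r : (0 <= H r)%E by rewrite lee_fin mulr_ge0// sqr_ge0.
pose K r := (\1_(`[0, +oo[%classic) r * (r ^+ n.+1 * phi (r *: e1)))%:E.
have mK : measurable_fun setT (K : measurableTypeR R -> \bar R).
  apply/measurable_EFinP; apply: measurable_funM; first exact: measurable_indic.
  by apply: measurable_funM => //; exact: measurable_funX.
have K0 r : (0 <= K r)%E.
  rewrite /K indicE mem_setE in_itv/= andbT lee_fin; case: (leP 0 r) => r0.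
    by rewrite mul1r mulr_ge0// exprn_ge0.
  by rewrite mul0r.
have KE : (\int[leb]_(r in `[0%R, +oo[) (r ^+ n.+1 * phit r)%:E = \int[leb]_r K r)%E.
  rewrite integral_mkcond; apply: eq_integral => r _.
  rewrite patchE /K indicE mem_setE in_itv/= andbT.
  case: (leP 0 r) => r0; last by rewrite mul0r.
  by rewrite mul1r phiE e1E ger0_norm.
have E : (\int[mu]_z (enorm z ^+ 2 * phi z)%:E =
    (n%:R * omega)%:E * \int[leb]_(r in `[0%R, +oo[) (r ^+ n.+1 * phit r)%:E)%E.
  transitivity (\int[mu]_z H (enorm z))%E.
    apply: eq_integral => z _; rewrite /H; congr ((_ * _)%:E).
    by rewrite !phiE e1E ger0_norm// enorm_ge0.
  rewrite (ge0_integral_polar n_gt0)// KE -ge0_integralZl//; last first.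
    by rewrite lee_fin mulr_ge0// unit_ball_volume_ge0.
  apply: eq_integral => r _.
  rewrite /K indicE mem_setE in_itv/= andbT /H /sphere_area.
  case: (leP 0 r) => r0; last by rewrite !(mul0r, mule0, mulr0, mul0e).
  rewrite -!EFinM mul1r; congr EFin.
  move: (phi _) => p; have -> : r ^+ n.+1 = r ^+ 2 * r ^+ n.-1.
    by rewrite -exprD add2n prednK.
  ring.
have c0 : 0 <= n%:R * omega by rewrite mulr_ge0// unit_ball_volume_ge0.
rewrite /radial_coef mulrA {1}/Rintegral E /Rintegral KE.
have X0 : (0 <= \int[leb]_r K r)%E by exact: integral_ge0.
move: X0; case: (integral _ _ _) => [r| |]//= _.
have [->|cn] := eqVneq (n%:R * omega) 0; first by rewrite mul0e mul0r.
by rewrite gt0_muley ?lte_fin ?lt_neqAle ?c0 1?eq_sym ?cn//= mulr0.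
Qed.

(** The off-diagonal entries vanish and the diagonal ones are equal, so the trace
    determines the matrix. *)
Lemma second_moment_radial : second_moment phi = (radial_coef n phit)%:M.
Proof.
apply/matrixP => i j; rewrite !mxE.
have -> : \int[mu]_y (tensor y y i j * phi y) = \int[mu]_y (y 0 i * y 0 j * phi y).
  by apply: eq_Rintegral => y _; rewrite mxE.
have [->|ij] := eqVneq i j; last by rewrite second_moment_offdiag.
have n0 : n%:R != 0 :> R by rewrite pnatr_eq0 -lt0n.
by apply: (mulfI n0); rewrite -mom2_coord mom2_polar mulr1n.
Qed.

End radial_kernel.

Theorem theorem1p1 (R : realType) (n : nat) (n_gt0 : (0 < n)%N)
    (f : R -> R) (f_C2 : C2 f)
    (f_bnd : exists M : R, forall x : R, `|f^`(2) x| <= M)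
    (f_0 : f 0 = 0) (df_0 : f^`() 0 = 0)
    (phi : 'rV[R]_n -> R)
    (phi_L1 : phi \in Lfun (lebesgue_rV R n) 1%:E)
    (phi_ge0 : forall x : 'rV[R]_n, 0 <= phi x)
    (phi_mass : \int[lebesgue_rV R n]_y phi y = 1)
    (phi_mean : forall i : 'I_n, \int[lebesgue_rV R n]_y (y 0 i * phi y) = 0)
    (phi_mom2 :
      (\int[lebesgue_rV R n]_y (enorm y ^+ 2 * phi y)%:E < +oo)%E) :
  (forall (u : 'rV[R]_n -> R) (Du : 'rV[R]_n -> 'rV[R]_n),
     W12 u -> weak_gradient_L2 u Du ->
     (eps ^- 2 * \int[lebesgue_rV R n]_x
        (f (u x) - f (convolution u (rescale eps phi) x))) @[eps --> 0^'+]
     --> 2^-1 * \int[lebesgue_rV R n]_x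
           ((f^`(2))%classic (u x) * dotv (Du x) (apply_mx (second_moment phi) (Du x))))
  /\
  (forall phit : R -> R,
     (forall r : R, 0 <= r -> 0 <= phit r) ->
     (forall x : 'rV[R]_n, phi x = phit (enorm x)) ->
     forall (u : 'rV[R]_n -> R) (Du : 'rV[R]_n -> 'rV[R]_n),
     W12 u -> weak_gradient_L2 u Du ->
     (eps ^- 2 * \int[lebesgue_rV R n]_x
        (f (u x) - f (convolution u (rescale eps phi) x))) @[eps --> 0^'+]
     --> 2^-1 * radial_coef n phit *
         \int[lebesgue_rV R n]_x ((f^`(2))%classic (u x) * enorm (Du x) ^+ 2)).
Proof.
have mphi : measurable_fun setT phi by exact: (set_mem (sub_Lfun_mfun phi_L1)).
have phi1 : (\int[lebesgue_rV R n]_y (phi y)%:E = 1)%E.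
  have iphi := (Lfun1_integrable _ _).1 phi_L1.
  by rewrite -[LHS]fineK ?(integrable_fin_num measurableT iphi)//; congr EFin.
have [M fM] := f_bnd.
have main u Du : W12 u -> weak_gradient_L2 u Du ->
     (eps ^- 2 * \int[lebesgue_rV R n]_x
        (f (u x) - f (convolution u (rescale eps phi) x))) @[eps --> 0^'+]
     --> 2^-1 * \int[lebesgue_rV R n]_x
           ((f^`(2))%classic (u x) * dotv (Du x) (apply_mx (second_moment phi) (Du x))).
  move=> [/Lfun2_L2 u2 _] wD.
  exact: (energy_cvg f_C2 fM f_0 df_0 mphi phi_ge0 phi1 phi_mean phi_mom2 u2 wD).
split => // phit _ phiE u Du uW wD.
have := main u Du uW wD.
suff -> : \int[lebesgue_rV R n]_x ((f^`(2))%classic (u x) *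
      dotv (Du x) (apply_mx (second_moment phi) (Du x))) =
    radial_coef n phit * \int[lebesgue_rV R n]_x ((f^`(2))%classic (u x) * enorm (Du x) ^+ 2).
  by rewrite mulrA.
have u2 := Lfun2_L2 uW.1.
have D2 i : L2 (lebesgue_rV R n) (fun x => Du x 0 i) by exact: Lfun2_L2 (wD i).1.
rewrite (second_moment_radial n_gt0 mphi phi_ge0 phi_mom2 phiE) -RintegralZl//.
  apply: eq_Rintegral => x _; rewrite /apply_mx tr_scalar_mx mul_mx_scalar enorm_sqr /dotv.
  rewrite mulrCA; congr (_ * _); rewrite mulr_sumr; apply: eq_bigr => i _.
  by rewrite mxE; ring.
rewrite (_ : _ \o _ = (fun x => \sum_(i < n) ((f^`(2))%classic (u x) * (Du x 0 i * Du x 0 i))%:E)%E).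
  by apply: integrable_sum => // i _; exact: (integrable_hessian f_C2 fM u2 wD).
by apply/funext => x; rewrite /= sumEFin -mulr_sumr enorm_sqr; congr (_ * _)%:E;
  apply: eq_bigr => i _; rewrite expr2.
Qed.
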